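(* Under the standing assumptions below, suppose in addition that $\liminf_{x\to\infty}h(x)>0$. Then there exist $\epsilon>0$ and constants $c>0$, $C<\infty$ such that, putting $M(x)=\sup_{1/\epsilon\le y\le x}h(y)$ for $x\ge1/\epsilon$, one has $M(x)<\infty$ for every such $x$, and for every $\eta\in(0,1]$ (with $C$ allowed to depend on $\eta$) and every pair of integers $m\ge1$, $n>m+\epsilon^{-\alpha/(\alpha+1)}$, $$b_mb_n\Big|P(S_m=\kappa_m,S_n=\kappa_n)-P(S_m=\kappa_m)P(S_n=\kappa_n)\Big|\le C L(n)\Big\{n^{1/\alpha}\big(e^{-(n-m)c}+e^{-nc}\big)+\frac{m/n}{(1-\frac mn)^{1+\frac1\alpha}}\big(1+M(n^{1+\frac1\alpha})\big)+\frac{(\frac mn)^{\eta/\alpha}L^\eta(m)}{(1-\frac mn)^{\frac{\eta+1}{\alpha}}}\Big\}.$$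
   Context: Standing assumptions: $(X_n)_{n\ge1}$ are i.i.d. real random variables whose common distribution $F$ is supported on a lattice $\{a+k:\ k\in\mathbb Z\}$ ($a\in\mathbb R$) with maximal span $1$; $S_n=X_1+\dots+X_n$. There exist $\alpha\in(0,2]$ with $\alpha\neq1$, constants $c_1,c_2\ge0$ with $c_1+c_2>0$, and a function $l$ slowly varying at infinity such that, as $x\to\infty$, $x^\alpha P(X_1>x)=(c_1+o(1))l(x)$ and $x^\alpha P(X_1\le -x)=(c_2+o(1))l(x)$. If $\alpha>1$, $E[X_1]=0$. Then $F$ is in the domain of attraction of an $\alpha$-stable law $G$: with $b_n=L(n)n^{1/\alpha}$, where $L$ is slowly varying, $S_n/b_n$ converges in distribution to $G$ (no centering constants needed). The characteristic function $\phi$ of $X_1$ satisfies, as $t\to0$, $\phi(t)=\exp\{-c|t|^\alpha h(1/|t|)(1-i\beta\,\mathrm{sign}(t)\tan\frac{\pi\alpha}{2})+o(|t|^\alpha h(1/|t|))\}$, where for $\alpha<2$: $h=l$, $c=\Gamma(1-\alpha)(c_1+c_2)\cos\frac{\pi\alpha}{2}>0$, $\beta=\frac{c_1-c_2}{c_1+c_2}$; and for $\alpha=2$: $c=1/2$, $\beta=0$, $h(x)=E[X_1^2\mathbf 1_{\{|X_1|\le x\}}]$. The function $h$ is slowly varying, determined up to asymptotic equivalence, and is chosen continuous on $[a_0,\infty)$ for some $a_0>0$; moreover $L(n)=h^{1/\alpha}(b_n)$ if $\alpha<2$ and $L(n)=\sqrt{h(b_n)}$ if $\alpha=2$. For each $n$,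 $\kappa_n$ is a point of the lattice $\{na+k:\ k\in\mathbb Z\}$ (where $S_n$ takes values), and $\kappa_n/b_n\to\kappa\in\mathbb R$ as $n\to\infty$. *)

(* Defs.v *)
From Stdlib Require Import Reals Lra ZArith ClassicalEpsilon.
Open Scope R_scope.

Definition Zsummable (f : Z -> R) (s : R) : Prop :=
  exists s1 s2,
    infinite_sum (fun n => f (Z.of_nat n)) s1 /\
    infinite_sum (fun n => f (- Z.of_nat (S n))%Z) s2 /\ s = s1 + s2.

(* Value of the sum over Z (meaningful when the two half-series converge). *)
Definition nat_series (u : nat -> R) : R :=
  epsilon (inhabits 0) (fun s => infinite_sum u s).
Definition Zsum (f : Z -> R) : R :=
  nat_series (fun n => f (Z.of_nat n)) + nat_series (fun n => f (- Z.of_nat (S n))%Z).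

(* Convolution of pmfs on Z and n-fold convolution powers (law of K_1+...+K_n). *)
Definition conv (p q : Z -> R) (k : Z) : R := Zsum (fun j => p j * q (k - j)%Z).
Fixpoint convpow (p : Z -> R) (n : nat) : Z -> R :=
  match n with
  | O => fun k => if Z.eq_dec k 0 then 1 else 0
  | S n' => conv (convpow p n') p
  end.

(* X = a + K, K with pmf p on Z. *)
Definition tail_right (p : Z -> R) (a x : R) : R :=
  Zsum (fun k => if Rlt_dec x (a + IZR k) then p k else 0).
Definition tail_left (p : Z -> R) (a x : R) : R :=
  Zsum (fun k => if Rle_dec (a + IZR k) (- x) then p k else 0).
Definition trunc_second_moment (p : Z -> R) (a x : R) : R :=
  Zsum (fun k => if Rle_dec (Rabs (a + IZR k)) x then (a + IZR k) ^ 2 * p k else 0).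
Definition mean (p : Z -> R) (a : R) : R := Zsum (fun k => (a + IZR k) * p k).

Definition lim_infty (f : R -> R) (l : R) : Prop :=
  forall eps, eps > 0 -> exists A, forall x, x > A -> Rabs (f x - l) < eps.

Definition slowly_varying (l : R -> R) : Prop :=
  (exists A, forall x, x > A -> l x > 0) /\
  forall lam, lam > 0 -> lim_infty (fun x => l (lam * x) / l x) 1.

Definition continuous_on_from (h : R -> R) (a0 : R) : Prop :=
  forall x, a0 <= x -> forall eps, eps > 0 ->
    exists delta, delta > 0 /\
      forall y, a0 <= y -> Rabs (y - x) < delta -> Rabs (h y - h x) < eps.

Definition max_span_one (p : Z -> R) : Prop :=
  forall d r : Z, (2 <= d)%Z -> ~ (forall k, 0 < p k -> (d | k - r)%Z).

Definition range_on (h : R -> R) (lo hi : R) : R -> Prop :=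
  fun v => exists y, lo <= y <= hi /\ v = h y.

(* Main.v *)
From Stdlib Require Import Reals Lra Lia ZArith ClassicalEpsilon.
From Coquelicot Require Import Coquelicot.
Require Import Defs.
Open Scope R_scope.

(** Let [phi] be the characteristic function of [X = a + K].  Fourier inversion
    turns the difference [P(S_(n-m) = kappa_n - kappa_m) - P(S_n = kappa_n)] into
    [1/pi] times the integral over [0, pi] of the real part of
    [phi^(n-m) e^(-it kappa_n) (e^(it kappa_m) - phi^m)].
    With [w(x) = E(X^2; |X| <= x)], the tail hypotheses give, for [x] large,
    [w(x) ~ x^(2-alpha) h(x)] up to constants, and for small [t > 0]
    [|phi(t)| <= exp(- c t^2 w(1/t))] and [|1 - phi(t)| <= C t^2 w(1/t)].
    No limit theorem is needed, and since the tails and [w] are monotone, dyadic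
    iteration replaces the uniform convergence theorem for slowly varying functions.
    On [0, eps] the integrand is bounded by
    [exp(- c (n-m) t^alpha) (2 (t |kappa_m|)^eta + m |1 - phi(t)|)], where
    [h(1/t) <= M(n^(1+1/alpha))] unless [t < n^(-1-1/alpha)], a range so short that
    [|1 - phi| <= 2] suffices.  On [eps, pi] the span condition gives
    [|phi| <= e^(-c)].  The factor [b_m P(S_m = kappa_m)] is bounded by the same
    inversion formula and a Potter-type lower bound on [w]. *)

(** * Absolutely convergent sums over the integers *)

(** Independence of the increments takes P(S_m = kappa_m) out of the covariance. This factor absorbs
    b_m, while b_n = L(n) n^(1/alpha) has to be paid for by the difference of the two local
    probabilities. The function l need not be monotone, unlike the tails and w, so the estimates
    pass through w and [h] is compared with w once. When alpha = 2, w may stay bounded, so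
    subtracting a constant from it relies on a strict gap, not on divergence. The hypothesis liminf
    h > 0 turns the decay exp(-c t^2 w(1/t)) into exp(-c t^alpha). Each integrand t^q exp(-k
    t^alpha) is then dominated by a multiple of 1/(1 + (t/s)^2) with s = k^(-1/alpha): its primitive
    is an arctangent, which yields the right order in k without improper integrals. The cut t_0 =
    n^(-1-1/alpha) is the scale at which n^(1/alpha) m t_0 = m/n, so the trivial bound below it
    costs no more than the middle term of the claim. The condition n > m + eps^(-alpha/(alpha+1))
    ensures 1/eps <= 1/t_0, so the supremum M is over a nonempty range. *)

Definition sumZ (f : Z -> R) : R :=
  Series (fun n => f (Z.of_nat n)) + Series (fun n => f (- Z.of_nat (S n))%Z).

Definition abs_summable (f : Z -> R) : Prop :=
  ex_series (fun n => Rabs (f (Z.of_nat n))) /\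
  ex_series (fun n => Rabs (f (- Z.of_nat (S n))%Z)).

Lemma nat_series_eq (u : nat -> R) : ex_series u -> nat_series u = Series u.
Proof.
  intros [s Hs]. unfold nat_series.
  assert (H : infinite_sum u (epsilon (inhabits 0) (fun s => infinite_sum u s))).
  { apply epsilon_spec. exists s. now apply is_series_Reals. }
  symmetry. apply is_series_unique. now apply is_series_Reals.
Qed.

(** Passage from the [epsilon]-chosen sums of the statement to the total function [Series];
    summability makes the chosen value the unique limit. *)
Lemma Zsum_eq (f : Z -> R) : abs_summable f -> Zsum f = sumZ f.
Proof.
  intros [H1 H2]. unfold Zsum, sumZ.
  rewrite !nat_series_eq; auto; now apply ex_series_Rabs.
Qed.

Lemma Zsummable_abs_summable (f : Z -> R) (s : R) :
  (forall k, 0 <= f k) -> Zsummable f s -> abs_summable f /\ sumZ f = s.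
Proof.
  intros Hf (s1 & s2 & H1 & H2 & ->).
  apply is_series_Reals in H1. apply is_series_Reals in H2.
  split; [split|].
  - exists s1. eapply is_series_ext; [|exact H1].
    intro n. cbv beta. now rewrite Rabs_pos_eq.
  - exists s2. eapply is_series_ext; [|exact H2].
    intro n. cbv beta. now rewrite Rabs_pos_eq.
  - unfold sumZ. now rewrite (is_series_unique _ _ H1), (is_series_unique _ _ H2).
Qed.

Lemma sumZ_ext (f g : Z -> R) : (forall k, f k = g k) -> sumZ f = sumZ g.
Proof. intro H. unfold sumZ. f_equal; apply Series_ext; auto. Qed.

Lemma abs_summable_ext (f g : Z -> R) : (forall k, f k = g k) -> abs_summable f -> abs_summable g.
Proof.
  intros H [H1 H2]; split; eapply ex_series_ext; [|exact H1| |exact H2];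
    intro n; cbv beta; now rewrite H.
Qed.

Lemma abs_summable_le (f g : Z -> R) : (forall k, Rabs (f k) <= g k) -> abs_summable g -> abs_summable f.
Proof.
  intros H [H1 H2]; split.
  - refine (ex_series_le (V := R_CompleteNormedModule) _ _ _ H1). intro n.
    change (Rabs (Rabs (f (Z.of_nat n))) <= Rabs (g (Z.of_nat n))).
    rewrite Rabs_Rabsolu. eapply Rle_trans; [apply H|apply Rle_abs].
  - refine (ex_series_le (V := R_CompleteNormedModule) _ _ _ H2). intro n.
    change (Rabs (Rabs (f (- Z.of_nat (S n))%Z)) <= Rabs (g (- Z.of_nat (S n))%Z)).
    rewrite Rabs_Rabsolu. eapply Rle_trans; [apply H|apply Rle_abs].
Qed.

Lemma abs_summable_abs (f : Z -> R) : abs_summable f -> abs_summable (fun k => Rabs (f k)).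
Proof.
  intros [H1 H2]; split; eapply ex_series_ext; [|exact H1| |exact H2];
    intro n; cbv beta; now rewrite Rabs_Rabsolu.
Qed.

Lemma abs_summable_scal (c : R) (f : Z -> R) : abs_summable f -> abs_summable (fun k => c * f k).
Proof.
  intros [H1 H2]; split.
  - eapply ex_series_ext; [|exact (ex_series_scal (Rabs c) _ H1)].
    intro n. cbv beta. now rewrite Rabs_mult.
  - eapply ex_series_ext; [|exact (ex_series_scal (Rabs c) _ H2)].
    intro n. cbv beta. now rewrite Rabs_mult.
Qed.

Lemma abs_summable_plus (f g : Z -> R) : abs_summable f -> abs_summable g -> abs_summable (fun k => f k + g k).
Proof.
  intros [F1 F2] [G1 G2].
  apply abs_summable_le with (g := fun k => Rabs (f k) + Rabs (g k)).
  { intro k. apply Rabs_triang. }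
  split.
  - eapply ex_series_ext; [|exact (ex_series_plus _ _ F1 G1)].
    intro n. symmetry. apply Rabs_pos_eq.
    apply Rplus_le_le_0_compat; apply Rabs_pos.
  - eapply ex_series_ext; [|exact (ex_series_plus _ _ F2 G2)].
    intro n. symmetry. apply Rabs_pos_eq.
    apply Rplus_le_le_0_compat; apply Rabs_pos.
Qed.

Lemma sumZ_plus (f g : Z -> R) :
  abs_summable f -> abs_summable g -> sumZ (fun k => f k + g k) = sumZ f + sumZ g.
Proof.
  intros [F1 F2] [G1 G2]. unfold sumZ.
  rewrite !Series_plus; try now apply ex_series_Rabs. ring.
Qed.

Lemma sumZ_scal (c : R) (f : Z -> R) : sumZ (fun k => c * f k) = c * sumZ f.
Proof. unfold sumZ. rewrite !Series_scal_l. ring. Qed.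

Lemma Series_le_gen (u v : nat -> R) :
  (forall n, u n <= v n) -> ex_series u -> ex_series v -> Series u <= Series v.
Proof.
  intros H Hu Hv.
  assert (H0 : 0 <= Series (fun n => v n - u n)).
  { rewrite <- (Rmult_0_l (Series (fun n => v n - u n))), <- Series_scal_l.
    apply Series_le; [|now apply (ex_series_minus v u)].
    intro n. specialize (H n). split; lra. }
  rewrite Series_minus in H0; auto. lra.
Qed.

Lemma sumZ_le (f g : Z -> R) :
  (forall k, f k <= g k) -> abs_summable f -> abs_summable g -> sumZ f <= sumZ g.
Proof.
  intros H [F1 F2] [G1 G2].
  apply Rplus_le_compat; apply Series_le_gen; auto; now apply ex_series_Rabs.
Qed.

Lemma sumZ_0 : sumZ (fun _ => 0) = 0.
Proof.
  transitivity (0 * sumZ (fun _ => 0)); [|ring].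
  rewrite <- sumZ_scal. apply sumZ_ext. intro; ring.
Qed.

Lemma sumZ_abs_le (f g : Z -> R) :
  (forall k, Rabs (f k) <= g k) -> abs_summable g -> Rabs (sumZ f) <= sumZ g.
Proof.
  intros H Hg. assert (Hf := abs_summable_le f g H Hg).
  apply Rabs_le. split.
  - replace (- sumZ g) with (sumZ (fun k => (-1) * g k)) by (rewrite sumZ_scal; ring).
    apply sumZ_le; auto; [|now apply abs_summable_scal].
    intro k. specialize (H k). apply Rabs_le_between in H. lra.
  - apply sumZ_le; auto. intro k. eapply Rle_trans; [apply Rle_abs|apply H].
Qed.

Lemma abs_summable_shift (f : Z -> R) : abs_summable f -> abs_summable (fun k => f (k + 1)%Z).
Proof.
  intros [F1 F2]. split.
  - apply ex_series_incr_1 in F1. eapply ex_series_ext; [|exact F1].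
    intro n. cbv beta. do 2 f_equal; lia.
  - apply ex_series_incr_1. eapply ex_series_ext; [|exact F2].
    intro n. cbv beta. do 2 f_equal; lia.
Qed.

Lemma abs_summable_refl (f : Z -> R) : abs_summable f -> abs_summable (fun k => f (- k)%Z).
Proof.
  intros [F1 F2]. split.
  - apply ex_series_incr_1. exact F2.
  - apply ex_series_incr_1 in F1. eapply ex_series_ext; [|exact F1].
    intro n. cbv beta. do 2 f_equal; lia.
Qed.

(** The term [f 0] leaves the nonnegative half-series and enters the negative one; everything else
    is a reindexing. *)
Lemma sumZ_shift (f : Z -> R) : abs_summable f -> sumZ (fun k => f (k + 1)%Z) = sumZ f.
Proof.
  intros Hf. destruct (abs_summable_shift f Hf) as [_ S2]. destruct Hf as [F1 F2].
  unfold sumZ.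
  rewrite (Series_incr_1 (fun n => f (Z.of_nat n))) by now apply ex_series_Rabs.
  rewrite (Series_incr_1 (fun n => f (- Z.of_nat (S n) + 1)%Z)) by now apply ex_series_Rabs.
  assert (E1 : Series (fun n => f (Z.of_nat n + 1)%Z) = Series (fun n => f (Z.of_nat (S n)))).
  { apply Series_ext. intro n. f_equal; lia. }
  assert (E2 : Series (fun n => f (- Z.of_nat (S (S n)) + 1)%Z)
               = Series (fun n => f (- Z.of_nat (S n))%Z)).
  { apply Series_ext. intro n. f_equal; lia. }
  rewrite E1, E2. change (- Z.of_nat 1 + 1)%Z with 0%Z. change (Z.of_nat 0) with 0%Z. ring.
Qed.

Lemma sumZ_refl (f : Z -> R) : abs_summable f -> sumZ (fun k => f (- k)%Z) = sumZ f.
Proof.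
  intros Hf. destruct (abs_summable_refl f Hf) as [S1 _]. destruct Hf as [F1 F2].
  unfold sumZ.
  rewrite (Series_incr_1 (fun n => f (Z.of_nat n))) by now apply ex_series_Rabs.
  rewrite (Series_incr_1 (fun n => f (- Z.of_nat n)%Z)) by now apply ex_series_Rabs.
  assert (E : Series (fun n => f (- - Z.of_nat (S n))%Z) = Series (fun n => f (Z.of_nat (S n)))).
  { apply Series_ext. intro n. f_equal; lia. }
  rewrite E. change (- Z.of_nat 0)%Z with 0%Z. change (Z.of_nat 0) with 0%Z. ring.
Qed.

Lemma abs_summable_sumZ_translate (f : Z -> R) (j : Z) :
  abs_summable f -> abs_summable (fun k => f (k + j)%Z) /\ sumZ (fun k => f (k + j)%Z) = sumZ f.
Proof.
  intro Hf. revert j.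
  assert (Hnat : forall (n : nat) g, abs_summable g ->
     abs_summable (fun k => g (k + Z.of_nat n)%Z) /\ sumZ (fun k => g (k + Z.of_nat n)%Z) = sumZ g).
  { induction n as [|n IH]; intros g Hg.
    - split; [apply abs_summable_ext with (2 := Hg)|apply sumZ_ext]; intro k; f_equal; lia.
    - destruct (IH g Hg) as [I1 I2]. split.
      + eapply abs_summable_ext; [|exact (abs_summable_shift _ I1)]. intro k. cbv beta. f_equal; lia.
      + rewrite <- I2, <- (sumZ_shift _ I1). apply sumZ_ext. intro k. f_equal; lia. }
  intro j. destruct (Z_le_gt_dec 0 j) as [Hj|Hj].
  - rewrite <- (Z2Nat.id j Hj). now apply Hnat.
  (* For negative [j]: reflect, translate by [- j], reflect back. *)
  - destruct (Hnat (Z.to_nat (- j)) _ (abs_summable_refl f Hf)) as [I1 I2].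
    split.
    + eapply abs_summable_ext; [|exact (abs_summable_refl _ I1)]. intro k. cbv beta. f_equal; lia.
    + rewrite <- (sumZ_refl f Hf), <- I2, <- (sumZ_refl _ I1).
      apply sumZ_ext. intro k. f_equal; lia.
Qed.

Lemma sumZ_subst (f : Z -> R) (j : Z) :
  abs_summable f -> abs_summable (fun k => f (j - k)%Z) /\ sumZ (fun k => f (j - k)%Z) = sumZ f.
Proof.
  intro Hf. destruct (abs_summable_sumZ_translate f j Hf) as [H1 H2]. split.
  - eapply abs_summable_ext; [|exact (abs_summable_refl _ H1)]. intro k. cbv beta. f_equal; lia.
  - rewrite <- H2, <- (sumZ_refl _ H1). apply sumZ_ext. intro k. f_equal; lia.
Qed.

Lemma Series_term_le (u : nat -> R) (n : nat) :
  (forall k, 0 <= u k) -> ex_series u -> u n <= Series u.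
Proof.
  revert u. induction n as [|n IH]; intros u Hu Hs; rewrite Series_incr_1 by assumption.
  - assert (0 <= Series (fun k => u (S k))); [|lra].
    rewrite <- (Rmult_0_l (Series (fun k => u (S k)))), <- Series_scal_l.
    apply Series_le; [|now apply ex_series_incr_1 in Hs].
    intro k. specialize (Hu (S k)). lra.
  - assert (u (S n) <= Series (fun k => u (S k))).
    { apply (IH (fun k => u (S k))); auto. now apply ex_series_incr_1 in Hs. }
    specialize (Hu O). lra.
Qed.

Lemma sumZ_term_le (f : Z -> R) (k : Z) : (forall i, 0 <= f i) -> abs_summable f -> f k <= sumZ f.
Proof.
  intros Hf [F1 F2]. apply ex_series_Rabs in F1. apply ex_series_Rabs in F2.
  assert (N1 := Series_term_le _ 0%nat (fun n => Hf (Z.of_nat n)) F1).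
  assert (N2 := Series_term_le _ 0%nat (fun n => Hf (- Z.of_nat (S n))%Z) F2).
  assert (P1 := Hf (Z.of_nat 0)). assert (P2 := Hf (- Z.of_nat 1)%Z). cbv beta in *.
  unfold sumZ. destruct (Z_le_gt_dec 0 k) as [Hk|Hk].
  - assert (N := Series_term_le _ (Z.to_nat k) (fun n => Hf (Z.of_nat n)) F1).
    cbv beta in N. rewrite Z2Nat.id in N by assumption. lra.
  - assert (N := Series_term_le _ (Z.to_nat (- k - 1)) (fun n => Hf (- Z.of_nat (S n))%Z) F2).
    cbv beta in N. replace (- Z.of_nat (S (Z.to_nat (- k - 1))))%Z with k in N by lia. lra.
Qed.


(** * Termwise continuity and integration of series *)

(** The majorant [u] carries no parameter, so for terms [f n t] the bound is uniform in [t]: this is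
    the Weierstrass test behind continuity and termwise integration. *)
Lemma Series_remainder_le (f u : nat -> R) (N : nat) :
  (forall n, Rabs (f n) <= u n) -> ex_series u ->
  Rabs (Series f - sum_n f N) <= Series u - sum_n u N.
Proof.
  intros H Hu.
  assert (Hf : ex_series (fun n => Rabs (f n))).
  { refine (ex_series_le (V := R_CompleteNormedModule) _ _ _ Hu). intro n.
    change (Rabs (Rabs (f n)) <= u n). now rewrite Rabs_Rabsolu. }
  assert (Hf' := ex_series_Rabs _ Hf).
  rewrite (Series_incr_n f (S N)), (Series_incr_n u (S N)) by (auto; lia).
  rewrite !sum_n_Reals. simpl pred.
  match goal with |- Rabs (?x + ?y - ?x) <= ?z + ?v - ?z =>
    replace (x + y - x) with y by ring; replace (z + v - z) with v by ring end.
  assert (Hu' : ex_series (fun k => u (S N + k)%nat)) by now apply ex_series_incr_n.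
  eapply Rle_trans; [apply Series_Rabs|].
  - refine (ex_series_le (V := R_CompleteNormedModule) _ _ _ Hu'). intro n.
    change (Rabs (Rabs (f (S N + n)%nat)) <= u (S N + n)%nat). now rewrite Rabs_Rabsolu.
  - apply Series_le; auto. intro n. split; [apply Rabs_pos|apply H].
Qed.

Lemma Series_remainder_small (u : nat -> R) (e : R) :
  ex_series u -> 0 < e -> exists N, forall n, (N <= n)%nat -> Rabs (Series u - sum_n u n) < e.
Proof.
  intros Hu He. assert (H := Series_correct _ Hu).
  apply is_series_Reals in H. destruct (H e He) as [N HN]. exists N. intros n Hn.
  specialize (HN n Hn). unfold Rdist in HN. rewrite sum_n_Reals, Rabs_minus_sym. exact HN.
Qed.

Lemma continuous_sum_n (f : nat -> R -> R) (N : nat) (x : R) :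
  (forall n, continuous (f n) x) -> continuous (fun t => sum_n (fun n => f n t) N) x.
Proof.
  intro H. induction N as [|N IH].
  - apply continuous_ext with (f O); [|apply H]. intro t. now rewrite sum_O.
  - apply continuous_ext with (fun t => plus (sum_n (fun n => f n t) N) (f (S N) t)).
    + intro t. now rewrite sum_Sn.
    + now apply (continuous_plus (fun t => sum_n (fun n => f n t) N)).
Qed.

Lemma continuous_Series (f : nat -> R -> R) (u : nat -> R) (x : R) :
  (forall n, continuous (f n) x) -> (forall n t, Rabs (f n t) <= u n) -> ex_series u ->
  continuous (fun t => Series (fun n => f n t)) x.
Proof.
  intros Hc Hb Hu. apply filterlim_locally. intros [e He].
  destruct (Series_remainder_small u (e / 3) Hu) as [N HN]; [lra|].
  specialize (HN N (le_n N)).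
  assert (Hr : forall t, Rabs (Series (fun n => f n t) - sum_n (fun n => f n t) N) < e / 3).
  { intro t. eapply Rle_lt_trans; [apply Series_remainder_le with (u := u); auto|].
    eapply Rle_lt_trans; [apply Rle_abs|exact HN]. }
  assert (Hs := continuous_sum_n f N x Hc).
  assert (He3 : 0 < e / 3) by lra.
  apply (proj1 (filterlim_locally _ _)) with (eps := mkposreal _ He3) in Hs.
  revert Hs. apply filter_imp. intros t Ht.
  change (Rabs (sum_n (fun n => f n t) N - sum_n (fun n => f n x) N) < e / 3) in Ht.
  change (Rabs (Series (fun n => f n t) - Series (fun n => f n x)) < e).
  assert (H1 := Hr t). assert (H2 := Hr x).
  apply Rabs_def2 in H1. apply Rabs_def2 in H2. apply Rabs_def2 in Ht.
  apply Rabs_def1; lra.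
Qed.

Lemma ex_RInt_cont (f : R -> R) (a b : R) : (forall x, continuous f x) -> ex_RInt f a b.
Proof. intro H. apply (ex_RInt_continuous (V := R_CompleteNormedModule)). intros; apply H. Qed.

Lemma RInt_sum_n (f : nat -> R -> R) (a b : R) (N : nat) :
  (forall n x, continuous (f n) x) ->
  RInt (fun t => sum_n (fun n => f n t) N) a b = sum_n (fun n => RInt (f n) a b) N.
Proof.
  intro H. induction N as [|N IH].
  - rewrite sum_O. apply RInt_ext. intros; now rewrite sum_O.
  - rewrite sum_Sn, <- IH.
    rewrite <- (RInt_plus (V := R_CompleteNormedModule)); try (apply ex_RInt_cont; intro; auto).
    + apply RInt_ext. intros; now rewrite sum_Sn.
    + apply continuous_sum_n. auto.
Qed.

Lemma RInt_Series (f : nat -> R -> R) (u : nat -> R) (a b : R) :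
  a <= b -> (forall n x, continuous (f n) x) ->
  (forall n t, Rabs (f n t) <= u n) -> ex_series u ->
  RInt (fun t => Series (fun n => f n t)) a b = Series (fun n => RInt (f n) a b).
Proof.
  intros Hab Hc Hb Hu. symmetry. apply is_series_unique, is_series_Reals.
  intros e He.
  (* The [+ 1] keeps the denominator positive when [a = b]. *)
  assert (He' : 0 < e / (b - a + 1)) by (apply Rdiv_lt_0_compat; lra).
  destruct (Series_remainder_small u _ Hu He') as [N HN]. exists N. intros n Hn.
  unfold Rdist. rewrite <- sum_n_Reals, <- RInt_sum_n by assumption.
  rewrite <- (RInt_minus (V := R_CompleteNormedModule)).
  2:{ apply ex_RInt_cont. intro x. apply continuous_sum_n. auto. }
  2:{ apply ex_RInt_cont. intro x. apply continuous_Series with u; auto. }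
  apply Rle_lt_trans with ((b - a) * (e / (b - a + 1))).
  - apply abs_RInt_le_const; auto.
    + apply ex_RInt_cont. intro x.
      apply (continuous_minus (fun t => sum_n (fun k => f k t) n)).
      * apply continuous_sum_n. auto.
      * apply continuous_Series with u; auto.
    + intros t _. change (Rabs (sum_n (fun k => f k t) n - Series (fun k => f k t))
                          <= e / (b - a + 1)).
      rewrite Rabs_minus_sym. eapply Rle_trans; [apply Series_remainder_le with (u := u); auto|].
      eapply Rle_trans; [apply Rle_abs|]. left. apply HN. exact Hn.
  - unfold Rdiv. rewrite <- Rmult_assoc, Rmult_comm, <- Rmult_assoc.
    apply Rmult_lt_reg_r with (b - a + 1); [lra|].
    replace (/ (b - a + 1) * (b - a) * e * (b - a + 1)) with ((b - a) * e) by (field; lra).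
    nra.
Qed.

Lemma continuous_sumZ (f : Z -> R -> R) (u : Z -> R) (x : R) :
  (forall k, continuous (f k) x) -> (forall k t, Rabs (f k t) <= u k) -> abs_summable u ->
  continuous (fun t => sumZ (fun k => f k t)) x.
Proof.
  intros Hc Hb [U1 U2].
  apply (continuous_plus (fun t => Series (fun n => f (Z.of_nat n) t))
           (fun t => Series (fun n => f (- Z.of_nat (S n))%Z t))).
  - apply continuous_Series with (fun n => u (Z.of_nat n)); auto. now apply ex_series_Rabs.
  - apply continuous_Series with (fun n => u (- Z.of_nat (S n))%Z); auto. now apply ex_series_Rabs.
Qed.

Lemma RInt_sumZ (f : Z -> R -> R) (u : Z -> R) (a b : R) :
  a <= b -> (forall k x, continuous (f k) x) ->
  (forall k t, Rabs (f k t) <= u k) -> abs_summable u ->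
  RInt (fun t => sumZ (fun k => f k t)) a b = sumZ (fun k => RInt (f k) a b).
Proof.
  intros Hab Hc Hb [U1 U2]. apply ex_series_Rabs in U1. apply ex_series_Rabs in U2.
  unfold sumZ.
  rewrite (RInt_plus (V := R_CompleteNormedModule) (fun t => Series (fun n => f (Z.of_nat n) t))
           (fun t => Series (fun n => f (- Z.of_nat (S n))%Z t))).
  - change plus with Rplus. f_equal.
    + apply (RInt_Series (fun n => f (Z.of_nat n)) (fun n => u (Z.of_nat n))); auto.
    + apply (RInt_Series (fun n => f (- Z.of_nat (S n))%Z) (fun n => u (- Z.of_nat (S n))%Z)); auto.
  - apply ex_RInt_cont. intro x. apply continuous_Series with (fun n => u (Z.of_nat n)); auto.
  - apply ex_RInt_cont. intro x.
    apply continuous_Series with (fun n => u (- Z.of_nat (S n))%Z); auto.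
Qed.

(** * Characteristic functions and Fourier inversion *)

Definition pmf (p : Z -> R) : Prop := (forall k, 0 <= p k) /\ abs_summable p /\ sumZ p = 1.

Definition expect (p : Z -> R) (a : R) (f : R -> R) : R := sumZ (fun k => f (a + IZR k) * p k).

Definition integrable (p : Z -> R) (a : R) (f : R -> R) : Prop :=
  abs_summable (fun k => f (a + IZR k) * p k).

Lemma integrable_bounded (p : Z -> R) (a B : R) (f : R -> R) :
  pmf p -> (forall x, Rabs (f x) <= B) -> integrable p a f.
Proof.
  intros (Hp & Hs & _) H. apply abs_summable_le with (g := fun k => B * p k).
  - intro k. rewrite Rabs_mult, (Rabs_pos_eq (p k)) by auto. now apply Rmult_le_compat_r.
  - now apply abs_summable_scal.
Qed.

Lemma integrable_plus (p : Z -> R) (a : R) (f g : R -> R) :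
  integrable p a f -> integrable p a g -> integrable p a (fun x => f x + g x).
Proof.
  intros F G. eapply abs_summable_ext; [|exact (abs_summable_plus _ _ F G)]. intro k. cbv beta. ring.
Qed.

Lemma integrable_scal (p : Z -> R) (a c : R) (f : R -> R) :
  integrable p a f -> integrable p a (fun x => c * f x).
Proof.
  intros F. eapply abs_summable_ext; [|exact (abs_summable_scal c _ F)]. intro k. cbv beta. ring.
Qed.

Lemma integrable_le (p : Z -> R) (a : R) (f g : R -> R) :
  pmf p -> (forall x, Rabs (f x) <= g x) -> integrable p a g -> integrable p a f.
Proof.
  intros (Hp & _) H G. apply abs_summable_le with (2 := G).
  intro k. rewrite Rabs_mult, (Rabs_pos_eq (p k)) by auto. now apply Rmult_le_compat_r.
Qed.

Lemma expect_plus (p : Z -> R) (a : R) (f g : R -> R) :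
  integrable p a f -> integrable p a g ->
  expect p a (fun x => f x + g x) = expect p a f + expect p a g.
Proof.
  intros F G. unfold expect. rewrite <- sumZ_plus by assumption. apply sumZ_ext. intro; ring.
Qed.

Lemma expect_scal (p : Z -> R) (a c : R) (f : R -> R) :
  expect p a (fun x => c * f x) = c * expect p a f.
Proof.
  unfold expect. rewrite <- sumZ_scal. apply sumZ_ext. intro; ring.
Qed.

Lemma expect_ext (p : Z -> R) (a : R) (f g : R -> R) :
  (forall x, f x = g x) -> expect p a f = expect p a g.
Proof. intro H. apply sumZ_ext. intro. now rewrite H. Qed.

Lemma expect_const (p : Z -> R) (a c : R) : pmf p -> expect p a (fun _ => c) = c.
Proof. intros (_ & _ & H). unfold expect. rewrite sumZ_scal, H. ring. Qed.

Lemma expect_le (p : Z -> R) (a : R) (f g : R -> R) :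
  pmf p -> (forall x, f x <= g x) -> integrable p a f -> integrable p a g ->
  expect p a f <= expect p a g.
Proof.
  intros (Hp & _) H F G. apply sumZ_le; auto. intro k. now apply Rmult_le_compat_r.
Qed.

Lemma expect_abs_le (p : Z -> R) (a : R) (f g : R -> R) :
  pmf p -> (forall x, Rabs (f x) <= g x) -> integrable p a g ->
  Rabs (expect p a f) <= expect p a g.
Proof.
  intros (Hp & _) H G. apply sumZ_abs_le; auto.
  intro k. rewrite Rabs_mult, (Rabs_pos_eq (p k)) by auto. now apply Rmult_le_compat_r.
Qed.

Lemma expect_atom_le (p : Z -> R) (a : R) (f : R -> R) (k : Z) :
  pmf p -> (forall x, 0 <= f x) -> integrable p a f -> f (a + IZR k) * p k <= expect p a f.
Proof.
  intros (Hp & _) H F. apply (sumZ_term_le (fun k => f (a + IZR k) * p k)); auto.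
  intro i. now apply Rmult_le_pos.
Qed.

Lemma pmf_atom (p : Z -> R) : pmf p -> exists k, 0 < p k.
Proof.
  intros (Hp & _ & H1). destruct (classic (exists k, 0 < p k)) as [|Hn]; [assumption|].
  exfalso. assert (sumZ p = 0); [|lra].
  rewrite <- sumZ_0. apply sumZ_ext. intro k. specialize (Hp k).
  destruct (Req_dec (p k) 0); [assumption|]. exfalso. apply Hn. exists k. lra.
Qed.

Definition cis (x : R) : C := (cos x, sin x).

Definition chf (p : Z -> R) (a t : R) : C :=
  (expect p a (fun x => cos (t * x)), expect p a (fun x => sin (t * x))).

Lemma cis_plus (x y : R) : cis (x + y) = (cis x * cis y)%C.
Proof. unfold cis, Cmult. simpl. rewrite cos_plus, sin_plus. f_equal; ring. Qed.

Lemma Cmod_sqr (z : C) : Cmod z ^ 2 = fst z ^ 2 + snd z ^ 2.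
Proof. apply Cmod2_alt. Qed.

Lemma Cmod_cis (x : R) : Cmod (cis x) = 1.
Proof.
  unfold Cmod, cis. simpl. transitivity (sqrt 1); [|apply sqrt_1]. f_equal.
  generalize (sin2_cos2 x). unfold Rsqr. intro. lra.
Qed.

Lemma Cmod_le_abs (x y : R) : Cmod (x, y) <= Rabs x + Rabs y.
Proof.
  replace (x, y) with (RtoC x + Ci * RtoC y)%C.
  2:{ unfold RtoC, Ci, Cplus, Cmult. simpl. f_equal; ring. }
  eapply Rle_trans; [apply Cmod_triangle|].
  rewrite Cmod_mult, !Cmod_R, Cmod_Ci. lra.
Qed.

Lemma integrable_cos (p : Z -> R) (a t : R) : pmf p -> integrable p a (fun x => cos (t * x)).
Proof.
  intro Hp. apply integrable_bounded with 1; auto. intro x.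
  apply Rabs_le. apply COS_bound.
Qed.

Lemma integrable_sin (p : Z -> R) (a t : R) : pmf p -> integrable p a (fun x => sin (t * x)).
Proof.
  intro Hp. apply integrable_bounded with 1; auto. intro x.
  apply Rabs_le. apply SIN_bound.
Qed.

Lemma trig_comb_le (A B x : R) : A * cos x + B * sin x <= Cmod (A, B).
Proof.
  assert (Hp := Cmod_ge_0 (A, B)). assert (H2 := Cmod_sqr (A, B)). simpl fst in H2; simpl snd in H2.
  destruct (Rle_dec (A * cos x + B * sin x) (Cmod (A, B))) as [|Hn]; [assumption|exfalso].
  assert (Ht := sin2_cos2 x). unfold Rsqr in Ht.
  (* Lagrange's identity: this square and that of [A * cos x + B * sin x] add up to
     [A ^ 2 + B ^ 2]. *)
  assert (Hs : 0 <= (A * sin x - B * cos x) ^ 2) by apply pow2_ge_0.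
  nra.
Qed.

(* With [A, B] the coordinates of [e^{-it x0} phi(t)], the nonnegative variable
   [|phi| - (A cos + B sin)(t (X - x0))] has mean [|phi| - |phi|^2] and takes the
   value [|phi| - A] at the atom [x0 = a + k]. *)
Lemma Cmod_chf_le (p : Z -> R) (a t : R) (k : Z) :
  pmf p ->
  Cmod (chf p a t) <= 1 - p k / 2 * expect p a (fun x => 1 - cos (t * (x - (a + IZR k)))).
Proof.
  intro Hp. set (x0 := a + IZR k). set (C0 := expect p a (fun x => cos (t * x))).
  set (S0 := expect p a (fun x => sin (t * x))).
  set (A := C0 * cos (t * x0) + S0 * sin (t * x0)).
  set (B := S0 * cos (t * x0) - C0 * sin (t * x0)).
  assert (Ht := sin2_cos2 (t * x0)). unfold Rsqr in Ht.
  assert (HR : Cmod (chf p a t) = Cmod (A, B)).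
  { apply Rsqr_inj; try apply Cmod_ge_0. unfold Rsqr.
    replace (Cmod (chf p a t) * Cmod (chf p a t)) with (Cmod (chf p a t) ^ 2) by ring.
    replace (Cmod (A, B) * Cmod (A, B)) with (Cmod (A, B) ^ 2) by ring.
    rewrite !Cmod_sqr. unfold chf. simpl fst; simpl snd. fold C0 S0. unfold A, B.
    replace ((C0 * cos (t * x0) + S0 * sin (t * x0)) ^ 2
             + (S0 * cos (t * x0) - C0 * sin (t * x0)) ^ 2)
      with ((C0 ^ 2 + S0 ^ 2) * (sin (t * x0) * sin (t * x0) + cos (t * x0) * cos (t * x0)))
      by ring.
    rewrite Ht. ring. }
  rewrite HR. set (R0 := Cmod (A, B)).
  assert (H2 : R0 ^ 2 = A ^ 2 + B ^ 2) by apply Cmod_sqr.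
  assert (HA : expect p a (fun x => cos (t * (x - x0))) = A).
  { unfold A, C0, S0.
    rewrite !(Rmult_comm (expect _ _ _)), <- !expect_scal, <- expect_plus
      by (apply integrable_scal; [apply integrable_cos || apply integrable_sin]; auto).
    apply expect_ext. intro x.
    replace (t * (x - x0)) with (t * x - t * x0) by ring. rewrite cos_minus. ring. }
  assert (HB : expect p a (fun x => sin (t * (x - x0))) = B).
  { unfold B, C0, S0.
    replace (expect p a (fun x => sin (t * x)) * cos (t * x0)
             - expect p a (fun x => cos (t * x)) * sin (t * x0))
      with (cos (t * x0) * expect p a (fun x => sin (t * x))
             + - sin (t * x0) * expect p a (fun x => cos (t * x))) by ring.
    rewrite <- !expect_scal, <- expect_plus
      by (apply integrable_scal; [apply integrable_cos || apply integrable_sin]; auto).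
    apply expect_ext. intro x.
    replace (t * (x - x0)) with (t * x - t * x0) by ring. rewrite sin_minus. ring. }
  assert (Ic : integrable p a (fun x => cos (t * (x - x0)))).
  { apply integrable_bounded with 1; auto. intro. apply Rabs_le, COS_bound. }
  assert (Is : integrable p a (fun x => sin (t * (x - x0)))).
  { apply integrable_bounded with 1; auto. intro. apply Rabs_le, SIN_bound. }
  assert (I1 : forall c, integrable p a (fun _ => c)).
  { intro c. apply integrable_bounded with (Rabs c); auto. intro. lra. }
  assert (I : integrable p a (fun x => R0 + (- A * cos (t * (x - x0)) + - B * sin (t * (x - x0))))).
  { apply integrable_plus; [apply I1|]. apply integrable_plus; now apply integrable_scal. }
  assert (HE : expect p a (fun x => R0 + (- A * cos (t * (x - x0)) + - B * sin (t * (x - x0))))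
               = R0 - R0 ^ 2).
  { rewrite (expect_plus _ _ (fun _ => R0)); [|apply I1|apply integrable_plus; now apply integrable_scal].
    rewrite expect_plus by now apply integrable_scal.
    rewrite !expect_scal, HA, HB, expect_const, H2 by assumption. ring. }
  assert (Hk : (R0 + (- A * cos (t * (x0 - x0)) + - B * sin (t * (x0 - x0)))) * p k
               <= R0 - R0 ^ 2).
  { rewrite <- HE. refine (expect_atom_le p a _ k Hp _ I).
    intro x. generalize (trig_comb_le A B (t * (x - x0))). fold R0. lra. }
  replace (t * (x0 - x0)) with 0 in Hk by ring. rewrite cos_0, sin_0 in Hk.
  rewrite (expect_ext _ _ (fun x => 1 - cos (t * (x - x0))) (fun x => 1 + (-1) * cos (t * (x - x0))))
    by (intro; ring).
  rewrite expect_plus by (apply I1 || now apply integrable_scal).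
  rewrite expect_scal, expect_const, HA by assumption.
  assert (Hpk : 0 <= p k <= 1).
  { split; [apply Hp|]. destruct Hp as (P0 & P1 & P2). rewrite <- P2. now apply sumZ_term_le. }
  assert (HR0 : 0 <= R0) by apply Cmod_ge_0.
  assert (HAR : A <= R0).
  { generalize (trig_comb_le A B 0). fold R0. rewrite cos_0, sin_0. lra. }
  (* If [R0 > 1], the mean [R0 - R0 ^ 2] would be negative, against [Hk]. *)
  assert (HR1 : R0 <= 1).
  { destruct (Rle_dec R0 1); auto. exfalso.
    assert (0 <= (R0 - A) * p k) by (apply Rmult_le_pos; lra).
    assert (0 < R0 * (R0 - 1)) by (apply Rmult_lt_0_compat; lra). nra. }
  (* Adding [p k * (1 - R0)] to both sides of [Hk] gives this. The factor [R0 + p k] is at most 2,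
     whence the [p k / 2] of the claim. *)
  assert (H3 : p k * (1 - A) <= (1 - R0) * (R0 + p k)) by nra.
  assert (H4 : (1 - R0) * (R0 + p k) <= (1 - R0) * 2) by nra.
  lra.
Qed.

Lemma Cmod_chf_le_1 (p : Z -> R) (a t : R) : pmf p -> Cmod (chf p a t) <= 1.
Proof.
  (* Any index serves: the subtracted term is nonnegative even if [p 0] vanishes. *)
  intro Hp. eapply Rle_trans; [apply (Cmod_chf_le p a t 0); auto|].
  assert (0 <= expect p a (fun x => 1 - cos (t * (x - (a + 0))))).
  { apply Rle_trans with (expect p a (fun _ => 0)); [right; symmetry; now apply expect_const|].
    apply expect_le; auto.
    - intro x. generalize (COS_bound (t * (x - (a + 0)))). lra.
    - apply integrable_bounded with 0; auto. intro. rewrite Rabs_R0. lra.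
    - apply integrable_bounded with 2; auto. intro x. apply Rabs_le.
      generalize (COS_bound (t * (x - (a + 0)))). lra. }
  assert (0 <= p 0%Z / 2) by (apply Rmult_le_pos; [apply Hp|lra]).
  assert (Hm := Rmult_le_pos _ _ H0 H). simpl IZR. lra.
Qed.

Definition Ccont (F : R -> C) : Prop :=
  forall x, continuous (fun t => fst (F t)) x /\ continuous (fun t => snd (F t)) x.

Lemma Ccont_mult (F G : R -> C) : Ccont F -> Ccont G -> Ccont (fun t => (F t * G t)%C).
Proof.
  intros HF HG x. destruct (HF x) as [F1 F2], (HG x) as [G1 G2]. split.
  - apply (continuous_minus (fun t => fst (F t) * fst (G t))
             (fun t => snd (F t) * snd (G t)));
      now apply (continuous_mult (K := R_AbsRing)).
  - apply (continuous_plus (fun t => fst (F t) * snd (G t))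
             (fun t => snd (F t) * fst (G t)));
      now apply (continuous_mult (K := R_AbsRing)).
Qed.

Lemma Ccont_pow (F : R -> C) (n : nat) : Ccont F -> Ccont (fun t => (F t ^ n)%C).
Proof.
  intro HF. induction n as [|n IH].
  - intro x. split; apply continuous_const.
  - exact (Ccont_mult F _ HF IH).
Qed.

Lemma continuous_cos_comp (f : R -> R) (x : R) :
  continuous f x -> continuous (fun t => cos (f t)) x.
Proof. intro H. apply (continuous_comp f cos); auto. apply continuous_cos. Qed.

Lemma continuous_sin_comp (f : R -> R) (x : R) :
  continuous f x -> continuous (fun t => sin (f t)) x.
Proof. intro H. apply (continuous_comp f sin); auto. apply continuous_sin. Qed.

Lemma continuous_linear (c x : R) : continuous (fun t => t * c) x.
Proof.
  apply (continuous_mult (K := R_AbsRing) (fun t : R => t) (fun _ => c));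
    [apply continuous_id|apply continuous_const].
Qed.

Lemma Ccont_cis (c : R) : Ccont (fun t => cis (- (t * c))).
Proof.
  intro x.
  assert (H : continuous (fun t : R => - (t * c)) x).
  { apply (continuous_opp (fun t : R => t * c)). apply continuous_linear. }
  split; [now apply continuous_cos_comp|now apply continuous_sin_comp].
Qed.

Lemma Ccont_chf (p : Z -> R) (a : R) : pmf p -> Ccont (chf p a).
Proof.
  intros (Hp & Hs & _) x. split.
  - apply (continuous_sumZ (fun k t => cos (t * (a + IZR k)) * p k) p); auto.
    + intro k. apply (continuous_mult (K := R_AbsRing) (fun t => cos (t * (a + IZR k))) (fun _ => p k)).
      * apply continuous_cos_comp, continuous_linear.
      * apply continuous_const.
    + intros k t. rewrite Rabs_mult, (Rabs_pos_eq (p k)) by auto.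
      rewrite <- (Rmult_1_l (p k)) at 2. apply Rmult_le_compat_r; auto.
      apply Rabs_le, COS_bound.
  - apply (continuous_sumZ (fun k t => sin (t * (a + IZR k)) * p k) p); auto.
    + intro k. apply (continuous_mult (K := R_AbsRing) (fun t => sin (t * (a + IZR k))) (fun _ => p k)).
      * apply continuous_sin_comp, continuous_linear.
      * apply continuous_const.
    + intros k t. rewrite Rabs_mult, (Rabs_pos_eq (p k)) by auto.
      rewrite <- (Rmult_1_l (p k)) at 2. apply Rmult_le_compat_r; auto.
      apply Rabs_le, SIN_bound.
Qed.

(** [INR n * a + IZR j] is the value of S_n at index [j]. The real part of this function is even in
    [t], so inversion integrates over [[0, PI]] with weight [/ PI]. *)
Definition inv_integrand (p : Z -> R) (a : R) (n : nat) (j : Z) (t : R) : C :=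
  (chf p a t ^ n * cis (- (t * (INR n * a + IZR j))))%C.

Lemma Ccont_inv_integrand (p : Z -> R) (a : R) (n : nat) (j : Z) : pmf p -> Ccont (inv_integrand p a n j).
Proof. intro Hp. apply Ccont_mult; [apply Ccont_pow, Ccont_chf; auto|apply Ccont_cis]. Qed.

Lemma Cmod_inv_integrand (p : Z -> R) (a : R) (n : nat) (j : Z) (t : R) :
  Cmod (inv_integrand p a n j t) = Cmod (chf p a t) ^ n.
Proof. unfold inv_integrand. rewrite Cmod_mult, Cmod_pow, Cmod_cis. ring. Qed.

Lemma re_inv_integrand_le_1 (p : Z -> R) (a : R) (n : nat) (j : Z) (t : R) :
  pmf p -> Rabs (fst (inv_integrand p a n j t)) <= 1.
Proof.
  intro Hp. eapply Rle_trans; [apply (re_le_Cmod (inv_integrand p a n j t))|]. rewrite Cmod_inv_integrand.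
  rewrite <- (pow1 n). apply pow_incr. split; [apply Cmod_ge_0|now apply Cmod_chf_le_1].
Qed.

Lemma RInt_cos_int (j : Z) :
  / PI * RInt (fun t => cos (t * IZR j)) 0 PI = if Z.eq_dec j 0 then 1 else 0.
Proof.
  assert (HPI := PI_RGT_0). destruct (Z.eq_dec j 0) as [->|Hj].
  - rewrite (RInt_ext _ (fun _ => 1)).
    + rewrite RInt_const. unfold scal; simpl; unfold mult; simpl. field. lra.
    + intros t _. now rewrite Rmult_0_r, cos_0.
  - assert (Hj' : IZR j <> 0) by now apply not_0_IZR.
    assert (H : is_RInt (fun t => cos (t * IZR j)) 0 PI
                  (sin (PI * IZR j) / IZR j - sin (0 * IZR j) / IZR j)).
    { apply (is_RInt_derive (fun t => sin (t * IZR j) / IZR j)).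
      - intros t _. auto_derive; auto. field. auto.
      - intros t _. apply continuous_cos_comp, continuous_linear. }
    rewrite (is_RInt_unique _ _ _ _ H).
    rewrite (Rmult_comm PI), (sin_eq_0_1 (IZR j * PI)) by now exists j.
    rewrite Rmult_0_l, sin_0. field. lra.
Qed.

(** Induction on [n]: the convolution sum is exchanged with the integral under the majorant
    [p (j - i)], and summing over [i] then supplies one more factor [chf p a t]. The base case is
    the orthogonality of cosines. *)
Lemma convpow_inversion (p : Z -> R) (a : R) (n : nat) (j : Z) :
  pmf p -> convpow p n j = / PI * RInt (fun t => fst (inv_integrand p a n j t)) 0 PI.
Proof.
  intro Hp. assert (HPI := PI_RGT_0). revert j. induction n as [|n IH]; intro j.
  - simpl convpow. rewrite <- RInt_cos_int. f_equal. apply RInt_ext. intros t _.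
    unfold inv_integrand. simpl. rewrite cos_neg. rewrite Rmult_0_l, Rplus_0_l. ring.
  - change (convpow p (S n) j) with (Zsum (fun i => convpow p n i * p (j - i)%Z)).
    assert (Hpos := Hp). destruct Hpos as (P0 & P1 & _).
    assert (Hsj := proj1 (sumZ_subst p j P1)).
    assert (Hb : forall i t, Rabs (p (j - i)%Z * fst (inv_integrand p a n i t)) <= p (j - i)%Z).
    { intros i t. rewrite Rabs_mult, Rabs_pos_eq by auto.
      rewrite <- (Rmult_1_r (p (j - i)%Z)) at 2. apply Rmult_le_compat_l; auto.
      now apply re_inv_integrand_le_1. }
    assert (Hc : forall i x, continuous (fun t => p (j - i)%Z * fst (inv_integrand p a n i t)) x).
    { intros i x. apply (continuous_mult (K := R_AbsRing) (fun _ => p (j - i)%Z)).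
      - apply continuous_const.
      - exact (proj1 (Ccont_inv_integrand p a n i Hp x)). }
    assert (HE : forall i, convpow p n i * p (j - i)%Z
                 = / PI * RInt (fun t => p (j - i)%Z * fst (inv_integrand p a n i t)) 0 PI).
    { intro i. rewrite IH, (RInt_scal (V := R_CompleteNormedModule)).
      - change (scal (p (j - i)%Z)) with (Rmult (p (j - i)%Z)). ring.
      - apply ex_RInt_cont. intro x. exact (proj1 (Ccont_inv_integrand p a n i Hp x)). }
    rewrite Zsum_eq.
    (* [Zsum] is meaningful only for a convergent family; the integral form of the terms provides
       the majorant. *)
    2:{ apply abs_summable_le with (2 := Hsj). intro i. rewrite HE.
        rewrite Rabs_mult, Rabs_pos_eq by (left; now apply Rinv_0_lt_compat).
        apply Rle_trans with (/ PI * ((PI - 0) * p (j - i)%Z)).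
        - apply Rmult_le_compat_l; [left; now apply Rinv_0_lt_compat|].
          apply abs_RInt_le_const; [lra| |intros; apply Hb].
          apply ex_RInt_cont. apply Hc.
        - right. field. lra. }
    rewrite (sumZ_ext _ _ HE), sumZ_scal. f_equal.
    rewrite <- (RInt_sumZ (fun i t => p (j - i)%Z * fst (inv_integrand p a n i t))
                  (fun i => p (j - i)%Z)); auto; [|lra].
    apply RInt_ext. intros t _.
    (* [z] has the power of step [n] and the phase of step [S n]: multiplied by
       [cis (t * (a + IZR (j - i)))] it is the integrand at [i], multiplied by [chf p a t] the one
       at [S n]. *)
    set (z := (chf p a t ^ n * cis (- (t * (INR (S n) * a + IZR j))))%C).
    replace (inv_integrand p a (S n) j t) with (z * chf p a t)%C.
    2:{ unfold inv_integrand, z. rewrite Cpow_S. ring. }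
    rewrite (sumZ_ext _ (fun i => (fun k => p k * (fst z * cos (t * (a + IZR k))
                                  - snd z * sin (t * (a + IZR k)))) (j - i)%Z)).
    2:{ intro i. f_equal.
        replace (inv_integrand p a n i t) with (z * cis (t * (a + IZR (j - i))))%C; [reflexivity|].
        unfold z, inv_integrand. rewrite <- Cmult_assoc, <- cis_plus. do 2 f_equal.
        rewrite S_INR, minus_IZR. ring. }
    assert (Ic := integrable_cos p a t Hp). assert (Is := integrable_sin p a t Hp).
    assert (Ik : abs_summable (fun k => p k * (fst z * cos (t * (a + IZR k))
                                  - snd z * sin (t * (a + IZR k))))).
    { eapply abs_summable_ext; [|exact (abs_summable_plus _ _ (abs_summable_scal (fst z) _ Ic) (abs_summable_scal (- snd z) _ Is))].
      intro k. cbv beta. ring. }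
    rewrite (proj2 (sumZ_subst _ j Ik)).
    rewrite (sumZ_ext _ (fun k => fst z * (cos (t * (a + IZR k)) * p k)
                                  + - snd z * (sin (t * (a + IZR k)) * p k))) by (intro; ring).
    rewrite sumZ_plus by (now apply abs_summable_scal). rewrite !sumZ_scal.
    simpl. unfold expect. ring.
Qed.

Lemma cos_eq_1 (x : R) : cos x = 1 -> exists z : Z, x = 2 * IZR z * PI.
Proof.
  intro H. assert (Hs : sin (x / 2) = 0).
  { assert (E : cos (2 * (x / 2)) = 1 - 2 * sin (x / 2) * sin (x / 2)) by apply cos_2a_sin.
    replace (2 * (x / 2)) with x in E by field. nra. }
  destruct (sin_eq_0_0 _ Hs) as [z Hz]. exists z. lra.
Qed.

(** If the modulus were 1, the mean of [1 - cos (t * (X - x0))] would vanish, where [x0] is an atom.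
    Then every atom differs from [x0] by an element of [H], the subgroup of integers [d] with
    [t * d] a multiple of 2 PI. A generator at least 2 contradicts the span, and the generator 1
    makes [t] itself a multiple of 2 PI, impossible on [(0, PI]]. *)
Lemma chf_lt_1 (p : Z -> R) (a t : R) :
  pmf p -> max_span_one p -> 0 < t <= PI -> Cmod (chf p a t) < 1.
Proof.
  intros Hp Hspan Ht. destruct (pmf_atom p Hp) as [k0 Hk0].
  destruct (Rlt_dec (Cmod (chf p a t)) 1) as [|Hn]; [assumption|exfalso].
  assert (Hle := Cmod_chf_le p a t k0 Hp).
  set (f := fun x => 1 - cos (t * (x - (a + IZR k0)))) in Hle.
  assert (If : integrable p a f).
  { apply integrable_bounded with 2; auto. intro x. apply Rabs_le. unfold f.
    generalize (COS_bound (t * (x - (a + IZR k0)))). lra. }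
  assert (Hf : forall x, 0 <= f x).
  { intro x. unfold f. generalize (COS_bound (t * (x - (a + IZR k0)))). lra. }
  assert (HE : expect p a f <= 0) by nra.
  set (H := fun d : Z => exists z : Z, t * IZR d = 2 * IZR z * PI).
  assert (HH : forall k, 0 < p k -> H (k - k0)%Z).
  { intros k Hk. assert (Hat := expect_atom_le p a f k Hp Hf If). apply cos_eq_1.
    rewrite minus_IZR. replace (t * (IZR k - IZR k0)) with (t * (a + IZR k - (a + IZR k0))) by ring.
    generalize (Hf (a + IZR k)). unfold f in *. nra. }
  assert (Hlin : forall d g q, H d -> H g -> H (d - g * q)%Z).
  { intros d g q [z1 Hz1] [z2 Hz2]. exists (z1 - z2 * q)%Z.
    rewrite !minus_IZR, !mult_IZR.
    replace (t * (IZR d - IZR g * IZR q)) with (t * IZR d - (t * IZR g) * IZR q) by ring.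
    rewrite Hz1, Hz2. ring. }
  set (Q := fun n : nat => (0 < n)%nat /\ H (Z.of_nat n)).
  destruct (classic (exists n, Q n)) as [Hex|Hnone].
  - destruct (dec_inh_nat_subset_has_unique_least_element Q (fun n => classic (Q n)) Hex)
      as [g [[[Hg0 Hg] Hmin] _]].
    assert (Hdiv : forall d, H d -> (Z.of_nat g | d)%Z).
    { intros d Hd. apply Z.mod_divide; [lia|].
      assert (Hm := Z.mod_pos_bound d (Z.of_nat g) ltac:(lia)).
      destruct (Z.eq_dec (d mod Z.of_nat g) 0) as [|Hne]; [assumption|exfalso].
      assert (Hr : H (d mod Z.of_nat g)%Z).
      { rewrite Z.mod_eq by lia. now apply Hlin. }
      assert (Hq : Q (Z.to_nat (d mod Z.of_nat g))).
      { split; [lia|]. now rewrite Z2Nat.id by lia. }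
      specialize (Hmin _ Hq). lia. }
    destruct (Nat.eq_dec g 1) as [->|Hg1].
    + destruct Hg as [z Hz]. simpl in Hz. rewrite Rmult_1_r in Hz.
      assert (HPI := PI_RGT_0).
      destruct (Z_lt_le_dec z 1) as [Hz1|Hz1].
      * assert (IZR z <= 0) by (apply IZR_le; lia). nra.
      * apply IZR_le in Hz1. nra.
    + apply (Hspan (Z.of_nat g) k0); [lia|]. intros k Hk. now apply Hdiv, HH.
  (* If [H] is trivial, [k0] is the only atom, and a point mass violates the span condition for
     every modulus; 2 is taken. *)
  - apply (Hspan 2%Z k0); [lia|]. intros k Hk. exists 0%Z.
    destruct (Z.eq_dec k k0) as [->|Hne]; [lia|exfalso]. apply Hnone.
    assert (Hd := HH k Hk).
    destruct (Z_lt_le_dec (k - k0) 0) as [Hneg|Hpos].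
    + exists (Z.to_nat (k0 - k)). split; [lia|]. rewrite Z2Nat.id by lia.
      replace (k0 - k)%Z with (0 - (k - k0) * 1)%Z by ring. apply Hlin; auto.
      exists 0%Z. simpl. ring.
    + exists (Z.to_nat (k - k0)). split; [lia|]. now rewrite Z2Nat.id by lia.
Qed.

Lemma chf_away (p : Z -> R) (a eps : R) :
  pmf p -> max_span_one p -> 0 < eps <= PI ->
  exists c, 0 < c /\ forall t, eps <= t <= PI -> Cmod (chf p a t) <= exp (- c).
Proof.
  intros Hp Hspan He.
  set (f := fun t => fst (chf p a t) ^ 2 + snd (chf p a t) ^ 2).
  assert (Hf : forall t, f t = Cmod (chf p a t) ^ 2) by (intro; symmetry; apply Cmod_sqr).
  destruct (continuity_ab_maj f eps PI (proj2 He)) as [t0 [Hmax Ht0]].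
  { intros t _. apply continuity_pt_filterlim.
    destruct (Ccont_chf p a Hp t) as [H1 H2].
    apply (continuous_plus (fun t => fst (chf p a t) ^ 2) (fun t => snd (chf p a t) ^ 2)).
    - apply (continuous_mult (K := R_AbsRing) (fun t => fst (chf p a t))); auto.
      apply (continuous_mult (K := R_AbsRing) (fun t => fst (chf p a t))); auto.
      apply continuous_const.
    - apply (continuous_mult (K := R_AbsRing) (fun t => snd (chf p a t))); auto.
      apply (continuous_mult (K := R_AbsRing) (fun t => snd (chf p a t))); auto.
      apply continuous_const. }
  assert (Hlt : Cmod (chf p a t0) < 1) by (apply chf_lt_1; auto; lra).
  (* The floor 1/2 keeps [ln rho] meaningful should the maximum of the modulus be 0. *)
  set (rho := Rmax (Cmod (chf p a t0)) (/ 2)).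
  assert (Hrho : 0 < rho < 1).
  { unfold rho. split; [eapply Rlt_le_trans; [|apply Rmax_r]; lra|].
    apply Rmax_lub_lt; lra. }
  exists (- ln rho). split.
  - assert (ln rho < ln 1) by (apply ln_increasing; lra). rewrite ln_1 in H. lra.
  - intros t Ht. rewrite Ropp_involutive, exp_ln by lra.
    eapply Rle_trans; [|apply Rmax_l].
    specialize (Hmax t Ht). rewrite !Hf in Hmax.
    apply Rsqr_incr_0; try apply Cmod_ge_0. unfold Rsqr. lra.
Qed.

(** * Elementary estimates *)

Lemma exp_mono (x y : R) : x <= y -> exp x <= exp y.
Proof. intros [H| ->]; [left; now apply exp_increasing|lra]. Qed.

(** The left side is largest at [u = s], by [ln y <= y - 1] at [y = u / s]; the further factor
    [exp (- s)] of the maximum is dropped. *)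
Lemma Rpower_exp_le (s u : R) : 0 < s -> 0 < u -> Rpower u s * exp (- u) <= Rpower s s.
Proof.
  intros Hs Hu. unfold Rpower. rewrite <- exp_plus.
  assert (H : ln (u / s) <= u / s - 1).
  { assert (Hus : 0 < u / s) by (apply Rdiv_lt_0_compat; lra).
    rewrite <- (ln_exp (u / s - 1)). apply ln_le; [assumption|].
    assert (E := exp_ineq1_le (u / s - 1)). lra. }
  unfold Rdiv in H at 1. rewrite ln_mult, ln_Rinv in H by (auto using Rinv_0_lt_compat).
  assert (H' : s * (ln u - ln s) <= s * (u / s - 1)) by (apply Rmult_le_compat_l; lra).
  replace (s * (u / s - 1)) with (u - s) in H' by (field; lra).
  apply exp_mono. lra.
Qed.

Lemma Rpower_pos (x y : R) : 0 < Rpower x y.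
Proof. apply exp_pos. Qed.

Lemma Rpower_le_1 (v q : R) : 0 < v <= 1 -> 0 <= q -> Rpower v q <= 1.
Proof.
  intros Hv Hq. rewrite <- (Rpower_O v) by lra.
  unfold Rpower. apply exp_mono.
  assert (ln v <= 0) by (rewrite <- ln_1; apply ln_le; lra). nra.
Qed.

Lemma Rpower_ge_1 (v q : R) : 1 <= v -> 0 <= q -> 1 <= Rpower v q.
Proof.
  intros Hv Hq. rewrite <- (Rpower_O v) at 1 by lra.
  unfold Rpower. apply exp_mono.
  assert (0 <= ln v) by (rewrite <- ln_1; apply ln_le; lra). nra.
Qed.

(** Bounds [v ^ q * exp (- v ^ al) * (1 + v ^ 2)]: the first 2 covers [v <= 1]. For [v > 1], where
    [1 + v ^ 2 <= 2 * v ^ 2], the second term is [Rpower_exp_le] with [s = (q + 2) / al]. *)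
Definition kernel_const (q al : R) : R := 2 + 2 * Rpower ((q + 2) / al) ((q + 2) / al).

Lemma kernel_unit (q al v : R) :
  0 <= q -> 0 < al -> 0 < v ->
  Rpower v q * exp (- Rpower v al) * (1 + v ^ 2) <= kernel_const q al.
Proof.
  intros Hq Hal Hv. unfold kernel_const.
  set (s := (q + 2) / al). assert (Hs : 0 < s) by (apply Rdiv_lt_0_compat; lra).
  assert (Hss := Rpower_pos s s).
  assert (Hpe : 0 < exp (- Rpower v al)) by apply exp_pos.
  assert (Hpq := Rpower_pos v q).
  destruct (Rle_dec v 1) as [H1|H1].
  - assert (Rpower v q <= 1) by (apply Rpower_le_1; lra).
    assert (exp (- Rpower v al) <= 1).
    { rewrite <- exp_0. apply exp_mono. generalize (Rpower_pos v al). lra. }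
    assert (Rpower v q * exp (- Rpower v al) <= 1) by nra.
    assert (v ^ 2 <= 1) by nra.
    assert (0 < Rpower v q * exp (- Rpower v al)) by nra. nra.
  - assert (H := Rpower_exp_le s (Rpower v al) Hs (Rpower_pos _ _)).
    rewrite Rpower_mult in H. replace (al * s) with (q + INR 2) in H by (unfold s; simpl; field; lra).
    rewrite Rpower_plus, Rpower_pow in H by lra.
    assert (0 < Rpower v q * exp (- Rpower v al)) by nra.
    assert (Rpower v q * exp (- Rpower v al) * (1 + v ^ 2)
            <= Rpower v q * exp (- Rpower v al) * (2 * v ^ 2)).
    { apply Rmult_le_compat_l; [lra|]. nra. }
    lra.
Qed.

Lemma kernel_const_pos (q al : R) : 0 < kernel_const q al.
Proof. unfold kernel_const. generalize (Rpower_pos ((q + 2) / al) ((q + 2) / al)). lra. Qed.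

Lemma Rpower_Rdiv (x y q : R) : 0 < x -> 0 < y -> Rpower (x / y) q = Rpower x q / Rpower y q.
Proof.
  intros Hx Hy. unfold Rdiv.
  rewrite <- Rpower_mult_distr by (auto using Rinv_0_lt_compat).
  f_equal. unfold Rpower. rewrite ln_Rinv by assumption.
  rewrite <- exp_Ropp. f_equal. ring.
Qed.

(** Rescaling by [t = s * v] with [s = kap ^ (- / al)] reduces to [kernel_unit]. With
    [RInt_kernel_le], the integral of the left side over any [[0, e]] is of order
    [kap ^ (- (q + 1) / al)], as for the Gamma integral over the half-line. *)
Lemma kernel_le (q al kap t : R) :
  0 <= q -> 0 < al -> 0 < kap -> 0 < t ->
  Rpower t q * exp (- (kap * Rpower t al))
  <= kernel_const q al * Rpower kap (- (q / al)) / (1 + (t / Rpower kap (- / al)) ^ 2).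
Proof.
  intros Hq Hal Hk Ht. set (s := Rpower kap (- / al)).
  assert (Hs : 0 < s) by apply Rpower_pos.
  assert (Hv : 0 < t / s) by now apply Rdiv_lt_0_compat.
  assert (H := kernel_unit q al (t / s) Hq Hal Hv).
  rewrite !Rpower_Rdiv in H by assumption.
  assert (E1 : Rpower s q = Rpower kap (- (q / al))).
  { unfold s. rewrite Rpower_mult. f_equal. field. lra. }
  assert (E2 : Rpower t al / Rpower s al = kap * Rpower t al).
  { assert (E : Rpower s al = / kap).
    { unfold s. rewrite Rpower_mult. replace (- / al * al) with (- (1)) by (field; lra).
      rewrite Rpower_Ropp, Rpower_1 by assumption. reflexivity. }
    rewrite E. field. lra. }
  rewrite E1, E2 in H.
  assert (Hd : 0 < 1 + (t / s) ^ 2) by nra.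
  assert (Hk' := Rpower_pos kap (- (q / al))).
  apply Rmult_le_reg_r with ((1 + (t / s) ^ 2) / Rpower kap (- (q / al)));
    [now apply Rdiv_lt_0_compat|].
  set (D := 1 + (t / s) ^ 2) in *. clearbody D.
  eapply Rle_trans; [|eapply Rle_trans; [exact H|]]; right; field; repeat split; lra.
Qed.

Lemma continuous_kernel (A s x : R) : continuous (fun t => A / (1 + (t / s) ^ 2)) x.
Proof.
  apply (ex_derive_continuous (K := R_AbsRing) (V := R_NormedModule)).
  auto_derive. nra.
Qed.

Lemma RInt_kernel_le (A s e : R) :
  0 <= A -> 0 < s -> 0 <= e -> RInt (fun t => A / (1 + (t / s) ^ 2)) 0 e <= 2 * (A * s).
Proof.
  intros HA Hs He.
  assert (H : is_RInt (fun t => A / (1 + (t / s) ^ 2)) 0 e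
                (A * s * atan (e / s) - A * s * atan (0 / s))).
  { apply (is_RInt_derive (fun t => A * s * atan (t / s))).
    - intros t _. auto_derive; auto. unfold Rsqr. field. split; nra.
    - intros t _. apply continuous_kernel. }
  rewrite (is_RInt_unique _ _ _ _ H).
  unfold Rdiv at 2. rewrite Rmult_0_l, atan_0.
  assert (atan (e / s) < PI / 2) by apply atan_bound.
  assert (PI <= 4) by apply PI_4.
  assert (0 <= A * s) by (apply Rmult_le_pos; lra). nra.
Qed.

Lemma sin_le_abs (x : R) : Rabs (sin x) <= Rabs x.
Proof.
  assert (Hpos : forall y, 0 <= y -> Rabs (sin y) <= y).
  { intros y Hy. apply Rabs_le.
    destruct (Rle_lt_or_eq_dec 0 y Hy) as [H| <-]; [|rewrite sin_0; lra].
    split; [|left; now apply sin_lt_x].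
    destruct (Rle_dec y 1) as [H1|H1].
    - assert (0 <= sin y); [|lra]. apply sin_ge_0; [lra|]. generalize PI2_1. lra.
    - generalize (SIN_bound y). lra. }
  destruct (Rle_dec 0 x) as [H|H].
  - rewrite (Rabs_pos_eq x) by assumption. auto.
  - rewrite <- Rabs_Ropp, <- sin_neg, <- (Rabs_Ropp x), (Rabs_pos_eq (- x)) by lra.
    apply Hpos. lra.
Qed.

Lemma one_minus_cos (x : R) : 1 - cos x = 2 * sin (x / 2) ^ 2.
Proof.
  replace x with (2 * (x / 2)) at 1 by field. rewrite cos_2a_sin. ring.
Qed.

Lemma one_minus_cos_le (x : R) : 1 - cos x <= x ^ 2 / 2.
Proof.
  rewrite one_minus_cos. assert (H := sin_le_abs (x / 2)).
  assert (H2 : sin (x / 2) ^ 2 <= (x / 2) ^ 2).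
  { rewrite <- (pow2_abs (sin (x / 2))), <- (pow2_abs (x / 2)).
    apply pow_incr. split; [apply Rabs_pos|assumption]. }
  lra.
Qed.

Lemma sin_lower (y : R) : 0 <= y <= 1 -> y / 2 <= sin y /\ y - y ^ 2 <= sin y.
Proof.
  intro Hy. destruct (pre_sin_bound y 0) as [H _]; try lra.
  unfold sin_approx, sin_term in H. simpl in H.
  assert (y ^ 3 <= y ^ 2) by nra. assert (y ^ 2 <= y) by nra. nra.
Qed.

Lemma one_minus_cos_ge (x : R) : Rabs x <= 2 -> x ^ 2 / 8 <= 1 - cos x.
Proof.
  intro Hx.
  assert (Hpos : forall y, 0 <= y <= 2 -> y ^ 2 / 8 <= 1 - cos y).
  { intros y Hy. rewrite one_minus_cos.
    destruct (sin_lower (y / 2)) as [H _]; [lra|].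
    assert ((y / 2 / 2) ^ 2 <= sin (y / 2) ^ 2) by (apply pow_incr; lra). nra. }
  destruct (Rle_dec 0 x) as [H|H].
  - apply Hpos. rewrite Rabs_pos_eq in Hx; lra.
  - rewrite <- cos_neg. replace (x ^ 2) with ((- x) ^ 2) by ring.
    apply Hpos. rewrite Rabs_left in Hx; lra.
Qed.

Lemma sin_minus_id (x : R) : Rabs x <= 1 -> Rabs (sin x - x) <= x ^ 2.
Proof.
  intro Hx.
  assert (Hpos : forall y, 0 <= y <= 1 -> Rabs (sin y - y) <= y ^ 2).
  { intros y Hy. destruct (sin_lower y Hy) as [_ H]. assert (H' := sin_le_abs y).
    rewrite (Rabs_pos_eq y) in H' by lra. assert (H'' := Rle_abs (sin y)).
    rewrite Rabs_left1 by lra. lra. }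
  destruct (Rle_dec 0 x) as [H|H].
  - apply Hpos. rewrite Rabs_pos_eq in Hx; lra.
  - rewrite <- Rabs_Ropp. replace (- (sin x - x)) with (sin (- x) - - x) by (rewrite sin_neg; ring).
    replace (x ^ 2) with ((- x) ^ 2) by ring.
    apply Hpos. rewrite Rabs_left in Hx; lra.
Qed.

Lemma Cmod_cis_minus_1 (x : R) : Cmod (cis x - 1) <= Rmin 2 (Rabs x).
Proof.
  assert (H2 : Cmod (cis x - 1) ^ 2 = 2 * (1 - cos x)).
  { rewrite Cmod_sqr. unfold cis. simpl. generalize (sin2_cos2 x). unfold Rsqr. nra. }
  assert (H0 := Cmod_ge_0 (cis x - 1)).
  apply Rmin_glb.
  - generalize (COS_bound x). intro. nra.
  - assert (H := one_minus_cos_le x). apply Rsqr_incr_0; auto using Rabs_pos.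
    rewrite <- Rsqr_abs. unfold Rsqr. nra.
Qed.

(** Interpolates between the trivial bound 2 and the Lipschitz bound; this is where the free
    exponent [eta] of the theorem arises. *)
Lemma Cmod_cis_minus_1_holder (x y eta : R) :
  0 < eta <= 1 -> Rabs x <= y -> 0 < y -> Cmod (cis x - 1) <= 2 * Rpower y eta.
Proof.
  intros He Hxy Hy. eapply Rle_trans; [apply Cmod_cis_minus_1|].
  destruct (Rle_dec y 1) as [H1|H1].
  - eapply Rle_trans; [apply Rmin_r|]. eapply Rle_trans; [exact Hxy|].
    assert (y <= Rpower y eta); [|generalize (Rpower_pos y eta); lra].
    rewrite <- (Rpower_1 y) at 1 by assumption. unfold Rpower. apply exp_mono.
    assert (ln y <= 0) by (rewrite <- ln_1; apply ln_le; lra). nra.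
  - eapply Rle_trans; [apply Rmin_l|].
    assert (1 <= Rpower y eta) by (apply Rpower_ge_1; lra). lra.
Qed.

Lemma Cmod_pow_minus_1 (z : C) (m : nat) :
  Cmod z <= 1 -> Cmod (z ^ m - 1) <= INR m * Cmod (z - 1).
Proof.
  intro Hz. induction m as [|m IH].
  - simpl. replace (1 - 1)%C with (RtoC 0) by ring. rewrite Cmod_0. lra.
  - rewrite S_INR, Cpow_S.
    replace (z * z ^ m - 1)%C with (z * (z ^ m - 1) + (z - 1))%C by ring.
    eapply Rle_trans; [apply Cmod_triangle|]. rewrite Cmod_mult.
    assert (H0 := Cmod_ge_0 (z ^ m - 1)). nra.
Qed.

(** * Tails and truncated moments *)

(** Strict on the right and weak on the left, as in [tail_right] and [tail_left]. The point [- x]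
    thus counts in the tail and also in the truncation [Rabs u <= x]; the dyadic inequalities below
    hold despite this overlap. *)
Definition tail_ind (x u : R) : R :=
  (if Rlt_dec x u then 1 else 0) + (if Rle_dec u (- x) then 1 else 0).
Definition trunc_sq (x u : R) : R := if Rle_dec (Rabs u) x then u ^ 2 else 0.
Definition trunc_abs (x u : R) : R := if Rle_dec (Rabs u) x then Rabs u else 0.
Definition tail_abs (x u : R) : R := if Rle_dec (Rabs u) x then 0 else Rabs u.

Definition two_tail (p : Z -> R) (a x : R) : R := expect p a (tail_ind x).
Definition trunc_m2 (p : Z -> R) (a x : R) : R := expect p a (trunc_sq x).
Definition trunc_m1 (p : Z -> R) (a x : R) : R := expect p a (trunc_abs x).
Definition tail_m1 (p : Z -> R) (a x : R) : R := expect p a (tail_abs x).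

Ltac trunc_cases :=
  unfold tail_ind, trunc_sq, trunc_abs, tail_abs;
  repeat match goal with
    | |- context [Rlt_dec ?x ?y] => destruct (Rlt_dec x y)
    | |- context [Rle_dec ?x ?y] => destruct (Rle_dec x y)
    end;
  repeat match goal with
    | H : context [Rabs ?u] |- _ => revert H
    | |- context [Rabs ?u] => unfold Rabs; destruct (Rcase_abs u); intros
    end; try lra; try nra.

Lemma integrable_tail_ind (p : Z -> R) (a x : R) : pmf p -> integrable p a (tail_ind x).
Proof.
  intro Hp. apply integrable_bounded with 2; auto. intro u. apply Rabs_le.
  unfold tail_ind. destruct (Rlt_dec x u), (Rle_dec u (- x)); lra.
Qed.

Lemma integrable_trunc_sq (p : Z -> R) (a x : R) : pmf p -> integrable p a (trunc_sq x).
Proof.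
  intro Hp. apply integrable_bounded with (x ^ 2); auto. intro u.
  assert (Hx := pow2_ge_0 x). assert (Hu := pow2_ge_0 u).
  unfold trunc_sq. destruct (Rle_dec (Rabs u) x); rewrite Rabs_pos_eq by lra; auto.
  rewrite <- (pow2_abs u). apply pow_incr. split; auto using Rabs_pos.
Qed.

Lemma integrable_trunc_abs (p : Z -> R) (a x : R) : pmf p -> integrable p a (trunc_abs x).
Proof.
  intro Hp. apply integrable_bounded with (Rabs x); auto. intro u.
  unfold trunc_abs. destruct (Rle_dec (Rabs u) x).
  - rewrite Rabs_Rabsolu. eapply Rle_trans; [eassumption|apply Rle_abs].
  - rewrite Rabs_R0. apply Rabs_pos.
Qed.

Lemma integrable_tail_abs (p : Z -> R) (a x : R) :
  pmf p -> integrable p a Rabs -> integrable p a (tail_abs x).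
Proof.
  intros Hp H. apply integrable_le with (3 := H); auto. intro u.
  unfold tail_abs. destruct (Rle_dec (Rabs u) x).
  - rewrite Rabs_R0. apply Rabs_pos.
  - rewrite Rabs_Rabsolu. lra.
Qed.

#[local] Hint Resolve integrable_tail_ind integrable_trunc_sq integrable_trunc_abs integrable_tail_abs
  integrable_plus integrable_scal : integ.

Lemma expect_nonneg (p : Z -> R) (a : R) (f : R -> R) :
  pmf p -> (forall x, 0 <= f x) -> integrable p a f -> 0 <= expect p a f.
Proof.
  intros Hp H F. rewrite <- (expect_const p a 0 Hp). apply expect_le; auto.
  apply integrable_bounded with 0; auto. intro. rewrite Rabs_R0. lra.
Qed.

Lemma two_tail_nonneg (p : Z -> R) (a x : R) : pmf p -> 0 <= two_tail p a x.
Proof. intro Hp. apply expect_nonneg; auto with integ. intro u. trunc_cases. Qed.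

Lemma two_tail_mono (p : Z -> R) (a x y : R) : pmf p -> 0 < x <= y -> two_tail p a y <= two_tail p a x.
Proof. intros Hp Hx. apply expect_le; auto with integ. intro u. trunc_cases. Qed.

Lemma trunc_m2_nonneg (p : Z -> R) (a x : R) : pmf p -> 0 <= trunc_m2 p a x.
Proof. intro Hp. apply expect_nonneg; auto with integ. intro u. trunc_cases. Qed.

Lemma trunc_m2_mono (p : Z -> R) (a x y : R) : pmf p -> x <= y -> trunc_m2 p a x <= trunc_m2 p a y.
Proof. intros Hp Hx. apply expect_le; auto with integ. intro u. trunc_cases. Qed.

Lemma trunc_m1_mono (p : Z -> R) (a x y : R) : pmf p -> x <= y -> trunc_m1 p a x <= trunc_m1 p a y.
Proof. intros Hp Hx. apply expect_le; auto with integ. intro u. trunc_cases. Qed.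

Lemma trunc_m2_double_le (p : Z -> R) (a x : R) :
  pmf p -> 0 < x -> trunc_m2 p a (2 * x) <= trunc_m2 p a x + 4 * x ^ 2 * two_tail p a x.
Proof.
  intros Hp Hx. unfold trunc_m2, two_tail. rewrite <- expect_scal, <- expect_plus by auto with integ.
  apply expect_le; auto with integ. intro u. trunc_cases.
Qed.

Lemma trunc_m2_double_ge (p : Z -> R) (a x : R) :
  pmf p -> 0 < x -> x ^ 2 * (two_tail p a x - two_tail p a (2 * x)) <= trunc_m2 p a (2 * x).
Proof.
  intros Hp Hx. unfold trunc_m2, two_tail.
  replace (x ^ 2 * (expect p a (tail_ind x) - expect p a (tail_ind (2 * x))))
    with (x ^ 2 * expect p a (tail_ind x) + - x ^ 2 * expect p a (tail_ind (2 * x))) by ring.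
  rewrite <- !expect_scal, <- expect_plus by auto with integ.
  apply expect_le; auto with integ. intro u. trunc_cases.
Qed.

(** Counts the two dyadic shells below [4 * x]. A single shell would not bring the growth factor of
    the truncated moment below 4 when [alpha = 2]. *)
Lemma trunc_m2_quad_ge (p : Z -> R) (a x : R) :
  pmf p -> 0 < x ->
  4 * x ^ 2 * (two_tail p a (2 * x) - two_tail p a (4 * x)) + x ^ 2 * (two_tail p a x - two_tail p a (2 * x))
  <= trunc_m2 p a (4 * x).
Proof.
  intros Hp Hx. unfold trunc_m2, two_tail.
  replace (4 * x ^ 2 * (expect p a (tail_ind (2 * x)) - expect p a (tail_ind (4 * x)))
           + x ^ 2 * (expect p a (tail_ind x) - expect p a (tail_ind (2 * x))))
    with ((3 * x ^ 2 * expect p a (tail_ind (2 * x)) + - (4 * x ^ 2) * expect p a (tail_ind (4 * x)))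
          + x ^ 2 * expect p a (tail_ind x)) by ring.
  rewrite <- !expect_scal, <- !expect_plus by auto with integ.
  apply expect_le; auto with integ. intro u. trunc_cases.
Qed.

(** Mass between [2 * x] and [4 * x] forces a strict increase, which serves to show that the
    truncated moment exceeds any of its earlier values. *)
Lemma trunc_m2_gap (p : Z -> R) (a x : R) :
  pmf p -> 0 < x -> trunc_m2 p a x + x ^ 2 * (two_tail p a (2 * x) - two_tail p a (4 * x)) <= trunc_m2 p a (4 * x).
Proof.
  intros Hp Hx. unfold trunc_m2, two_tail.
  replace (expect p a (trunc_sq x) + x ^ 2 * (expect p a (tail_ind (2 * x)) - expect p a (tail_ind (4 * x))))
    with ((expect p a (trunc_sq x) + x ^ 2 * expect p a (tail_ind (2 * x))) + - x ^ 2 * expect p a (tail_ind (4 * x))) by ring.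
  rewrite <- !expect_scal, <- !expect_plus by auto with integ.
  apply expect_le; auto with integ. intro u. trunc_cases.
Qed.

Lemma trunc_m1_double_le (p : Z -> R) (a x : R) :
  pmf p -> 0 < x -> trunc_m1 p a (2 * x) <= trunc_m1 p a x + 2 * x * two_tail p a x.
Proof.
  intros Hp Hx. unfold trunc_m1, two_tail. rewrite <- expect_scal, <- expect_plus by auto with integ.
  apply expect_le; auto with integ. intro u. trunc_cases.
Qed.

Lemma tail_m1_double_ge (p : Z -> R) (a x : R) :
  pmf p -> integrable p a Rabs -> 0 < x ->
  tail_m1 p a x <= tail_m1 p a (2 * x) + 2 * x * two_tail p a x.
Proof.
  intros Hp Hi Hx. unfold tail_m1, two_tail. rewrite <- expect_scal, <- expect_plus by auto with integ.
  apply expect_le; auto with integ. intro u. trunc_cases.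
Qed.

Lemma sumZ_tail_small (f : Z -> R) (e : R) :
  abs_summable f -> 0 < e ->
  exists N : nat, abs_summable (fun k => if Z_le_dec (Z.abs k) (Z.of_nat N) then 0 else Rabs (f k)) /\
    sumZ (fun k => if Z_le_dec (Z.abs k) (Z.of_nat N) then 0 else Rabs (f k)) <= e.
Proof.
  intros [F1 F2] He. assert (He2 : 0 < e / 2) by lra.
  destruct (Series_remainder_small _ _ F1 He2) as [N1 H1].
  destruct (Series_remainder_small _ _ F2 He2) as [N2 H2].
  (* The successor is there because index [n] of the negative half stands for [- (n + 1)]. *)
  set (N := S (Nat.max N1 N2)). exists N.
  set (g := fun k => if Z_le_dec (Z.abs k) (Z.of_nat N) then 0 else Rabs (f k)).
  assert (Hg : forall k, Rabs (g k) <= Rabs (f k)).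
  { intro k. unfold g. destruct (Z_le_dec (Z.abs k) (Z.of_nat N)).
    - rewrite Rabs_R0. apply Rabs_pos.
    - rewrite Rabs_Rabsolu. lra. }
  split; [apply abs_summable_le with (1 := Hg); apply abs_summable_abs; now split|].
  assert (Z1 : sum_n (fun n => g (Z.of_nat n)) (N1) = 0).
  { rewrite sum_n_Reals. apply sum_eq_R0. intros n Hn. unfold g.
    destruct (Z_le_dec _ _) as [|HH]; [reflexivity|]. exfalso. apply HH. unfold N. lia. }
  assert (Z2 : sum_n (fun n => g (- Z.of_nat (S n))%Z) (N2) = 0).
  { rewrite sum_n_Reals. apply sum_eq_R0. intros n Hn. unfold g.
    destruct (Z_le_dec _ _) as [|HH]; [reflexivity|]. exfalso. apply HH. unfold N. lia. }
  assert (B1 := Series_remainder_le (fun n => g (Z.of_nat n)) _ N1 (fun n => Hg (Z.of_nat n)) F1).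
  assert (B2 := Series_remainder_le (fun n => g (- Z.of_nat (S n))%Z) _ N2
                  (fun n => Hg (- Z.of_nat (S n))%Z) F2).
  specialize (H1 N1 (le_n _)). specialize (H2 N2 (le_n _)).
  rewrite Z1, Rminus_0_r in B1. rewrite Z2, Rminus_0_r in B2.
  apply Rabs_def2 in H1. apply Rabs_def2 in H2.
  apply Rabs_le_between in B1. apply Rabs_le_between in B2.
  unfold sumZ. lra.
Qed.

Lemma tail_m1_small (p : Z -> R) (a e : R) :
  pmf p -> integrable p a Rabs -> 0 < e -> exists A, forall y, A <= y -> tail_m1 p a y <= e.
Proof.
  intros Hp Hi He. destruct (sumZ_tail_small _ e Hi He) as [N [HN1 HN2]].
  exists (Rabs a + INR N). intros y Hy. eapply Rle_trans; [|exact HN2].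
  apply sumZ_le; auto; [|now apply integrable_tail_abs].
  intro k. assert (Hpk := proj1 Hp k). unfold tail_abs.
  rewrite Rabs_mult, Rabs_Rabsolu, (Rabs_pos_eq (p k)) by assumption.
  assert (H0 := Rabs_pos (a + IZR k)).
  destruct (Z_le_dec (Z.abs k) (Z.of_nat N)) as [Hk|Hk];
    destruct (Rle_dec (Rabs (a + IZR k)) y) as [Hl|Hl]; try nra.
  exfalso. apply Hl. eapply Rle_trans; [apply Rabs_triang|].
  apply IZR_le in Hk. rewrite abs_IZR, <- INR_IZR_INZ in Hk. lra.
Qed.

Lemma ex_series_eventually_pos (u : nat -> R) :
  ex_series u -> (exists N, forall n, (N <= n)%nat -> 0 <= u n) ->
  ex_series (fun n => Rabs (u n)).
Proof.
  intros Hu [N HN].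
  apply (ex_series_incr_n (K := R_AbsRing) (V := R_NormedModule) _ N).
  apply (ex_series_incr_n (K := R_AbsRing) (V := R_NormedModule) u N) in Hu.
  eapply ex_series_ext; [|exact Hu].
  intro n. cbv beta. rewrite Rabs_pos_eq; [reflexivity|]. apply HN. lia.
Qed.

(** The hypothesis gives mere convergence of two half-series, but [a + IZR k] has a constant sign
    far out on each side, so the convergence is absolute. *)
Lemma mean_zero (p : Z -> R) (a : R) :
  pmf p -> Zsummable (fun k => (a + IZR k) * p k) 0 ->
  integrable p a (fun x => x) /\ integrable p a Rabs /\ expect p a (fun x => x) = 0.
Proof.
  intros Hp (s1 & s2 & H1 & H2 & H0).
  apply is_series_Reals in H1. apply is_series_Reals in H2.
  assert (HI : integrable p a (fun x => x)).
  { split.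
    - apply ex_series_eventually_pos; [now exists s1|].
      destruct (archimed (- a)) as [Ha _]. exists (Z.to_nat (up (- a))). intros n Hn.
      apply Rmult_le_pos; [|apply Hp].
      assert (IZR (up (- a)) <= IZR (Z.of_nat n)) by (apply IZR_le; lia). lra.
    - eapply ex_series_ext.
      2:{ apply (ex_series_eventually_pos (fun n => - ((a + IZR (- Z.of_nat (S n))) * p (- Z.of_nat (S n))%Z))).
          - apply (ex_series_opp (V := R_NormedModule)). now exists s2.
          - destruct (archimed a) as [Ha _]. exists (Z.to_nat (up a)). intros n Hn.
            assert (Hq := proj1 Hp (- Z.of_nat (S n))%Z).
            assert (IZR (up a) <= IZR (Z.of_nat (S n))) by (apply IZR_le; lia).
            rewrite opp_IZR. nra. }
      intro n. cbv beta. now rewrite Rabs_Ropp. }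
  split; [assumption|split].
  - apply abs_summable_abs in HI. eapply abs_summable_ext; [|exact HI]. intro k. cbv beta.
    rewrite Rabs_mult, (Rabs_pos_eq (p k)) by apply Hp. reflexivity.
  - unfold expect, sumZ. rewrite (is_series_unique _ _ H1), (is_series_unique _ _ H2). now symmetry.
Qed.

(** * Regular variation by dyadic iteration *)

Definition at_infinity (P : R -> Prop) : Prop := exists A, forall x, A <= x -> P x.

Lemma at_infinity_and (P Q : R -> Prop) : at_infinity P -> at_infinity Q -> at_infinity (fun x => P x /\ Q x).
Proof.
  intros [A HA] [B HB]. exists (Rmax A B). intros x Hx. split.
  - apply HA. eapply Rle_trans; [apply Rmax_l|eassumption].
  - apply HB. eapply Rle_trans; [apply Rmax_r|eassumption].
Qed.

Lemma at_infinity_imp (P Q : R -> Prop) : (forall x, P x -> Q x) -> at_infinity P -> at_infinity Q.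
Proof. intros H [A HA]. exists A. auto. Qed.

Lemma at_infinity_ge (A : R) : at_infinity (fun x => A <= x).
Proof. exists A. auto. Qed.

Lemma at_infinity_scale (P : R -> Prop) (lam : R) : 0 < lam -> at_infinity P -> at_infinity (fun x => P (lam * x)).
Proof.
  intros Hl [A HA]. exists (A / lam). intros x Hx. apply HA.
  apply Rmult_le_compat_l with (r := lam) in Hx; [|lra].
  replace (lam * (A / lam)) with A in Hx by (field; lra). assumption.
Qed.

Lemma at_infinity_lim (f : R -> R) (l e : R) :
  lim_infty f l -> 0 < e -> at_infinity (fun x => l - e < f x < l + e).
Proof.
  intros H He. destruct (H e He) as [A HA]. exists (A + 1). intros x Hx.
  specialize (HA x ltac:(lra)). apply Rabs_def2 in HA. lra.
Qed.

Lemma dyadic_locate (x0 x : R) :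
  0 < x0 <= x -> exists k : nat, x0 * 2 ^ k <= x < x0 * 2 ^ S k.
Proof.
  intros Hx. assert (H : exists n : nat, x < x0 * 2 ^ n).
  { destruct (Pow_x_infinity 2) with (b := x / x0 + 1) as [N HN].
    - rewrite Rabs_pos_eq; lra.
    - exists N. specialize (HN N (le_n N)).
      rewrite Rabs_pos_eq in HN by (apply pow_le; lra).
      assert (x / x0 < 2 ^ N) by lra.
      apply Rmult_lt_compat_l with (r := x0) in H; [|lra].
      replace (x0 * (x / x0)) with x in H by (field; lra). assumption. }
  destruct H as [n Hn]. induction n as [|n IH].
  - simpl in Hn. lra.
  - destruct (Rlt_dec x (x0 * 2 ^ n)); [auto|]. exists n. lra.
Qed.

Lemma dyadic_iter (f : R -> R) (v x0 : R) :
  0 <= v -> 0 < x0 -> (forall x, x0 <= x -> f (2 * x) <= v * f x) ->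
  forall (k : nat) x, x0 <= x -> f (2 ^ k * x) <= v ^ k * f x.
Proof.
  intros Hv Hx0 H. induction k as [|k IH]; intros x Hx.
  - simpl. rewrite !Rmult_1_l. lra.
  - replace (2 ^ S k * x) with (2 * (2 ^ k * x)) by (simpl; ring).
    assert (1 <= 2 ^ k) by (apply pow_R1_Rle; lra).
    eapply Rle_trans; [apply H; nra|]. simpl. rewrite Rmult_assoc.
    apply Rmult_le_compat_l; auto.
Qed.

(* One half of Karamata's theorem: if [g] grows at least geometrically along
   dyadic scales, it dominates any [f] whose dyadic increments it dominates. *)
Lemma dyadic_sum_le (f g : R -> R) (A gam K x0 : R) :
  0 < x0 -> 0 <= A -> 0 <= gam < 1 ->
  (forall x, x0 <= x -> 0 <= g x) ->
  (forall x, x0 <= x -> f (2 * x) <= f x + A * g x) ->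
  (forall x, x0 <= x -> g x <= gam * g (2 * x)) ->
  (forall x, x0 <= x <= 2 * x0 -> f x <= K * g x) ->
  exists C, 0 < C /\ forall x, x0 <= x -> f x <= C * g x.
Proof.
  intros Hx0 HA Hg Hg0 Hf Hgg HK.
  (* [K] starts the induction, 1 gives positivity, and the last entry yields [(C + A) * gam <= C],
     which closes the step. *)
  set (C := Rmax (Rmax K 1) (A * gam / (1 - gam))).
  assert (C1 : K <= C) by (unfold C; eapply Rle_trans; [apply Rmax_l|apply Rmax_l]).
  assert (C2 : 1 <= C) by (unfold C; eapply Rle_trans; [apply (Rmax_r K)|apply Rmax_l]).
  assert (C3 : (C + A) * gam <= C).
  { assert (H : A * gam / (1 - gam) <= C) by apply Rmax_r.
    apply Rmult_le_compat_r with (r := 1 - gam) in H; [|lra].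
    replace (A * gam / (1 - gam) * (1 - gam)) with (A * gam) in H by (field; lra). lra. }
  exists C. split; [lra|].
  assert (Hk : forall (k : nat) x, x0 <= x -> x < x0 * 2 ^ S k -> f x <= C * g x).
  { induction k as [|k IH]; intros x Hx1 Hx2.
    - simpl in Hx2. eapply Rle_trans; [apply HK; lra|].
      apply Rmult_le_compat_r; auto.
    - destruct (Rle_dec (2 * x0) x) as [Hl|Hl].
      2:{ eapply Rle_trans; [apply HK; lra|]. apply Rmult_le_compat_r; auto. }
      assert (Hh : x0 <= x / 2) by lra.
      assert (Hh2 : x / 2 < x0 * 2 ^ S k) by (simpl in *; lra).
      specialize (IH _ Hh Hh2). assert (Hf' := Hf _ Hh). assert (Hgg' := Hgg _ Hh).
      replace (2 * (x / 2)) with x in * by field.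
      assert (Hgx := Hg0 x Hx1).
      apply Rle_trans with ((C + A) * g (x / 2)); [lra|].
      apply Rle_trans with ((C + A) * (gam * g x)); [apply Rmult_le_compat_l; lra|].
      rewrite <- Rmult_assoc. now apply Rmult_le_compat_r. }
  intros x Hx. destruct (dyadic_locate x0 x) as [k Hkx]; [lra|].
  apply (Hk k); lra.
Qed.

Section Tails.

Variables (p : Z -> R) (a alpha c1 c2 : R) (l : R -> R).
Hypotheses (Hp : pmf p) (Halpha : 0 < alpha <= 2)
  (Hc1 : 0 <= c1) (Hc2 : 0 <= c2) (Hc12 : 0 < c1 + c2) (Hl : slowly_varying l)
  (Htail_r : lim_infty (fun x => Rpower x alpha * tail_right p a x / l x) c1)
  (Htail_l : lim_infty (fun x => Rpower x alpha * tail_left p a x / l x) c2).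

Lemma two_tail_tails (x : R) : two_tail p a x = tail_right p a x + tail_left p a x.
Proof.
  assert (HI : forall f : R -> R, (forall u, f u = 0 \/ f u = 1) -> integrable p a f).
  { intros f Hf. apply integrable_bounded with 1; auto. intro u.
    destruct (Hf u) as [-> | ->]; [rewrite Rabs_R0|rewrite Rabs_R1]; lra. }
  assert (I1 : integrable p a (fun u => if Rlt_dec x u then 1 else 0)).
  { apply HI. intro u. destruct (Rlt_dec x u); auto. }
  assert (I2 : integrable p a (fun u => if Rle_dec u (- x) then 1 else 0)).
  { apply HI. intro u. destruct (Rle_dec u (- x)); auto. }
  assert (E1 : forall k, (if Rlt_dec x (a + IZR k) then 1 else 0) * p k
                         = if Rlt_dec x (a + IZR k) then p k else 0).
  { intro k. destruct (Rlt_dec x (a + IZR k)); ring. }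
  assert (E2 : forall k, (if Rle_dec (a + IZR k) (- x) then 1 else 0) * p k
                         = if Rle_dec (a + IZR k) (- x) then p k else 0).
  { intro k. destruct (Rle_dec (a + IZR k) (- x)); ring. }
  unfold two_tail, tail_ind. rewrite expect_plus by assumption.
  unfold tail_right, tail_left.
  rewrite !Zsum_eq; [|exact (abs_summable_ext _ _ E2 I2)|exact (abs_summable_ext _ _ E1 I1)].
  unfold expect. now rewrite (sumZ_ext _ _ E1), (sumZ_ext _ _ E2).
Qed.

Lemma two_tail_asymp (e : R) : 0 < e ->
  at_infinity (fun x => 0 < l x /\ (1 - e) * (c1 + c2) * l x <= Rpower x alpha * two_tail p a x
                       <= (1 + e) * (c1 + c2) * l x).
Proof.
  (* One of [c1], [c2] may vanish, so each tail gets an absolute error [d]; together they make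
     [e * (c1 + c2)]. *)
  intro He. set (d := e * (c1 + c2) / 2). assert (Hd : 0 < d) by (unfold d; nra).
  destruct Hl as [[A HA] _].
  assert (H0 : at_infinity (fun x => 0 < l x)) by (exists (A + 1); intros x Hx; apply HA; lra).
  eapply at_infinity_imp; [|exact (at_infinity_and _ _ H0 (at_infinity_and _ _ (at_infinity_lim _ _ d Htail_r Hd) (at_infinity_lim _ _ d Htail_l Hd)))].
  intros x (Lx & Hr & Hll). split; [assumption|]. rewrite two_tail_tails.
  set (u := Rpower x alpha * tail_right p a x) in *.
  set (v := Rpower x alpha * tail_left p a x) in *.
  replace (Rpower x alpha * (tail_right p a x + tail_left p a x)) with (u + v) by (unfold u, v; ring).
  replace u with (u / l x * l x) by (field; lra). replace v with (v / l x * l x) by (field; lra).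
  set (u' := u / l x) in *. set (v' := v / l x) in *. clearbody u' v'.
  assert (E : e * (c1 + c2) = 2 * d) by (unfold d; field). split; nra.
Qed.

Lemma two_tail_pos : at_infinity (fun x => 0 < two_tail p a x).
Proof.
  eapply at_infinity_imp; [|apply (two_tail_asymp (/ 2)); lra]. cbv beta. intros x (Lx & H & _).
  assert (Hq := Rpower_pos x alpha). assert (HT := two_tail_nonneg p a x Hp).
  assert (0 < (1 - / 2) * (c1 + c2) * l x) by (apply Rmult_lt_0_compat; nra).
  destruct HT as [|HT]; [assumption|]. rewrite <- HT in H. lra.
Qed.

Lemma two_tail_ratio (e : R) : 0 < e ->
  at_infinity (fun x => (1 - e) * Rpower 2 (- alpha) * two_tail p a x <= two_tail p a (2 * x)
               <= (1 + e) * Rpower 2 (- alpha) * two_tail p a x).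
Proof.
  (* For [d <= / 4] one has [(1 + d)^2 <= (1 + 6 d) (1 - d)] and [(1 - d)^2 >= (1 - 3 d) (1 + d)],
     so [6 d <= e] suffices for both sides. *)
  intro He. set (d := Rmin (e / 6) (/ 4)).
  assert (Hd : 0 < d) by (unfold d; apply Rmin_glb_lt; lra).
  assert (Hd1 : d <= e / 6) by apply Rmin_l. assert (Hd2 : d <= / 4) by apply Rmin_r.
  assert (Hsv := proj2 Hl 2 ltac:(lra)).
  assert (HA := two_tail_asymp d Hd). assert (HA2 := at_infinity_scale _ 2 ltac:(lra) HA).
  eapply at_infinity_imp; [|exact (at_infinity_and _ _ (at_infinity_ge 1) (at_infinity_and _ _ HA (at_infinity_and _ _ HA2 (at_infinity_lim _ _ d Hsv Hd))))].
  cbv beta. intros x (Hx & (Lx & B1 & B2) & (L2x & B3 & B4) & B5).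
  rewrite <- Rpower_mult_distr in B3, B4 by lra.
  rewrite Rpower_Ropp. set (q := Rpower 2 alpha) in *.
  assert (Hq : 0 < q) by apply Rpower_pos.
  set (P := Rpower x alpha) in *. assert (HP : 0 < P) by apply Rpower_pos.
  set (t := two_tail p a x) in *. set (t2 := two_tail p a (2 * x)) in *.
  replace (l (2 * x)) with (l (2 * x) / l x * l x) in B3, B4 by (field; lra).
  set (r := l (2 * x) / l x) in *. set (L := l x) in *. set (c := c1 + c2) in *.
  clearbody q P t t2 r L c.
  assert (HcL : 0 < c * L) by (apply Rmult_lt_0_compat; assumption).
  assert (D1 : (1 - d) * (c * L) <= P * t) by lra.
  assert (D2 : P * t <= (1 + d) * (c * L)) by lra.
  assert (D3 : (1 - d) * (1 - d) * (c * L) <= P * (q * t2)).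
  { apply Rle_trans with ((1 - d) * r * (c * L)); [|lra].
    apply Rmult_le_compat_r; [lra|]. apply Rmult_le_compat_l; lra. }
  assert (D4 : P * (q * t2) <= (1 + d) * (1 + d) * (c * L)).
  { apply Rle_trans with ((1 + d) * r * (c * L)); [lra|].
    apply Rmult_le_compat_r; [lra|]. apply Rmult_le_compat_l; lra. }
  assert (Ht : 0 <= P * t) by nra.
  assert (U : q * t2 <= (1 + e) * t).
  { apply Rmult_le_reg_l with P; [assumption|].
    apply Rle_trans with ((1 + 6 * d) * (P * t)); [|nra].
    apply Rle_trans with ((1 + 6 * d) * ((1 - d) * (c * L))); [|apply Rmult_le_compat_l; lra].
    eapply Rle_trans; [exact D4|].
    replace ((1 + 6 * d) * ((1 - d) * (c * L))) with ((1 + 6 * d) * (1 - d) * (c * L)) by ring.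
    apply Rmult_le_compat_r; nra. }
  assert (V : (1 - e) * t <= q * t2).
  { apply Rmult_le_reg_l with P; [assumption|].
    apply Rle_trans with ((1 - 3 * d) * (P * t)); [nra|].
    apply Rle_trans with ((1 - 3 * d) * ((1 + d) * (c * L))); [apply Rmult_le_compat_l; lra|].
    eapply Rle_trans; [|exact D3].
    replace ((1 - 3 * d) * ((1 + d) * (c * L))) with ((1 - 3 * d) * (1 + d) * (c * L)) by ring.
    apply Rmult_le_compat_r; nra. }
  assert (Hqi : 0 < / q) by now apply Rinv_0_lt_compat.
  split.
  - replace t2 with (/ q * (q * t2)) by (field; lra).
    replace ((1 - e) * / q * t) with (/ q * ((1 - e) * t)) by ring.
    apply Rmult_le_compat_l; lra.
  - replace t2 with (/ q * (q * t2)) by (field; lra).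
    replace ((1 + e) * / q * t) with (/ q * ((1 + e) * t)) by ring.
    apply Rmult_le_compat_l; lra.
Qed.

Lemma two_tail_double_le (v : R) : Rpower 2 (- alpha) < v -> at_infinity (fun x => two_tail p a (2 * x) <= v * two_tail p a x).
Proof.
  intro Hv. assert (Hq := Rpower_pos 2 (- alpha)). set (q := Rpower 2 (- alpha)) in *.
  assert (He : 0 < v / q - 1).
  { assert (1 < v / q); [|lra]. apply Rmult_lt_reg_r with q; [assumption|].
    unfold Rdiv. rewrite Rmult_assoc, Rinv_l; lra. }
  eapply at_infinity_imp; [|exact (two_tail_ratio _ He)]. cbv beta. fold q. intros x [_ H].
  replace ((1 + (v / q - 1)) * q) with v in H by (field; lra). assumption.
Qed.

Lemma two_tail_double_ge (v : R) :
  0 < v < Rpower 2 (- alpha) -> at_infinity (fun x => v * two_tail p a x <= two_tail p a (2 * x)).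
Proof.
  intro Hv. assert (Hq := Rpower_pos 2 (- alpha)). set (q := Rpower 2 (- alpha)) in *.
  assert (He : 0 < 1 - v / q).
  { assert (v / q < 1); [|lra]. apply Rmult_lt_reg_r with q; [assumption|].
    unfold Rdiv. rewrite Rmult_assoc, Rinv_l; lra. }
  eapply at_infinity_imp; [|exact (two_tail_ratio _ He)]. cbv beta. fold q. intros x [H _].
  replace ((1 - (1 - v / q)) * q) with v in H by (field; lra). assumption.
Qed.

Lemma Rpower_2_lt (x y : R) : x < y -> Rpower 2 x < Rpower 2 y.
Proof. intro H. apply Rpower_lt; lra. Qed.

Lemma Rpower_2_m1 : Rpower 2 (- (1)) = / 2.
Proof. rewrite Rpower_Ropp, Rpower_1; lra. Qed.

Lemma Rpower_2_m2 : Rpower 2 (- (2)) = / 4.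
Proof.
  replace (- (2)) with (- INR 2) by (simpl; ring).
  rewrite Rpower_Ropp, Rpower_pow by lra. simpl. f_equal. ring.
Qed.

(** The shell between [x / 2] and [x] has mass at least [(/ v - 1) * two_tail p a x], since the tail
    shrinks by a factor [v < 1] per doubling; on it the square is at least [x ^ 2 / 4]. *)
Lemma two_tail_le_trunc_m2 : exists C, 0 < C /\ at_infinity (fun x => x ^ 2 * two_tail p a x <= C * trunc_m2 p a x).
Proof.
  assert (Hq : Rpower 2 (- alpha) < 1) by (rewrite <- (Rpower_O 2) by lra; apply Rpower_2_lt; lra).
  assert (Hq0 := Rpower_pos 2 (- alpha)).
  set (v := (1 + Rpower 2 (- alpha)) / 2). assert (Hv : 0 < v < 1) by (unfold v; lra).
  exists (4 * v / (1 - v)). split; [apply Rdiv_lt_0_compat; lra|].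
  assert (H := at_infinity_scale _ (/ 2) ltac:(lra) (two_tail_double_le v ltac:(unfold v; lra))).
  eapply at_infinity_imp; [|exact (at_infinity_and _ _ (at_infinity_ge 1) H)]. cbv beta. clear H. intros x [Hx H].
  assert (HW := trunc_m2_double_ge p a (/ 2 * x) Hp ltac:(lra)).
  replace (2 * (/ 2 * x)) with x in * by field.
  assert (H1 : (1 - v) * two_tail p a x <= v * (two_tail p a (/ 2 * x) - two_tail p a x)) by lra.
  assert (H2 : (/ 2 * x) ^ 2 * ((1 - v) * two_tail p a x) <= v * trunc_m2 p a x).
  { eapply Rle_trans; [apply Rmult_le_compat_l; [apply pow2_ge_0|exact H1]|]. nra. }
  apply Rmult_le_reg_r with ((1 - v) / 4); [lra|].
  replace (4 * v / (1 - v) * trunc_m2 p a x * ((1 - v) / 4)) with (v * trunc_m2 p a x) by (field; lra).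
  eapply Rle_trans; [|exact H2]. right. field.
Qed.

Lemma trunc_m2_pos : at_infinity (fun x => 0 < trunc_m2 p a x).
Proof.
  destruct two_tail_le_trunc_m2 as [C [HC E]].
  eapply at_infinity_imp; [|exact (at_infinity_and _ _ (at_infinity_ge 1) (at_infinity_and _ _ E two_tail_pos))].
  cbv beta. intros x (Hx & H1 & H2).
  assert (0 < x ^ 2 * two_tail p a x) by (apply Rmult_lt_0_compat; [nra|assumption]).
  assert (HW := trunc_m2_nonneg p a x Hp). destruct HW as [|HW]; [assumption|]. rewrite <- HW in H1. lra.
Qed.

(** As [v < 2 ^ (- alpha)], the tail retains at least the fraction [v] per doubling, so
    [x ^ i * two_tail p a x] gains the factor [2 ^ i * v > 1] and [dyadic_sum_le] applies. Such a
    [v] exists exactly when [alpha < i]. *)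
Lemma dyadic_dominated (f : R -> R) (i : nat) (A v : R) :
  0 <= A -> (forall x y, x <= y -> f x <= f y) -> 0 <= f 0 ->
  (forall x, 0 < x -> f (2 * x) <= f x + A * (x ^ i * two_tail p a x)) ->
  / 2 ^ i < v < Rpower 2 (- alpha) ->
  exists C, 0 < C /\ at_infinity (fun x => f x <= C * (x ^ i * two_tail p a x)).
Proof.
  intros HA Hmono Hf0 Hf Hv.
  assert (H2i : 0 < 2 ^ i) by (apply pow_lt; lra).
  assert (Hv0 : 0 < v) by (assert (0 < / 2 ^ i) by (now apply Rinv_0_lt_compat); lra).
  destruct (at_infinity_and _ _ (at_infinity_ge 1) (at_infinity_and _ _ two_tail_pos (two_tail_double_ge v (conj Hv0 (proj2 Hv)))))
    as [x0' Hx0]. set (x0 := Rmax x0' 1).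
  assert (Hx1 : 1 <= x0) by apply Rmax_r.
  assert (Hev : forall x, x0 <= x -> 0 < two_tail p a x /\ v * two_tail p a x <= two_tail p a (2 * x)).
  { intros x Hx. apply Hx0. eapply Rle_trans; [apply Rmax_l|exact Hx]. }
  set (g := fun x => x ^ i * two_tail p a x).
  assert (Hgpos : forall x, x0 <= x -> 0 < g x).
  { intros x Hx. apply Rmult_lt_0_compat; [apply pow_lt; lra|now apply Hev]. }
  destruct (dyadic_sum_le f g A (/ (2 ^ i * v)) (f (2 * x0) / (x0 ^ i * two_tail p a (2 * x0))) x0)
    as [C [HC HfC]]; auto.
  - lra.
  - assert (1 < 2 ^ i * v).
    { apply Rmult_lt_reg_l with (/ 2 ^ i); [now apply Rinv_0_lt_compat|].
      rewrite <- Rmult_assoc, Rinv_l; lra. }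
    split; [left; apply Rinv_0_lt_compat; lra|].
    rewrite <- Rinv_1. apply Rinv_lt_contravar; lra.
  - intros x Hx. left. auto.
  - intros x Hx. apply Hf. lra.
  - intros x Hx. destruct (Hev x Hx) as [_ H]. unfold g.
    rewrite Rpow_mult_distr.
    apply Rmult_le_reg_l with v; [assumption|].
    replace (v * (/ (2 ^ i * v) * (2 ^ i * x ^ i * two_tail p a (2 * x)))) with (x ^ i * two_tail p a (2 * x))
      by (field; lra).
    replace (v * (x ^ i * two_tail p a x)) with (x ^ i * (v * two_tail p a x)) by ring.
    apply Rmult_le_compat_l; [apply pow_le; lra|assumption].
  (* On the starting interval [[x0, 2 * x0]] monotonicity bounds [f] by its right end and the
     comparison function from below by [x0 ^ i * two_tail p a (2 * x0)]. *)
  - intros x Hx. set (K := f (2 * x0) / (x0 ^ i * two_tail p a (2 * x0))).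
    assert (Hb : 0 < x0 ^ i * two_tail p a (2 * x0)).
    { apply Rmult_lt_0_compat; [apply pow_lt; lra|apply Hev; lra]. }
    assert (Hf2 : 0 <= f (2 * x0)) by (eapply Rle_trans; [exact Hf0|apply Hmono; lra]).
    apply Rle_trans with (f (2 * x0)); [apply Hmono; lra|].
    replace (f (2 * x0)) with (K * (x0 ^ i * two_tail p a (2 * x0))).
    2:{ unfold K. unfold Rdiv. rewrite Rmult_assoc, Rinv_l; lra. }
    apply Rmult_le_compat_l.
    + apply Rmult_le_pos; [assumption|]. left. now apply Rinv_0_lt_compat.
    + apply Rmult_le_compat; [apply pow_le; lra|now apply two_tail_nonneg|apply pow_incr; lra|].
      apply two_tail_mono; auto. lra.
  - exists C. split; [assumption|]. exists x0. exact HfC.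
Qed.

Lemma trunc_m2_le_two_tail : alpha < 2 -> exists C, 0 < C /\ at_infinity (fun x => trunc_m2 p a x <= C * (x ^ 2 * two_tail p a x)).
Proof.
  intro Ha. assert (Hq : / 4 < Rpower 2 (- alpha)) by (rewrite <- Rpower_2_m2; apply Rpower_2_lt; lra).
  apply (dyadic_dominated (trunc_m2 p a) 2 4 ((/ 4 + Rpower 2 (- alpha)) / 2)).
  - lra.
  - intros x y Hxy. now apply trunc_m2_mono.
  - now apply trunc_m2_nonneg.
  - intros x Hx. rewrite <- Rmult_assoc. now apply trunc_m2_double_le.
  - replace (2 ^ 2) with 4 by ring. lra.
Qed.

Lemma trunc_m1_le_two_tail : alpha < 1 -> exists C, 0 < C /\ at_infinity (fun x => trunc_m1 p a x <= C * (x ^ 1 * two_tail p a x)).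
Proof.
  intro Ha. assert (Hq : / 2 < Rpower 2 (- alpha)) by (rewrite <- Rpower_2_m1; apply Rpower_2_lt; lra).
  apply (dyadic_dominated (trunc_m1 p a) 1 2 ((/ 2 + Rpower 2 (- alpha)) / 2)).
  - lra.
  - intros x y Hxy. now apply trunc_m1_mono.
  - apply expect_nonneg; [exact Hp| |now apply integrable_trunc_abs].
    intro u. unfold trunc_abs. destruct (Rle_dec (Rabs u) 0); [apply Rabs_pos|lra].
  - intros x Hx. rewrite pow_1, <- Rmult_assoc. now apply trunc_m1_double_le.
  - rewrite pow_1. lra.
Qed.

(** Sums the shells above [x]: the k-th contributes at most [2 * x * (2 * v) ^ k * two_tail p a x],
    a geometric series with [2 * v < 1] because [alpha > 1]. Integrability makes the remainder
    vanish. *)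
Lemma tail_m1_le_two_tail : 1 < alpha -> integrable p a Rabs ->
  exists C, 0 < C /\ at_infinity (fun x => tail_m1 p a x <= C * (x * two_tail p a x)).
Proof.
  intros Ha Hi.
  assert (Hq : Rpower 2 (- alpha) < / 2) by (rewrite <- Rpower_2_m1; apply Rpower_2_lt; lra).
  assert (Hq0 := Rpower_pos 2 (- alpha)).
  set (v := (/ 2 + Rpower 2 (- alpha)) / 2). assert (Hv : 0 < v < / 2) by (unfold v; lra).
  destruct (two_tail_double_le v ltac:(unfold v; lra)) as [x0' Hx0'].
  set (x0 := Rmax x0' 1). assert (Hx1 : 1 <= x0) by apply Rmax_r.
  assert (HT : forall x, x0 <= x -> two_tail p a (2 * x) <= v * two_tail p a x).
  { intros x Hx. apply Hx0'. eapply Rle_trans; [apply Rmax_l|exact Hx]. }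
  (* The sum of the geometric series, that is the fixed point of [C = 2 + 2 * v * C]. *)
  set (C := 2 / (1 - 2 * v)). assert (HC : 0 < C) by (apply Rdiv_lt_0_compat; lra).
  assert (EC : 2 + 2 * v * C = C) by (unfold C; field; lra).
  exists C. split; [assumption|]. exists x0. intros x Hx.
  assert (Hk : forall (k : nat) y, x0 <= y -> tail_m1 p a y <= C * (y * two_tail p a y) + tail_m1 p a (2 ^ k * y)).
  { induction k as [|k IH]; intros y Hy.
    - rewrite pow_O, Rmult_1_l. assert (0 <= y * two_tail p a y); [|nra].
      apply Rmult_le_pos; [lra|now apply two_tail_nonneg].
    - assert (H1 := tail_m1_double_ge p a y Hp Hi ltac:(lra)).
      assert (H2 := IH (2 * y) ltac:(lra)).
      replace (2 ^ k * (2 * y)) with (2 ^ S k * y) in H2 by (simpl; ring).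
      assert (H3 := HT y Hy).
      assert (H4 : C * (2 * y * two_tail p a (2 * y)) <= C * (2 * y * (v * two_tail p a y))).
      { apply Rmult_le_compat_l; [lra|]. apply Rmult_le_compat_l; lra. }
      replace (C * (y * two_tail p a y)) with ((2 + 2 * v * C) * (y * two_tail p a y)) by (rewrite EC; ring).
      lra. }
  (* A positive excess [e] would persist in every remainder [tail_m1 p a (2 ^ N * x)], which however
     drops below [e / 2]. *)
  apply Rnot_lt_le. intro Hlt.
  set (e := tail_m1 p a x - C * (x * two_tail p a x)).
  destruct (tail_m1_small p a (e / 2) Hp Hi) as [A HA]; [unfold e; lra|].
  destruct (Pow_x_infinity 2) with (b := A) as [N HN]; [rewrite Rabs_pos_eq; lra|].
  specialize (HN N (le_n N)). rewrite Rabs_pos_eq in HN by (apply pow_le; lra).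
  assert (H1 : 0 < 2 ^ N) by (apply pow_lt; lra).
  assert (H2 := HA (2 ^ N * x) ltac:(nra)). assert (H3 := Hk N x Hx). unfold e in *. lra.
Qed.

(** A one-sided Potter bound: [rho < 4] means that [trunc_m2 p a x / x ^ 2] decays geometrically
    along doublings. For [alpha < 2] the moment is comparable to [x ^ 2 * two_tail p a x]. At
    [alpha = 2] only one side of that comparison remains, and its constant has to be made
    explicit. *)
Lemma trunc_m2_growth : exists C rho, 0 < C /\ 1 <= rho < 4 /\
  at_infinity (fun x => forall k : nat, trunc_m2 p a (2 ^ k * x) <= C * rho ^ k * trunc_m2 p a x).
Proof.
  assert (Hq0 := Rpower_pos 2 (- alpha)).
  destruct (Rlt_dec alpha 2) as [Ha|Ha].
  - assert (Hq : Rpower 2 (- alpha) < 1) by (rewrite <- (Rpower_O 2) by lra; apply Rpower_2_lt; lra).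
    assert (Hq' : / 4 < Rpower 2 (- alpha)) by (rewrite <- Rpower_2_m2; apply Rpower_2_lt; lra).
    set (v := (1 + Rpower 2 (- alpha)) / 2). assert (Hv : / 4 < v < 1) by (unfold v; lra).
    destruct (trunc_m2_le_two_tail Ha) as [C1 [HC1 E1]]. destruct two_tail_le_trunc_m2 as [C2 [HC2 E2]].
    destruct (at_infinity_and _ _ (at_infinity_ge 1) (at_infinity_and _ _ E1 (at_infinity_and _ _ E2
       (two_tail_double_le v ltac:(unfold v; lra))))) as [x0' Hx0'].
    set (x0 := Rmax x0' 1). assert (Hx1 : 1 <= x0) by apply Rmax_r.
    assert (Hx0 : forall x, x0 <= x -> 1 <= x /\ trunc_m2 p a x <= C1 * (x ^ 2 * two_tail p a x) /\
       x ^ 2 * two_tail p a x <= C2 * trunc_m2 p a x /\ two_tail p a (2 * x) <= v * two_tail p a x).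
    { intros x Hx. apply Hx0'. eapply Rle_trans; [apply Rmax_l|exact Hx]. }
    clear Hx0'. exists (C1 * C2), (4 * v). split; [now apply Rmult_lt_0_compat|]. split; [lra|].
    exists x0. intros x Hx k.
    assert (Hk : 1 <= 2 ^ k) by (apply pow_R1_Rle; lra).
    assert (HT := dyadic_iter (two_tail p a) v x0 ltac:(lra) ltac:(lra)
                    (fun x Hx => proj2 (proj2 (proj2 (Hx0 x Hx)))) k x Hx).
    destruct (Hx0 (2 ^ k * x) ltac:(nra)) as (_ & B1 & _).
    destruct (Hx0 x Hx) as (_ & _ & B2 & _).
    eapply Rle_trans; [exact B1|]. rewrite !Rmult_assoc.
    apply Rmult_le_compat_l; [lra|].
    replace ((2 ^ k * x) ^ 2) with (4 ^ k * x ^ 2).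
    2:{ rewrite Rpow_mult_distr, <- pow_mult, Nat.mul_comm, pow_mult.
        replace (2 ^ 2) with 4 by ring. ring. }
    rewrite Rpow_mult_distr.
    replace (C2 * (4 ^ k * v ^ k * trunc_m2 p a x)) with (4 ^ k * v ^ k * (C2 * trunc_m2 p a x)) by ring.
    apply Rle_trans with (4 ^ k * x ^ 2 * (v ^ k * two_tail p a x)).
    + apply Rmult_le_compat_l; [|assumption].
      apply Rmult_le_pos; [apply pow_le; lra|apply pow2_ge_0].
    + replace (4 ^ k * x ^ 2 * (v ^ k * two_tail p a x)) with (4 ^ k * v ^ k * (x ^ 2 * two_tail p a x)) by ring.
      apply Rmult_le_compat_l; [|assumption].
      apply Rmult_le_pos; apply pow_le; lra.
  - assert (Ea : alpha = 2) by lra.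
    (* Any number slightly above 1/4 works. With 0.26 the two shells give [trunc_m2 p a x >= 1.38 *
       x ^ 2 * two_tail p a x], and doubling multiplies the moment by at most
       [1 + 4 / 1.38 < 3.9]. *)
    assert (Hq : Rpower 2 (- alpha) < 26 / 100) by (rewrite Ea, Rpower_2_m2; lra).
    assert (E := two_tail_double_le _ Hq).
    destruct (at_infinity_and _ _ (at_infinity_ge 1) (at_infinity_and _ _ (at_infinity_scale _ (/ 4) ltac:(lra) E)
                (at_infinity_scale _ (/ 2) ltac:(lra) E))) as [x0' Hx0'].
    set (x0 := Rmax x0' 1). assert (Hx1 : 1 <= x0) by apply Rmax_r.
    assert (Hx0 : forall x, x0 <= x -> trunc_m2 p a (2 * x) <= 39 / 10 * trunc_m2 p a x).
    { intros x Hx. destruct (Hx0' x) as (Hx1' & B1 & B2); [eapply Rle_trans; [apply Rmax_l|exact Hx]|].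
      assert (G := trunc_m2_quad_ge p a (/ 4 * x) Hp ltac:(lra)).
      assert (D := trunc_m2_double_le p a x Hp ltac:(lra)).
      replace (2 * (/ 4 * x)) with (/ 2 * x) in * by field.
      replace (4 * (/ 4 * x)) with x in * by field.
      replace (2 * (/ 2 * x)) with x in * by field.
      set (X := x ^ 2) in *.
      replace ((/ 4 * x) ^ 2) with (X / 16) in G by (unfold X; field).
      assert (HX : 0 < X) by (unfold X; nra).
      assert (HT := two_tail_nonneg p a x Hp).
      assert (G2 : X * (138 / 100 * two_tail p a x) <= trunc_m2 p a x).
      { eapply Rle_trans; [|exact G].
        replace (4 * (X / 16) * (two_tail p a (/ 2 * x) - two_tail p a x)
                 + X / 16 * (two_tail p a (/ 4 * x) - two_tail p a (/ 2 * x)))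
          with (X * ((3 * two_tail p a (/ 2 * x) + two_tail p a (/ 4 * x) - 4 * two_tail p a x) / 16)) by field.
        apply Rmult_le_compat_l; lra. }
      nra. }
    exists 1, (39 / 10). split; [lra|]. split; [lra|]. exists x0. intros x Hx k. rewrite Rmult_1_l.
    exact (dyadic_iter (trunc_m2 p a) (39 / 10) x0 ltac:(lra) ltac:(lra) Hx0 k x Hx).
Qed.

End Tails.

(** * Bounds for the characteristic function near zero *)

Lemma exp_ge_1_plus (x : R) : 1 - x <= exp (- x).
Proof. generalize (exp_ineq1_le (- x)). lra. Qed.

Lemma abs_sub_ge_half (u x0 : R) : 2 * Rabs x0 < Rabs u -> u ^ 2 <= 4 * (u - x0) ^ 2.
Proof.
  unfold Rabs. destruct (Rcase_abs x0), (Rcase_abs u); intro; nra.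
Qed.

(** Discarding [|u| <= 2 |x0|] leaves [|u - x0| >= |u| / 2], while [|u - x0| <= 2 x] keeps the
    cosine in its quadratic range; 1/32 is 1/8 from [one_minus_cos_ge] times 1/4. *)
Lemma one_minus_cos_trunc (x0 x u : R) :
  0 < x -> 2 * Rabs x0 <= x ->
  / 32 * / x ^ 2 * (trunc_sq x u + -1 * trunc_sq (2 * Rabs x0) u) <= 1 - cos (/ x * (u - x0)).
Proof.
  intros Hx Hd. assert (H0 := COS_bound (/ x * (u - x0))). assert (Hx0 := Rabs_pos x0).
  unfold trunc_sq. destruct (Rle_dec (Rabs u) x) as [H1|H1];
    destruct (Rle_dec (Rabs u) (2 * Rabs x0)) as [H2|H2]; try lra.
  assert (Hi : 0 < / x) by now apply Rinv_0_lt_compat.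
  eapply Rle_trans; [|apply one_minus_cos_ge].
  - rewrite Rpow_mult_distr, pow_inv. assert (Hs := abs_sub_ge_half u x0 ltac:(lra)).
      assert (0 < / x ^ 2) by (apply Rinv_0_lt_compat, pow_lt; lra). nra.
  - rewrite Rabs_mult, (Rabs_pos_eq (/ x)) by lra.
    apply Rmult_le_reg_l with x; [assumption|]. rewrite <- Rmult_assoc, Rinv_r, Rmult_1_l by lra.
    assert (H3 := Rabs_triang u (- x0)). rewrite Rabs_Ropp in H3.
      replace (u + - x0) with (u - x0) in H3 by ring. lra.
Qed.

Section CharacteristicFunction.

Variables (p : Z -> R) (a alpha c1 c2 : R) (l : R -> R).
Hypotheses (Hp : pmf p) (Halpha : 0 < alpha <= 2)
  (Hc1 : 0 <= c1) (Hc2 : 0 <= c2) (Hc12 : 0 < c1 + c2) (Hl : slowly_varying l)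
  (Htail_r : lim_infty (fun x => Rpower x alpha * tail_right p a x / l x) c1)
  (Htail_l : lim_infty (fun x => Rpower x alpha * tail_left p a x / l x) c2).

(** The truncated moment may converge, so the constant is beaten by a strict gap: since the tail
    strictly decreases from [2 * y1] to [4 * y1], the moment at [4 * y1] exceeds that at [d], and
    [c] is the relative gap there. *)
Lemma trunc_m2_minus_const (d : R) :
  exists c, 0 < c /\ at_infinity (fun x => c * trunc_m2 p a x <= trunc_m2 p a x - trunc_m2 p a d).
Proof.
  assert (Hq : Rpower 2 (- alpha) < 1) by (rewrite <- (Rpower_O 2) by lra; apply Rpower_2_lt; lra).
  assert (E1 := two_tail_double_le p a alpha c1 c2 l Hp Hc12 Hl Htail_r Htail_l
                  ((1 + Rpower 2 (- alpha)) / 2) ltac:(lra)).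
  assert (E2 := two_tail_pos p a alpha c1 c2 l Hp Hc12 Hl Htail_r Htail_l).
  destruct (at_infinity_and _ _ (at_infinity_ge (Rmax 1 d)) (at_infinity_scale _ 2 ltac:(lra) (at_infinity_and _ _ E1 E2))) as [y Hy].
  set (y1 := Rmax y (Rmax 1 d)). destruct (Hy y1 (Rmax_l _ _)) as (_ & H1 & H2).
  assert (Hy1 : 1 <= y1) by (eapply Rle_trans; [apply (Rmax_l 1 d)|apply Rmax_r]).
  assert (Hyd : d <= y1) by (eapply Rle_trans; [apply (Rmax_r 1 d)|apply Rmax_r]).
  assert (HG := trunc_m2_gap p a y1 Hp ltac:(lra)).
  replace (2 * (2 * y1)) with (4 * y1) in H1 by ring.
  assert (Hgap : trunc_m2 p a y1 < trunc_m2 p a (4 * y1)).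
  { assert (two_tail p a (4 * y1) < two_tail p a (2 * y1)) by nra.
    assert (0 < y1 ^ 2) by nra. nra. }
  assert (Hd := trunc_m2_mono p a d y1 Hp Hyd). assert (Hd0 := trunc_m2_nonneg p a d Hp).
  assert (HW4 : 0 < trunc_m2 p a (4 * y1)) by lra.
  exists (1 - trunc_m2 p a d / trunc_m2 p a (4 * y1)). split.
  - assert (trunc_m2 p a d / trunc_m2 p a (4 * y1) < 1); [|lra].
    apply Rmult_lt_reg_r with (trunc_m2 p a (4 * y1)); [assumption|].
    unfold Rdiv. rewrite Rmult_assoc, Rinv_l; lra.
  - exists (4 * y1). intros x Hx. assert (Hm := trunc_m2_mono p a _ _ Hp Hx).
    assert (trunc_m2 p a d <= trunc_m2 p a d / trunc_m2 p a (4 * y1) * trunc_m2 p a x); [|lra].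
    replace (trunc_m2 p a d) with (trunc_m2 p a d / trunc_m2 p a (4 * y1) * trunc_m2 p a (4 * y1)) at 1 by (field; lra).
    apply Rmult_le_compat_l; [|assumption].
    apply Rmult_le_pos; [assumption|]. left. now apply Rinv_0_lt_compat.
Qed.

Lemma chf_upper :
  exists c, 0 < c /\ at_infinity (fun x => Cmod (chf p a (/ x)) <= exp (- (c * (trunc_m2 p a x / x ^ 2)))).
Proof.
  destruct (pmf_atom p Hp) as [k0 Hk0]. set (x0 := a + IZR k0).
  destruct (trunc_m2_minus_const (2 * Rabs x0)) as [c [Hc E]].
  exists (p k0 / 2 * (/ 32 * c)). split; [nra|].
  eapply at_infinity_imp; [|exact (at_infinity_and _ _ (at_infinity_ge (Rmax 1 (2 * Rabs x0))) E)].
  cbv beta. intros x [Hx H].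
  assert (Hx1 : 1 <= x) by (eapply Rle_trans; [apply Rmax_l|exact Hx]).
  assert (Hx2 : 2 * Rabs x0 <= x) by (eapply Rle_trans; [apply Rmax_r|exact Hx]).
  eapply Rle_trans; [apply (Cmod_chf_le p a (/ x) k0 Hp)|]. fold x0.
  eapply Rle_trans; [|apply exp_ge_1_plus].
  assert (Hx2p : 0 < / x ^ 2) by (apply Rinv_0_lt_compat, pow_lt; lra).
  assert (HE : / 32 * c * (trunc_m2 p a x / x ^ 2) <= expect p a (fun u => 1 - cos (/ x * (u - x0)))).
  { apply Rle_trans with (/ 32 * / x ^ 2 * (trunc_m2 p a x + -1 * trunc_m2 p a (2 * Rabs x0))).
    - unfold Rdiv. nra.
    - unfold trunc_m2. rewrite <- expect_scal, <- expect_plus, <- expect_scal;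
        [|now apply integrable_trunc_sq|apply integrable_scal; now apply integrable_trunc_sq].
      apply expect_le; auto.
      + intro u. apply one_minus_cos_trunc; lra.
      + apply integrable_scal, integrable_plus; [now apply integrable_trunc_sq|].
        apply integrable_scal; now apply integrable_trunc_sq.
      + apply integrable_bounded with 2; auto. intro u. apply Rabs_le.
        generalize (COS_bound (/ x * (u - x0))). lra. }
  assert (p k0 / 2 * (/ 32 * c * (trunc_m2 p a x / x ^ 2))
          <= p k0 / 2 * expect p a (fun u => 1 - cos (/ x * (u - x0)))).
  { apply Rmult_le_compat_l; lra. }
  lra.
Qed.

Lemma chf_cos_part (x : R) : 0 < x ->
  Rabs (expect p a (fun u => cos (/ x * u)) - 1) <= trunc_m2 p a x / x ^ 2 + 2 * two_tail p a x.
Proof.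
  intro Hx.
  replace (expect p a (fun u => cos (/ x * u)) - 1) with (expect p a (fun u => cos (/ x * u) + -1)).
  2:{ rewrite expect_plus, expect_const; auto; [now apply integrable_cos|].
      apply integrable_bounded with 1; auto. intro. rewrite Rabs_left; lra. }
  unfold trunc_m2, two_tail, Rdiv. rewrite (Rmult_comm (expect p a (trunc_sq x))), <- !expect_scal, <- expect_plus
    by (apply integrable_scal; [apply integrable_trunc_sq || apply integrable_tail_ind]; auto).
  apply expect_abs_le; auto.
  2:{ apply integrable_plus; apply integrable_scal;
      [now apply integrable_trunc_sq|now apply integrable_tail_ind]. }
  intro u. rewrite Rabs_left1 by (generalize (COS_bound (/ x * u)); lra).
  assert (Hi : 0 < / x ^ 2) by (apply Rinv_0_lt_compat, pow_lt; lra).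
  assert (H1 := one_minus_cos_le (/ x * u)). assert (H2 := COS_bound (/ x * u)).
  rewrite Rpow_mult_distr, pow_inv in H1.
  assert (Hu := pow2_ge_0 u).
  assert (0 <= / x ^ 2 * u ^ 2) by nra.
  revert H1 H2 H. generalize (cos (/ x * u)). intros cu H1 H2 H3.
  unfold trunc_sq, tail_ind. destruct (Rle_dec (Rabs u) x) as [Ha|Ha].
  - destruct (Rlt_dec x u), (Rle_dec u (- x)); lra.
  - destruct (Rlt_dec x u), (Rle_dec u (- x)); try lra.
    exfalso. apply Ha. apply Rabs_le. lra.
Qed.

(** Meant for [alpha < 1], where the mean may not exist: the sine is estimated linearly inside the
    truncation and by 1 outside. *)
Lemma chf_sin_part_lt1 (x : R) : 0 < x ->
  Rabs (expect p a (fun u => sin (/ x * u))) <= trunc_m1 p a x / x + two_tail p a x.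
Proof.
  intro Hx. unfold trunc_m1, two_tail, Rdiv.
  rewrite (Rmult_comm (expect p a (trunc_abs x))), <- !expect_scal, <- expect_plus
    by (try apply integrable_scal; [apply integrable_trunc_abs || apply integrable_tail_ind]; auto).
  apply expect_abs_le; auto.
  2:{ apply integrable_plus; [apply integrable_scal|]; [now apply integrable_trunc_abs|now apply integrable_tail_ind]. }
  intro u. assert (Hi : 0 < / x) by now apply Rinv_0_lt_compat.
  assert (H1 := sin_le_abs (/ x * u)). rewrite (Rabs_mult (/ x)), (Rabs_pos_eq (/ x)) in H1 by lra.
  assert (H2 : Rabs (sin (/ x * u)) <= 1) by (apply Rabs_le, SIN_bound).
  assert (H0 := Rabs_pos u). assert (0 <= / x * Rabs u) by nra.
  unfold trunc_abs, tail_ind. destruct (Rle_dec (Rabs u) x) as [Ha|Ha].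
  - destruct (Rlt_dec x u), (Rle_dec u (- x)); lra.
  - destruct (Rlt_dec x u), (Rle_dec u (- x)); try lra.
    exfalso. apply Ha. apply Rabs_le. lra.
Qed.

(** Zero mean allows [u / x] to be subtracted from the sine, leaving a quadratic error for
    [|u| <= x] and a linear one beyond. *)
Lemma chf_sin_part_gt1 (x : R) :
  0 < x -> integrable p a (fun u => u) -> integrable p a Rabs -> expect p a (fun u => u) = 0 ->
  Rabs (expect p a (fun u => sin (/ x * u))) <= trunc_m2 p a x / x ^ 2 + 2 * (tail_m1 p a x / x).
Proof.
  intros Hx I1 I2 H0.
  replace (expect p a (fun u => sin (/ x * u))) with (expect p a (fun u => sin (/ x * u) + - / x * u)).
  2:{ rewrite expect_plus, expect_scal, H0; auto; [ring|now apply integrable_sin|].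
      now apply (integrable_scal p a (- / x) (fun u => u)). }
  unfold trunc_m2, tail_m1, Rdiv.
  replace (expect p a (trunc_sq x) * / x ^ 2 + 2 * (expect p a (tail_abs x) * / x))
    with (/ x ^ 2 * expect p a (trunc_sq x) + 2 * / x * expect p a (tail_abs x)) by ring.
  rewrite <- !expect_scal, <- expect_plus
    by (apply integrable_scal; [apply integrable_trunc_sq || apply integrable_tail_abs]; auto).
  apply expect_abs_le; auto.
  2:{ apply integrable_plus; apply integrable_scal; [now apply integrable_trunc_sq|now apply integrable_tail_abs]. }
  intro u. assert (Hi : 0 < / x) by now apply Rinv_0_lt_compat.
  replace (sin (/ x * u) + - / x * u) with (sin (/ x * u) - / x * u) by ring.
  unfold trunc_sq, tail_abs. destruct (Rle_dec (Rabs u) x) as [Ha|Ha].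
  - eapply Rle_trans; [apply sin_minus_id|].
    + rewrite Rabs_mult, Rabs_pos_eq by lra. apply Rmult_le_reg_l with x; [assumption|].
      rewrite <- Rmult_assoc, Rinv_r; lra.
    + rewrite Rpow_mult_distr, pow_inv. lra.
  - rewrite Rmult_0_r, Rplus_0_l.
    assert (H1 := sin_le_abs (/ x * u)). rewrite (Rabs_mult (/ x)), (Rabs_pos_eq (/ x)) in H1 by lra.
    eapply Rle_trans; [apply Rabs_triang|].
    rewrite Rabs_Ropp, (Rabs_mult (/ x) u), (Rabs_pos_eq (/ x)) by lra. lra.
Qed.

Hypotheses (Halpha1 : alpha <> 1)
  (Hmean : alpha > 1 -> Zsummable (fun k => (a + IZR k) * p k) 0).

(** The exclusion of [alpha = 1] enters here: the sine part needs a first moment, truncated or in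
    the tail, of order [x * two_tail p a x], which is available below 1 and above 1 respectively. *)
Lemma chf_minus_1 :
  exists C, 0 < C /\ at_infinity (fun x => Cmod (chf p a (/ x) - 1) <= C * (trunc_m2 p a x / x ^ 2)).
Proof.
  destruct (two_tail_le_trunc_m2 p a alpha c1 c2 l) as [C1 [HC1 E1]]; auto.
  assert (Hsin : exists C, 0 < C /\
     at_infinity (fun x => Rabs (expect p a (fun u => sin (/ x * u))) <= C * (trunc_m2 p a x / x ^ 2 + two_tail p a x))).
  { destruct (Rlt_dec alpha 1) as [Ha|Ha].
    - destruct (trunc_m1_le_two_tail p a alpha c1 c2 l) as [C2 [HC2 E2]]; auto.
      exists (C2 + 1). split; [lra|].
      eapply at_infinity_imp; [|exact (at_infinity_and _ _ (at_infinity_ge 1) E2)]. cbv beta. intros x [Hx H].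
      eapply Rle_trans; [apply chf_sin_part_lt1; lra|].
      assert (HT := two_tail_nonneg p a x Hp). assert (HW := trunc_m2_nonneg p a x Hp).
      assert (trunc_m1 p a x / x <= C2 * two_tail p a x).
      { apply Rmult_le_reg_r with x; [lra|]. unfold Rdiv. rewrite Rmult_assoc, Rinv_l; lra. }
      assert (0 <= trunc_m2 p a x / x ^ 2) by (apply Rmult_le_pos; [assumption|left; apply Rinv_0_lt_compat; nra]).
      nra.
    - destruct (mean_zero p a Hp (Hmean ltac:(lra))) as (I1 & I2 & H0).
      destruct (tail_m1_le_two_tail p a alpha c1 c2 l) as [C2 [HC2 E2]]; auto; [lra|].
      exists (2 * C2 + 1). split; [lra|].
      eapply at_infinity_imp; [|exact (at_infinity_and _ _ (at_infinity_ge 1) E2)]. cbv beta. intros x [Hx H].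
      eapply Rle_trans; [apply chf_sin_part_gt1; auto; lra|].
      assert (HT := two_tail_nonneg p a x Hp). assert (HW := trunc_m2_nonneg p a x Hp).
      assert (tail_m1 p a x / x <= C2 * two_tail p a x).
      { apply Rmult_le_reg_r with x; [lra|]. unfold Rdiv. rewrite Rmult_assoc, Rinv_l; lra. }
      assert (0 <= trunc_m2 p a x / x ^ 2) by (apply Rmult_le_pos; [assumption|left; apply Rinv_0_lt_compat; nra]).
      nra. }
  destruct Hsin as [C2 [HC2 E2]].
  (* The cosine part costs the moment once and the tail twice, the sine part [C2] times each; [C1]
     converts tails into moments. *)
  exists ((1 + C2) + (2 + C2) * C1). split; [nra|].
  eapply at_infinity_imp; [|exact (at_infinity_and _ _ (at_infinity_ge 1) (at_infinity_and _ _ E1 E2))]. cbv beta.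
  intros x (Hx & H1 & H2).
  assert (H3 := chf_cos_part x ltac:(lra)).
  replace (chf p a (/ x) - 1)%C
    with (expect p a (fun u => cos (/ x * u)) - 1, expect p a (fun u => sin (/ x * u))).
  2:{ unfold chf, Cminus, Cplus, Copp. simpl. f_equal. ring. }
  eapply Rle_trans; [apply Cmod_le_abs|].
  assert (HT : two_tail p a x <= C1 * (trunc_m2 p a x / x ^ 2)).
  { apply Rmult_le_reg_l with (x ^ 2); [nra|]. eapply Rle_trans; [exact H1|].
    right. field. lra. }
  assert (0 <= trunc_m2 p a x / x ^ 2).
  { apply Rmult_le_pos; [now apply trunc_m2_nonneg|left; apply Rinv_0_lt_compat; nra]. }
  nra.
Qed.

End CharacteristicFunction.

(** * Comparison of [h] with the truncated second moment *)

Lemma trunc_second_moment_eq (p : Z -> R) (a x : R) :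
  pmf p -> trunc_second_moment p a x = trunc_m2 p a x.
Proof.
  intro Hp. assert (I := integrable_trunc_sq p a x Hp).
  assert (E : forall k, trunc_sq x (a + IZR k) * p k
              = if Rle_dec (Rabs (a + IZR k)) x then (a + IZR k) ^ 2 * p k else 0).
  { intro k. unfold trunc_sq. destruct (Rle_dec (Rabs (a + IZR k)) x); ring. }
  unfold trunc_second_moment, trunc_m2, expect. rewrite Zsum_eq by exact (abs_summable_ext _ _ E I).
  now rewrite (sumZ_ext _ _ E).
Qed.

(** The link between [h] and the law of X. Below 2 it runs from [h] through [l] and the tail to the
    moment; at 2 the tail can be of smaller order and [h] is equivalent to the moment itself. *)
Lemma h_trunc_m2_equiv (p : Z -> R) (a alpha c1 c2 : R) (l h : R -> R) :
  pmf p -> 0 < alpha <= 2 -> 0 <= c1 -> 0 <= c2 -> 0 < c1 + c2 -> slowly_varying l ->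
  lim_infty (fun x => Rpower x alpha * tail_right p a x / l x) c1 ->
  lim_infty (fun x => Rpower x alpha * tail_left p a x / l x) c2 ->
  (alpha < 2 -> lim_infty (fun x => h x / l x) 1) ->
  (alpha = 2 -> lim_infty (fun x => h x / trunc_second_moment p a x) 1) ->
  exists C, 0 < C /\ at_infinity (fun x => h x * Rpower x (- alpha) <= C * (trunc_m2 p a x / x ^ 2) /\
                               trunc_m2 p a x / x ^ 2 <= C * (h x * Rpower x (- alpha))).
Proof.
  intros Hp Ha H1 H2 H12 Hl Hr Hlf Hlt Heq.
  destruct (Rlt_dec alpha 2) as [Ha2|Ha2].
  - destruct (trunc_m2_le_two_tail p a alpha c1 c2 l) as [C1 [HC1 E1]]; auto.
    destruct (two_tail_le_trunc_m2 p a alpha c1 c2 l) as [C2 [HC2 E2]]; auto.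
    assert (E3 := two_tail_asymp p a alpha c1 c2 l Hp H12 Hl Hr Hlf (/ 2) ltac:(lra)).
    assert (E4 := at_infinity_lim _ _ (/ 2) (Hlt Ha2) ltac:(lra)).
    set (c0 := c1 + c2) in *.
    (* With relative errors 1/2: [h <= 3/2 l] and [l <= 2 / c0] times the normalized tail give
       [3 / c0]; conversely the normalized tail is at most [3/2 c0 l <= 3 c0 h]. *)
    exists (3 / c0 * C2 + 3 * C1 * c0).
    assert (HA : 0 < 3 / c0 * C2) by (apply Rmult_lt_0_compat; [apply Rdiv_lt_0_compat; lra|assumption]).
    assert (HB : 0 < 3 * C1 * c0) by (repeat apply Rmult_lt_0_compat; lra).
    split; [lra|].
    eapply at_infinity_imp; [|exact (at_infinity_and _ _ (at_infinity_ge 1) (at_infinity_and _ _ E1 (at_infinity_and _ _ E2 (at_infinity_and _ _ E3 E4))))].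
    cbv beta. intros x (Hx & B1 & B2 & (Lx & B3 & B4) & B5).
    rewrite Rpower_Ropp. assert (HP := Rpower_pos x alpha). set (P := Rpower x alpha) in *.
    assert (Hx2 : 0 < x ^ 2) by nra.
    assert (Hh : / 2 * l x <= h x <= 3 / 2 * l x).
    { replace (h x) with (h x / l x * l x) by (field; lra). split; apply Rmult_le_compat_r; lra. }
    set (w := trunc_m2 p a x / x ^ 2).
    assert (B1' : w <= C1 * two_tail p a x).
    { apply Rmult_le_reg_l with (x ^ 2); [assumption|]. unfold w.
      replace (x ^ 2 * (trunc_m2 p a x / x ^ 2)) with (trunc_m2 p a x) by (field; lra). lra. }
    assert (B2' : two_tail p a x <= C2 * w).
    { apply Rmult_le_reg_l with (x ^ 2); [assumption|]. unfold w.
      replace (x ^ 2 * (C2 * (trunc_m2 p a x / x ^ 2))) with (C2 * trunc_m2 p a x) by (field; lra). lra. }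
    assert (Hw0 : 0 <= w).
    { apply Rmult_le_pos; [now apply trunc_m2_nonneg|left; now apply Rinv_0_lt_compat]. }
    assert (HPi : 0 < / P) by now apply Rinv_0_lt_compat.
    assert (Hh0 : 0 <= h x * / P) by (apply Rmult_le_pos; lra).
    clearbody w P. set (t := two_tail p a x) in *. clearbody t.
    split.
    + apply Rle_trans with (3 / c0 * C2 * w); [|nra].
      apply Rle_trans with (3 / c0 * t).
      * apply Rmult_le_reg_r with P; [assumption|].
        rewrite Rmult_assoc, Rinv_l, Rmult_1_r by lra.
        apply Rmult_le_reg_l with c0; [assumption|].
        replace (c0 * (3 / c0 * t * P)) with (3 * (P * t)) by (field; lra). nra.
      * rewrite Rmult_assoc. apply Rmult_le_compat_l; [left; apply Rdiv_lt_0_compat; lra|assumption].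
    + apply Rle_trans with (3 * C1 * c0 * (h x * / P)); [|nra].
      eapply Rle_trans; [exact B1'|].
      replace (3 * C1 * c0 * (h x * / P)) with (C1 * (3 * c0 * (h x * / P))) by ring.
      apply Rmult_le_compat_l; [lra|].
      apply Rmult_le_reg_r with P; [assumption|].
      replace (3 * c0 * (h x * / P) * P) with (3 * c0 * h x) by (field; lra). nra.
  - assert (Ea : alpha = 2) by lra.
    assert (E1 := at_infinity_lim _ _ (/ 2) (Heq Ea) ltac:(lra)).
    assert (E2 := trunc_m2_pos p a alpha c1 c2 l Hp Ha H12 Hl Hr Hlf).
    exists 2. split; [lra|].
    eapply at_infinity_imp; [|exact (at_infinity_and _ _ (at_infinity_ge 1) (at_infinity_and _ _ E1 E2))].
    cbv beta. intros x (Hx & B1 & B2). rewrite trunc_second_moment_eq in B1 by assumption.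
    replace (Rpower x (- alpha)) with (/ x ^ 2).
    2:{ rewrite Ea, Rpower_Ropp. f_equal. replace 2 with (INR 2) by (simpl; ring).
        rewrite Rpower_pow by lra. reflexivity. }
    assert (Hi : 0 < / x ^ 2) by (apply Rinv_0_lt_compat; nra).
    assert (Hh : / 2 * trunc_m2 p a x <= h x <= 3 / 2 * trunc_m2 p a x).
    { replace (h x) with (h x / trunc_m2 p a x * trunc_m2 p a x) by (field; lra).
      split; apply Rmult_le_compat_r; lra. }
    unfold Rdiv. split; nra.
Qed.

(** The condition on [b] says that [m * trunc_m2 p a b / b ^ 2] is bounded below, as it is at b_m.
    Going down from [b] to [x] gains a factor [4 / rho] per halving, hence a power of [b / x] with
    exponent [th = log_2 (4 / rho)]. *)
Lemma trunc_m2_growth_power (p : Z -> R) (a alpha c1 c2 : R) (l : R -> R) (D : R) :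
  pmf p -> 0 < alpha <= 2 -> 0 <= c1 -> 0 <= c2 -> 0 < c1 + c2 -> slowly_varying l ->
  lim_infty (fun x => Rpower x alpha * tail_right p a x / l x) c1 ->
  lim_infty (fun x => Rpower x alpha * tail_left p a x / l x) c2 -> 0 < D ->
  exists c th, 0 < c /\ 0 < th /\
    at_infinity (fun x => forall b m, x <= b -> 0 < m -> b ^ 2 <= D * m * trunc_m2 p a b ->
                 c * Rpower (b / x) th <= m * (trunc_m2 p a x / x ^ 2)).
Proof.
  intros Hp Ha H1 H2 H12 Hl Hr Hlf HD.
  destruct (trunc_m2_growth p a alpha c1 c2 l) as (C & rho & HC & Hrho & E); auto.
  set (th := ln (4 / rho) / ln 2).
  assert (Hln2 : 0 < ln 2) by (rewrite <- ln_1; apply ln_increasing; lra).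
  assert (H4 : 1 < 4 / rho).
  { apply Rmult_lt_reg_r with rho; [lra|]. unfold Rdiv. rewrite Rmult_assoc, Rinv_l; lra. }
  assert (Hth : 0 < th).
  { apply Rdiv_lt_0_compat; [|assumption]. rewrite <- ln_1. apply ln_increasing; lra. }
  assert (H2th : Rpower 2 th = 4 / rho).
  { unfold Rpower, th. replace (ln (4 / rho) / ln 2 * ln 2) with (ln (4 / rho)) by (field; lra).
    apply exp_ln. lra. }
  (* The 4 pays for rounding [b / x] up to the next power of 2. *)
  exists (/ (4 * D * C)), th. split; [apply Rinv_0_lt_compat; repeat apply Rmult_lt_0_compat; lra|].
  split; [assumption|].
  eapply at_infinity_imp; [|exact (at_infinity_and _ _ (at_infinity_ge 1) E)]. cbv beta. clear E.
  intros x [Hx HE] b m Hb Hm Hbm.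
  set (s := b / x). assert (Es : b = s * x) by (unfold s; field; lra).
  assert (Hs : 1 <= s).
  { apply Rmult_le_reg_r with x; [lra|]. rewrite <- Es. lra. }
  destruct (dyadic_locate 1 s ltac:(lra)) as [k [Hk1 Hk2]]. rewrite Rmult_1_l in Hk1, Hk2.
  assert (HW : trunc_m2 p a b <= C * rho ^ S k * trunc_m2 p a x).
  { eapply Rle_trans; [|apply HE]. apply trunc_m2_mono; [assumption|]. rewrite Es.
    apply Rmult_le_compat_r; lra. }
  assert (Hsp : Rpower s th <= (4 / rho) ^ S k).
  { rewrite <- H2th, <- Rpower_pow by apply Rpower_pos. rewrite Rpower_mult, (Rmult_comm th), <- Rpower_mult.
    rewrite Rpower_pow by lra. apply Rle_Rpower_l; lra. }
  assert (Hkpos : 0 < 2 ^ k) by (apply pow_lt; lra).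
  assert (H4k : 4 ^ S k <= 4 * s ^ 2).
  { simpl. replace (4 ^ k) with (2 ^ k * 2 ^ k) by (rewrite <- Rpow_mult_distr; f_equal; ring). nra. }
  assert (Hr0 : 0 < rho ^ S k) by (apply pow_lt; lra).
  assert (Hx2 : 0 < x ^ 2) by nra.
  assert (Hchain : (4 / rho) ^ S k <= 4 * D * C * (m * (trunc_m2 p a x / x ^ 2))).
  { unfold Rdiv at 1. rewrite Rpow_mult_distr, pow_inv.
    apply Rmult_le_reg_r with (rho ^ S k * x ^ 2); [now apply Rmult_lt_0_compat|].
    replace (4 ^ S k * / rho ^ S k * (rho ^ S k * x ^ 2)) with (4 ^ S k * x ^ 2) by (field; lra).
    replace (4 * D * C * (m * (trunc_m2 p a x / x ^ 2)) * (rho ^ S k * x ^ 2))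
      with (4 * (D * m * (C * rho ^ S k * trunc_m2 p a x))) by (field; lra).
    apply Rle_trans with (4 * b ^ 2).
    - rewrite Es, Rpow_mult_distr, <- Rmult_assoc. apply Rmult_le_compat_r; lra.
    - apply Rmult_le_compat_l; [lra|]. eapply Rle_trans; [exact Hbm|].
      apply Rmult_le_compat_l; [|assumption]. left. now apply Rmult_lt_0_compat. }
  apply Rmult_le_reg_l with (4 * D * C); [repeat apply Rmult_lt_0_compat; lra|].
  rewrite <- Rmult_assoc, Rinv_r, Rmult_1_l by (apply Rgt_not_eq; repeat apply Rmult_lt_0_compat; lra).
  lra.
Qed.

(** * Auxiliary bounds for the inversion integral *)

(** [kernel_le] with [q = 0], brought to unit scale by [1 + s^2 <= (1 + sg^2) (1 + (s / sg)^2)]. *)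
Lemma exp_power_kernel (kap th : R) : 0 < kap -> 0 < th ->
  exists K, 0 < K /\ forall s, 0 < s -> exp (- (kap * Rpower s th)) <= K / (1 + s ^ 2).
Proof.
  intros Hk Ht. set (sg := Rpower kap (- / th)). assert (Hsg : 0 < sg) by apply Rpower_pos.
  exists (kernel_const 0 th * (1 + sg ^ 2)).
  assert (HK := kernel_const_pos 0 th).
  split; [apply Rmult_lt_0_compat; nra|]. intros s Hs.
  assert (H := kernel_le 0 th kap s ltac:(lra) Ht Hk Hs). fold sg in H.
  rewrite Rpower_O, Rmult_1_l in H by assumption.
  replace (- (0 / th)) with 0 in H by (field; lra). rewrite Rpower_O, Rmult_1_r in H by assumption.
  eapply Rle_trans; [exact H|].
  unfold Rdiv at 1. unfold Rdiv at 2. rewrite Rmult_assoc. apply Rmult_le_compat_l; [lra|].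
  assert (Hd : 0 < 1 + (s / sg) ^ 2) by nra. assert (Hd2 : 0 < 1 + s ^ 2) by nra.
  apply Rmult_le_reg_r with ((1 + (s / sg) ^ 2) * (1 + s ^ 2)); [now apply Rmult_lt_0_compat|].
  replace (/ (1 + (s / sg) ^ 2) * ((1 + (s / sg) ^ 2) * (1 + s ^ 2))) with (1 + s ^ 2)
    by (rewrite <- Rmult_assoc, Rinv_l; lra).
  replace ((1 + sg ^ 2) * / (1 + s ^ 2) * ((1 + (s / sg) ^ 2) * (1 + s ^ 2)))
    with ((1 + sg ^ 2) * (1 + (s / sg) ^ 2)).
  2:{ set (u := 1 + (s / sg) ^ 2) in *. clearbody u. field. lra. }
  replace ((1 + sg ^ 2) * (1 + (s / sg) ^ 2)) with (1 + s ^ 2 + sg ^ 2 + (s / sg) ^ 2) by (field; lra).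
  assert (0 <= sg ^ 2) by apply pow2_ge_0. assert (0 <= (s / sg) ^ 2) by apply pow2_ge_0. lra.
Qed.

(** Serves for [y = b m / x0]: b_m grows at most polynomially, so the part of the integral away from
    zero stays bounded after multiplication by b_m. *)
Lemma power_growth_exp (c th G : R) : 0 < c -> 0 < th -> 0 < G ->
  exists K, 0 < K /\ forall y m, 0 < y -> 0 < m -> Rpower y th <= G * m -> y * exp (- (m * c)) <= K.
Proof.
  intros Hc Ht HG. assert (Hti : 0 < / th) by now apply Rinv_0_lt_compat.
  exists (Rpower (G / c) (/ th) * Rpower (/ th) (/ th)).
  split; [apply Rmult_lt_0_compat; apply Rpower_pos|]. intros y m Hy Hm H.
  assert (Hu : 0 < m * c) by now apply Rmult_lt_0_compat.
  assert (Hyle : y <= Rpower (G / c) (/ th) * Rpower (m * c) (/ th)).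
  { rewrite Rpower_mult_distr by (try apply Rdiv_lt_0_compat; assumption).
    replace (G / c * (m * c)) with (G * m) by (field; lra).
    replace y with (Rpower (Rpower y th) (/ th)) at 1.
    2:{ rewrite Rpower_mult, Rinv_r, Rpower_1; lra. }
    apply Rle_Rpower_l; [lra|]. split; [apply Rpower_pos|assumption]. }
  apply Rle_trans with (Rpower (G / c) (/ th) * Rpower (m * c) (/ th) * exp (- (m * c))).
  - apply Rmult_le_compat_r; [left; apply exp_pos|assumption].
  - rewrite Rmult_assoc. apply Rmult_le_compat_l; [left; apply Rpower_pos|].
    now apply Rpower_exp_le.
Qed.

Lemma RInt_split_bound (F g : R -> R) (eps B : R) :
  (forall x, continuous F x) -> (forall x, continuous g x) -> 0 < eps <= PI -> 0 <= B ->
  (forall t, 0 < t < eps -> Rabs (F t) <= g t) ->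
  (forall t, eps <= t <= PI -> Rabs (F t) <= B) ->
  Rabs (RInt F 0 PI) <= RInt g 0 eps + PI * B.
Proof.
  intros HF Hg He HB H1 H2.
  rewrite <- (RInt_Chasles (V := R_CompleteNormedModule) F 0 eps PI) by now apply ex_RInt_cont.
  change plus with Rplus. eapply Rle_trans; [apply Rabs_triang|]. apply Rplus_le_compat.
  - eapply Rle_trans; [apply abs_RInt_le; [lra|now apply ex_RInt_cont]|].
    apply RInt_le; [lra| |now apply ex_RInt_cont|assumption].
    apply ex_RInt_cont. intro x. apply (continuous_comp F Rabs); [apply HF|].
    apply continuous_Rabs.
  - eapply Rle_trans; [apply abs_RInt_le_const with (M := B); [lra|now apply ex_RInt_cont|assumption]|].
    apply Rmult_le_compat_r; lra.
Qed.

Lemma finite_upper_bound (b : nat -> R) (N : nat) :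
  exists B, 0 < B /\ forall m, (m <= N)%nat -> b m <= B.
Proof.
  induction N as [|N [B [HB IH]]].
  - exists (Rmax 1 (b O)). split; [eapply Rlt_le_trans; [|apply Rmax_l]; lra|].
    intros m Hm. replace m with O by lia. apply Rmax_r.
  - exists (Rmax B (b (S N))). split; [eapply Rlt_le_trans; [exact HB|apply Rmax_l]|].
    intros m Hm. destruct (Nat.eq_dec m (S N)) as [->|Hne]; [apply Rmax_r|].
    eapply Rle_trans; [apply IH; lia|apply Rmax_l].
Qed.

Lemma convpow_abs_le_1 (p : Z -> R) (n : nat) (j : Z) : pmf p -> Rabs (convpow p n j) <= 1.
Proof.
  intro Hp. assert (HPI := PI_RGT_0). rewrite (convpow_inversion p 0 n j Hp).
  rewrite Rabs_mult, Rabs_pos_eq by (left; now apply Rinv_0_lt_compat).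
  apply Rmult_le_reg_l with PI; [assumption|]. rewrite <- Rmult_assoc, Rinv_r, Rmult_1_l by lra.
  eapply Rle_trans.
  - apply abs_RInt_le_const with (M := 1); [lra| |intros; now apply re_inv_integrand_le_1].
    apply ex_RInt_cont. intro x. exact (proj1 (Ccont_inv_integrand p 0 n j Hp x)).
  - lra.
Qed.

Lemma exp_pow (u : R) (m : nat) : exp (- u) ^ m = exp (- (INR m * u)).
Proof.
  induction m as [|m IH]; [simpl; rewrite <- exp_0; f_equal; ring|].
  rewrite <- tech_pow_Rmult, IH, <- exp_plus, S_INR. f_equal. ring.
Qed.

(** * Uniform bound on local probabilities *)

Lemma at_infinity_pos (P : R -> Prop) : at_infinity P -> exists A, 1 <= A /\ forall x, A <= x -> P x.
Proof.
  intros [A HA]. exists (Rmax A 1). split; [apply Rmax_r|].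
  intros x Hx. apply HA. eapply Rle_trans; [apply Rmax_l|exact Hx].
Qed.

(* [b] need not tend to infinity: [h] is unconstrained below [a0], so the equation
   for [b n] may have small spurious solutions; these make the claim trivial. *)
Lemma local_bound (p : Z -> R) (a alpha c1 c2 : R) (l h : R -> R) (b : nat -> R) :
  pmf p -> max_span_one p -> 0 < alpha <= 2 ->
  0 <= c1 -> 0 <= c2 -> 0 < c1 + c2 -> slowly_varying l ->
  lim_infty (fun x => Rpower x alpha * tail_right p a x / l x) c1 ->
  lim_infty (fun x => Rpower x alpha * tail_left p a x / l x) c2 ->
  (alpha < 2 -> lim_infty (fun x => h x / l x) 1) ->
  (alpha = 2 -> lim_infty (fun x => h x / trunc_second_moment p a x) 1) ->
  (exists delta A, delta > 0 /\ forall x, x > A -> h x > delta) ->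
  (forall n, (1 <= n)%nat -> b n > 0) ->
  (exists N, forall n, (N <= n)%nat ->
      b n / Rpower (INR n) (1 / alpha) = Rpower (h (b n)) (1 / alpha)) ->
  exists C, 0 < C /\ forall m j, (1 <= m)%nat -> b m * Rabs (convpow p m j) <= C.
Proof.
  intros Hp Hspan Ha H1 H2 H12 Hl Hr Hlf Hlt Heq (delta & Ah & Hdel & Hh) Hb [N HN].
  assert (HPI := PI_RGT_0). assert (HPI2 := PI2_1).
  destruct (h_trunc_m2_equiv p a alpha c1 c2 l h) as [D [HD ED]]; auto.
  destruct (trunc_m2_growth_power p a alpha c1 c2 l D) as (cg & th & Hcg & Hth & EG); auto.
  destruct (chf_upper p a alpha c1 c2 l) as [cu [Hcu EU]]; auto.
  assert (EW := trunc_m2_pos p a alpha c1 c2 l Hp Ha H12 Hl Hr Hlf).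
  destruct (at_infinity_pos _ (at_infinity_and _ _ (at_infinity_ge (Ah + 1)) (at_infinity_and _ _ ED (at_infinity_and _ _ EG (at_infinity_and _ _ EU EW)))))
    as (x0 & Hx0 & HE). clear ED EG EU EW.
  destruct (HE x0 (Rle_refl _)) as (_ & _ & HG0 & _ & HW0).
  set (G := trunc_m2 p a x0 / x0 ^ 2). assert (HG : 0 < G) by (apply Rdiv_lt_0_compat; nra).
  assert (Hix0 : 0 < / x0 <= 1).
  { split; [apply Rinv_0_lt_compat; lra|]. rewrite <- Rinv_1. apply Rinv_le_contravar; lra. }
  destruct (chf_away p a (/ x0) Hp Hspan) as [ca [Hca Haway]]; [lra|].
  destruct (exp_power_kernel (cu * cg) th) as [K [HK HKs]]; [nra|assumption|].
  destruct (power_growth_exp ca th (G / cg)) as [K2 [HK2 HK2s]]; auto; [now apply Rdiv_lt_0_compat|].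
  destruct (finite_upper_bound b N) as [B [HB HBN]].
  (* [K] serves for [t * b m >= 1]; the 2 serves below, where the integrand is at most 1 and
     [1 + s ^ 2 <= 2]. *)
  set (K' := K + 2).
  exists (B + x0 + 2 * K' + x0 * K2). split; [unfold K'; nra|].
  assert (HK2x : 0 < x0 * K2) by (apply Rmult_lt_0_compat; lra).
  intros m j Hm. assert (Hbm := Hb m Hm).
  destruct (Rle_dec (b m) (B + x0)) as [Hsmall|Hlarge].
  { assert (H := convpow_abs_le_1 p m j Hp). assert (H0 := Rabs_pos (convpow p m j)).
    unfold K'. nra. }
  (* Indices up to [N] have [b m <= B], so the case of large [b m] lies where the equation for it
     holds. *)
  assert (HmN : (N <= m)%nat).
  { destruct (le_lt_dec N m); [assumption|]. exfalso. apply Hlarge.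
    specialize (HBN m ltac:(lia)). lra. }
  assert (HmR : 0 < INR m) by (apply lt_0_INR; lia).
  assert (Hbx0 : x0 <= b m) by lra.
  destruct (HE (b m) Hbx0) as (Hbh & (HbD & _) & _ & _ & _).
  assert (Hhb : 0 < h (b m)) by (specialize (Hh (b m) ltac:(lra)); lra).
  (* The equation for [b m] raised to the power [alpha]; through [HbD] it becomes the hypothesis on
     [b] in [trunc_m2_growth_power]. *)
  assert (Hbpow : INR m * (h (b m) * Rpower (b m) (- alpha)) = 1).
  { specialize (HN m HmN).
    assert (E : b m = Rpower (INR m * h (b m)) (1 / alpha)).
    { rewrite <- Rpower_mult_distr, <- HN by assumption. field.
      apply Rgt_not_eq, Rpower_pos. }
    assert (E2 : Rpower (b m) alpha = INR m * h (b m)).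
    { rewrite E at 1. rewrite Rpower_mult. replace (1 / alpha * alpha) with 1 by (field; lra).
      apply Rpower_1. now apply Rmult_lt_0_compat. }
    rewrite Rpower_Ropp, E2. field. lra. }
  assert (Hbsq : b m ^ 2 <= D * INR m * trunc_m2 p a (b m)).
  { assert (Hb2 : 0 < b m ^ 2) by nra.
    assert (H : INR m * (h (b m) * Rpower (b m) (- alpha)) <= INR m * (D * (trunc_m2 p a (b m) / b m ^ 2)))
      by (apply Rmult_le_compat_l; lra).
    rewrite Hbpow in H. apply Rmult_le_compat_r with (r := b m ^ 2) in H; [|lra].
    replace (INR m * (D * (trunc_m2 p a (b m) / b m ^ 2)) * b m ^ 2)
      with (D * INR m * trunc_m2 p a (b m)) in H by (field; lra). lra. }
  set (F := fun t => fst (inv_integrand p a m j t)).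
  assert (HFc : forall t, continuous F t) by (intro t; exact (proj1 (Ccont_inv_integrand p a m j Hp t))).
  assert (HFle : forall t, Rabs (F t) <= Cmod (chf p a t) ^ m).
  { intro t. rewrite <- (Cmod_inv_integrand p a m j). apply (re_le_Cmod (inv_integrand p a m j t)). }
  assert (Hnear : forall t, 0 < t < / x0 -> Rabs (F t) <= K' / (1 + (t / / b m) ^ 2)).
  { intros t Ht.
    assert (Hxt : x0 <= / t).
    { rewrite <- (Rinv_inv x0). apply Rinv_le_contravar; lra. }
    destruct (HE (/ t) Hxt) as (_ & _ & HGt & HUt & _). rewrite Rinv_inv in HUt.
    replace (t / / b m) with (t * b m) by (field; lra).
    set (s := t * b m). assert (Hs : 0 < s) by (apply Rmult_lt_0_compat; lra).
    assert (Hden : 0 < 1 + s ^ 2) by nra.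
    destruct (Rle_dec (/ t) (b m)) as [Hbt|Hbt].
    - eapply Rle_trans; [apply HFle|].
      apply Rle_trans with (K / (1 + s ^ 2)).
      2:{ apply Rmult_le_compat_r; [left; now apply Rinv_0_lt_compat|unfold K'; lra]. }
      eapply Rle_trans; [|now apply HKs].
      eapply Rle_trans; [apply pow_incr; split; [apply Cmod_ge_0|exact HUt]|].
      rewrite exp_pow. apply exp_mono. apply Ropp_le_contravar.
      specialize (HGt (b m) (INR m) Hbt HmR Hbsq).
      replace (b m / / t) with s in HGt by (unfold s; field; lra).
      rewrite Rmult_assoc.
      replace (INR m * (cu * (trunc_m2 p a (/ t) / (/ t) ^ 2)))
        with (cu * (INR m * (trunc_m2 p a (/ t) / (/ t) ^ 2))) by ring.
      apply Rmult_le_compat_l; lra.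
    - assert (Hs1 : s <= 1).
      { apply Rmult_le_reg_l with (/ t); [apply Rinv_0_lt_compat; lra|]. unfold s.
        rewrite <- Rmult_assoc, Rinv_l; lra. }
      eapply Rle_trans; [now apply re_inv_integrand_le_1|].
      apply Rmult_le_reg_r with (1 + s ^ 2); [assumption|].
      unfold Rdiv. rewrite Rmult_assoc, Rinv_l by lra. unfold K'. nra. }
  assert (Hfar : forall t, / x0 <= t <= PI -> Rabs (F t) <= exp (- (INR m * ca))).
  { intros t Ht. eapply Rle_trans; [apply HFle|]. rewrite <- exp_pow.
    apply pow_incr. split; [apply Cmod_ge_0|now apply Haway]. }
  assert (HI := RInt_split_bound F (fun t => K' / (1 + (t / / b m) ^ 2)) (/ x0)
                  (exp (- (INR m * ca))) HFc (continuous_kernel K' (/ b m)) ltac:(lra)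
                  ltac:(left; apply exp_pos) Hnear Hfar).
  assert (HKI := RInt_kernel_le K' (/ b m) (/ x0) ltac:(unfold K'; lra)
                   ltac:(now apply Rinv_0_lt_compat) ltac:(lra)).
  rewrite (convpow_inversion p a m j Hp). fold F.
  rewrite Rabs_mult, Rabs_pos_eq by (left; now apply Rinv_0_lt_compat).
  (* The growth estimate at the fixed point [x0] bounds a power of [b m / x0] by a multiple of
     [m]. *)
  assert (Hexp : b m * exp (- (INR m * ca)) <= x0 * K2).
  { assert (Hy : 0 < b m / x0) by (apply Rdiv_lt_0_compat; lra).
    assert (H := HK2s (b m / x0) (INR m) Hy HmR).
    replace (b m) with (x0 * (b m / x0)) by (field; lra). rewrite Rmult_assoc.
    apply Rmult_le_compat_l; [lra|]. apply H.
    specialize (HG0 (b m) (INR m) Hbx0 HmR Hbsq). fold G in HG0.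
    apply Rmult_le_reg_l with cg; [assumption|].
    replace (cg * (G / cg * INR m)) with (INR m * G) by (field; lra). assumption. }
  assert (HPIi : 0 < / PI <= 1).
  { split; [now apply Rinv_0_lt_compat|]. rewrite <- Rinv_1. apply Rinv_le_contravar; lra. }
  set (E := exp (- (INR m * ca))) in *. set (I := RInt F 0 PI) in *.
  assert (H3 : Rabs I <= 2 * (K' * / b m) + PI * E) by lra.
  apply Rle_trans with (b m * (/ PI * (2 * (K' * / b m) + PI * E))).
  { apply Rmult_le_compat_l; [lra|]. apply Rmult_le_compat_l; lra. }
  replace (b m * (/ PI * (2 * (K' * / b m) + PI * E))) with (/ PI * (2 * K') + b m * E)
    by (field; lra).
  assert (/ PI * (2 * K') <= 2 * K').
  { rewrite <- (Rmult_1_l (2 * K')) at 2. apply Rmult_le_compat_r; [unfold K'; lra|lra]. }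
  lra.
Qed.

(** * Scaling identities and assembly of the covariance bound *)

Lemma ln_Rdiv (x y : R) : 0 < x -> 0 < y -> ln (x / y) = ln x - ln y.
Proof.
  intros Hx Hy. unfold Rdiv. rewrite ln_mult, ln_Rinv; auto using Rinv_0_lt_compat.
Qed.

Lemma Rdiv_exp (x y : R) : x / exp y = x * exp (- y).
Proof. unfold Rdiv. now rewrite exp_Ropp. Qed.

(** All factors are real powers, so the identity is linear in logarithms. It turns the kernel
    integral with [q = eta] into the last term of the theorem. *)
Lemma scaling_eta (al eta c n m bm : R) :
  0 < al -> 0 < c -> 0 < m -> m < n -> 0 < bm ->
  Rpower n (1 / al) * (Rpower bm eta * Rpower (c * (n - m)) (- (eta / al))
                       * Rpower (c * (n - m)) (- / al))
  = Rpower c (- ((eta + 1) / al)) *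
    (Rpower (m / n) (eta / al) * Rpower (bm / Rpower m (1 / al)) eta
     / Rpower (1 - m / n) ((eta + 1) / al)).
Proof.
  intros Hal Hc Hm Hn Hb.
  replace (1 - m / n) with ((n - m) / n) by (field; lra).
  unfold Rpower at 1 2 3 4 5 6 7 9.
  rewrite (ln_Rdiv bm) by (assumption || apply Rpower_pos).
  unfold Rpower. rewrite ln_exp, !ln_Rdiv, !ln_mult by lra.
  rewrite Rdiv_exp, <- !exp_plus. f_equal. field. lra.
Qed.

(** The counterpart for [q = al], yielding the middle term; the exponent [al / al] is left in the
    form in which [kernel_le] produces it. *)
Lemma scaling_alpha (al c n m : R) :
  0 < al -> 0 < c -> 0 < m -> m < n ->
  Rpower n (1 / al) * (m * Rpower (c * (n - m)) (- (al / al)) * Rpower (c * (n - m)) (- / al))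
  = Rpower c (- (1 + 1 / al)) * (m / n / Rpower (1 - m / n) (1 + 1 / al)).
Proof.
  intros Hal Hc Hm Hn.
  replace (1 - m / n) with ((n - m) / n) by (field; lra).
  replace (m / n) with (Rpower (m / n) 1) by (apply Rpower_1, Rdiv_lt_0_compat; lra).
  rewrite <- (exp_ln m Hm) at 1.
  unfold Rpower. rewrite !ln_Rdiv, !ln_mult by lra.
  rewrite Rdiv_exp, <- !exp_plus. f_equal. field. lra.
Qed.

(** This identity dictates the cut-off [n ^ (- (1 + 1 / al))]. *)
Lemma scaling_one (al n m : R) :
  0 < al -> 0 < n -> Rpower n (1 / al) * (m * Rpower n (- (1 + 1 / al))) = m / n.
Proof.
  intros Hal Hn.
  replace (- (1 + 1 / al)) with (- (1) + - (1 / al)) by ring.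
  rewrite Rpower_plus, !Rpower_Ropp, Rpower_1 by assumption. field.
  split; [lra|apply Rgt_not_eq, Rpower_pos].
Qed.

(** Continuity at [a0] is one-sided; the strict inequality [a0 < A] leaves room for two-sided
    continuity on all of [[A, x]]. *)
Lemma bound_from_continuous (h : R -> R) (a0 A x : R) :
  continuous_on_from h a0 -> a0 < A -> A <= x -> bound (range_on h A x).
Proof.
  intros Hc HA Hx. destruct (continuity_ab_maj h A x Hx) as [M [HM _]].
  - intros y Hy e He. destruct (Hc y ltac:(lra) e He) as [d [Hd H]].
    exists (Rmin d (A - a0)). split; [apply Rmin_glb_lt; lra|].
    intros z [_ Hz]. change (Rabs (z - y) < Rmin d (A - a0)) in Hz.
    apply H.
    + assert (Rabs (z - y) < A - a0) by (eapply Rlt_le_trans; [exact Hz|apply Rmin_r]).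
      apply Rabs_def2 in H0. lra.
    + eapply Rlt_le_trans; [exact Hz|apply Rmin_l].
  - exists (h M). intros v [y [Hy ->]]. now apply HM.
Qed.

Lemma RInt_three_kernels (A1 A2 A3 s1 s2 s3 e : R) :
  0 <= A1 -> 0 <= A2 -> 0 <= A3 -> 0 < s1 -> 0 < s2 -> 0 < s3 -> 0 <= e ->
  RInt (fun t => A1 / (1 + (t / s1) ^ 2) + (A2 / (1 + (t / s2) ^ 2) + A3 / (1 + (t / s3) ^ 2))) 0 e
  <= 2 * (A1 * s1 + A2 * s2 + A3 * s3).
Proof.
  intros. set (k := fun A s t : R => A / (1 + (t / s) ^ 2)).
  assert (Hk : forall A s x, continuous (k A s) x) by (intros; apply continuous_kernel).
  assert (E : RInt (fun t => k A1 s1 t + (k A2 s2 t + k A3 s3 t)) 0 e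
              = RInt (k A1 s1) 0 e + (RInt (k A2 s2) 0 e + RInt (k A3 s3) 0 e)).
  { rewrite (RInt_plus (V := R_CompleteNormedModule) (k A1 s1)).
    - change plus with Rplus. f_equal.
      apply (RInt_plus (V := R_CompleteNormedModule) (k A2 s2)); now apply ex_RInt_cont.
    - now apply ex_RInt_cont.
    - apply ex_RInt_cont. intro x. now apply (continuous_plus (k A2 s2)). }
  unfold k in E. rewrite E.
  assert (B1 := RInt_kernel_le A1 s1 e). assert (B2 := RInt_kernel_le A2 s2 e).
  assert (B3 := RInt_kernel_le A3 s3 e).
  specialize (B1 ltac:(auto) ltac:(auto) ltac:(auto)).
  specialize (B2 ltac:(auto) ltac:(auto) ltac:(auto)).
  specialize (B3 ltac:(auto) ltac:(auto) ltac:(auto)). lra.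
Qed.

(** Both [cis (t * kappa_m)] and the m-th power of the characteristic function are compared with 1:
    the first difference feeds the [eta] term, the second the one with [m / n]. *)
Lemma inv_integrand_diff_le (p : Z -> R) (a t : R) (m n : nat) (jm jn : Z) :
  pmf p -> (m <= n)%nat ->
  Cmod (inv_integrand p a (n - m) (jn - jm) t - inv_integrand p a n jn t)
  <= Cmod (chf p a t) ^ (n - m) *
     (Cmod (cis (t * (INR m * a + IZR jm)) - 1) + INR m * Cmod (chf p a t - 1)).
Proof.
  intros Hp Hmn. set (f := chf p a t). set (km := INR m * a + IZR jm).
  set (kn := INR n * a + IZR jn).
  replace (inv_integrand p a (n - m) (jn - jm) t - inv_integrand p a n jn t)%C
    with (f ^ (n - m) * cis (- (t * kn)) * ((cis (t * km) - 1) + - (f ^ m - 1)))%C.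
  - rewrite !Cmod_mult, Cmod_pow, Cmod_cis, Rmult_1_r.
    apply Rmult_le_compat_l; [apply pow_le, Cmod_ge_0|].
    eapply Rle_trans; [apply Cmod_triangle|]. rewrite Cmod_opp. apply Rplus_le_compat_l.
    apply Cmod_pow_minus_1. now apply Cmod_chf_le_1.
  - unfold inv_integrand. fold f. fold kn.
    replace (- (t * (INR (n - m) * a + IZR (jn - jm)))) with (- (t * kn) + t * km).
    2:{ rewrite minus_INR, minus_IZR by assumption. unfold kn, km. ring. }
    replace (f ^ n)%C with (f ^ (n - m) * f ^ m)%C.
    2:{ rewrite <- Cpow_add_r. f_equal. lia. }
    rewrite cis_plus. ring.
Qed.

(** The lower bound [delta] on [h] removes it from the decay exponent, so a single kernel in
    [t ^ alpha] fits all [n - m]; in the estimate of the distance to 1, [h] is kept. *)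
Lemma chf_near_zero (p : Z -> R) (a alpha c1 c2 : R) (l h : R -> R) :
  pmf p -> 0 < alpha <= 2 -> alpha <> 1 ->
  0 <= c1 -> 0 <= c2 -> 0 < c1 + c2 -> slowly_varying l ->
  lim_infty (fun x => Rpower x alpha * tail_right p a x / l x) c1 ->
  lim_infty (fun x => Rpower x alpha * tail_left p a x / l x) c2 ->
  (alpha > 1 -> Zsummable (fun k => (a + IZR k) * p k) 0) ->
  (alpha < 2 -> lim_infty (fun x => h x / l x) 1) ->
  (alpha = 2 -> lim_infty (fun x => h x / trunc_second_moment p a x) 1) ->
  (exists delta A, delta > 0 /\ forall x, x > A -> h x > delta) ->
  exists c C, 0 < c /\ 0 < C /\
    at_infinity (fun x => 0 < h x /\
      Cmod (chf p a (/ x)) <= exp (- (c * Rpower (/ x) alpha)) /\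
      Cmod (chf p a (/ x) - 1) <= C * (h x * Rpower (/ x) alpha)).
Proof.
  intros Hp Ha Ha1 H1 H2 H12 Hl Hr Hlf Hm Hlt Heq (delta & Ah & Hdel & Hh).
  destruct (h_trunc_m2_equiv p a alpha c1 c2 l h) as [D [HD ED]]; auto.
  destruct (chf_upper p a alpha c1 c2 l) as [cu [Hcu EU]]; auto.
  destruct (chf_minus_1 p a alpha c1 c2 l) as [C1 [HC1 E1]]; auto.
  exists (cu * (delta / D)), (C1 * D).
  split; [apply Rmult_lt_0_compat; [assumption|apply Rdiv_lt_0_compat; assumption]|].
  split; [now apply Rmult_lt_0_compat|].
  eapply at_infinity_imp; [|exact (at_infinity_and _ _ (at_infinity_ge (Rmax 1 (Ah + 1))) (at_infinity_and _ _ ED (at_infinity_and _ _ EU E1)))].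
  cbv beta. intros x (Hx & (B1 & B2) & B3 & B4).
  assert (Hx1 : 1 <= x) by (eapply Rle_trans; [apply Rmax_l|exact Hx]).
  assert (Hx2 : Ah + 1 <= x) by (eapply Rle_trans; [apply Rmax_r|exact Hx]).
  assert (Hhx := Hh x ltac:(lra)).
  replace (Rpower (/ x) alpha) with (Rpower x (- alpha)).
  2:{ unfold Rpower. rewrite ln_Rinv by lra. f_equal. ring. }
  assert (HP := Rpower_pos x (- alpha)).
  split; [lra|]. split.
  - eapply Rle_trans; [exact B3|]. apply exp_mono, Ropp_le_contravar.
    rewrite Rmult_assoc. apply Rmult_le_compat_l; [lra|].
    apply Rmult_le_reg_l with D; [assumption|]. eapply Rle_trans; [|exact B1].
    replace (D * (delta / D * Rpower x (- alpha))) with (delta * Rpower x (- alpha)) by (field; lra).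
    apply Rmult_le_compat_r; lra.
  - eapply Rle_trans; [exact B4|]. rewrite Rmult_assoc. apply Rmult_le_compat_l; lra.
Qed.

Theorem theorem3p1
  (p : Z -> R) (a alpha c1 c2 : R) (l h : R -> R) (a0 : R)
  (b : nat -> R) (j : nat -> Z) (kappa : R)
  (* X_1 = a + K with K of pmf p on Z; maximal span 1 *)
  (Hp_nonneg : forall k, 0 <= p k)
  (Hp_sum : Zsummable p 1)
  (Hspan : max_span_one p)
  (* tails *)
  (Halpha : 0 < alpha <= 2) (Halpha1 : alpha <> 1)
  (Hc1 : 0 <= c1) (Hc2 : 0 <= c2) (Hc12 : 0 < c1 + c2)
  (Hl : slowly_varying l)
  (Htail_r : lim_infty (fun x => Rpower x alpha * tail_right p a x / l x) c1)
  (Htail_l : lim_infty (fun x => Rpower x alpha * tail_left p a x / l x) c2)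
  (Hmean : alpha > 1 -> Zsummable (fun k => (a + IZR k) * p k) 0)
  (* the slowly varying function h *)
  (Ha0 : 0 < a0)
  (Hh_cont : continuous_on_from h a0)
  (Hh_lt2 : alpha < 2 -> lim_infty (fun x => h x / l x) 1)
  (Hh_eq2 : alpha = 2 -> lim_infty (fun x => h x / trunc_second_moment p a x) 1)
  (* normalizing sequence b_n = L(n) n^(1/alpha), L(n) = h(b_n)^(1/alpha) *)
  (Hb_pos : forall n, (1 <= n)%nat -> b n > 0)
  (Hb_eq : exists N, forall n, (N <= n)%nat ->
      b n / Rpower (INR n) (1 / alpha) = Rpower (h (b n)) (1 / alpha))
  (* lattice points kappa_n = n a + j_n with kappa_n / b_n -> kappa *)
  (Hkappa : Un_cv (fun n => (INR n * a + IZR (j n)) / b n) kappa)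
  (* additional hypothesis: liminf h > 0 *)
  (Hliminf : exists delta A, delta > 0 /\ forall x, x > A -> h x > delta) :
  let L := fun n : nat => b n / Rpower (INR n) (1 / alpha) in
  exists eps c : R, eps > 0 /\ c > 0 /\
    (forall x, x >= 1 / eps -> bound (range_on h (1 / eps) x)) /\
    forall eta, 0 < eta <= 1 ->
      exists C : R,
        forall (m n : nat) (Mv : R),
          (1 <= m)%nat ->
          INR n > INR m + Rpower eps (- (alpha / (alpha + 1))) ->
          is_lub (range_on h (1 / eps) (Rpower (INR n) (1 + 1 / alpha))) Mv ->
          let r := INR m / INR n in
          b m * b n *
            Rabs (convpow p m (j m) * convpow p (n - m) (j n - j m)%Z
                  - convpow p m (j m) * convpow p n (j n))
          <= C * L n *
             ( Rpower (INR n) (1 / alpha) * (exp (- (INR (n - m) * c)) + exp (- (INR n * c)))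
             + r / Rpower (1 - r) (1 + 1 / alpha) * (1 + Mv)
             + Rpower r (eta / alpha) * Rpower (L m) eta
                 / Rpower (1 - r) ((eta + 1) / alpha) ).
Proof.
  intro L.
  assert (Hp : pmf p) by (destruct (Zsummable_abs_summable p 1 Hp_nonneg Hp_sum); now split).
  assert (HPI := PI_RGT_0). assert (HPI2 := PI2_1).
  destruct (local_bound p a alpha c1 c2 l h b) as [C0 [HC0 Hloc]]; auto.
  destruct (chf_near_zero p a alpha c1 c2 l h) as (c0 & C1 & Hc0 & HC1 & EN); auto.
  (* The convergent sequence is bounded: [|kappa_n| <= Kk * b n], with [Kk] positive so that it can
     be the base of a real power. *)
  destruct (maj_by_pos _ (exist _ kappa Hkappa)) as [Kk [HKk Hkb]].
  (* Starting at [a0 + 1] secures the strict inequality asked by [bound_from_continuous]. *)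
  destruct (at_infinity_pos _ (at_infinity_and _ _ (at_infinity_ge (a0 + 1)) EN)) as (A & HA1 & HA). clear EN.
  assert (HAa0 := proj1 (HA A (Rle_refl A))).
  assert (HiA : 0 < / A <= 1).
  { split; [apply Rinv_0_lt_compat; lra|]. rewrite <- Rinv_1. apply Rinv_le_contravar; lra. }
  destruct (chf_away p a (/ A) Hp Hspan) as [ca [Hca Haway]]; [lra|].
  exists (/ A), ca. split; [lra|]. split; [lra|].
  replace (1 / / A) with A by (field; lra).
  split. { intros x Hx. apply bound_from_continuous with a0; auto; lra. }
  intros eta Heta.
  set (KE := kernel_const eta alpha). set (KA := kernel_const alpha alpha).
  assert (HKE : 0 < KE) by apply kernel_const_pos. assert (HKA : 0 < KA) by apply kernel_const_pos.
  (* The factors left over by [scaling_eta] and [scaling_alpha]. Each contains a 2 from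
     [RInt_kernel_le]; the other 2 in [QE] is that of the Hoelder bound. *)
  set (QE := 4 * KE * Rpower Kk eta * Rpower c0 (- ((eta + 1) / alpha))).
  set (QA := 2 * C1 * KA * Rpower c0 (- (1 + 1 / alpha))).
  assert (HQE : 0 < QE) by (unfold QE; repeat apply Rmult_lt_0_compat; try apply Rpower_pos; lra).
  assert (HQA : 0 < QA) by (unfold QA; repeat apply Rmult_lt_0_compat; try apply Rpower_pos; lra).
  (* [C0] bounds the factor [b m * P(S_m = kappa_m)]; 8 belongs to the range [t < t0] and 1 to the
     exponential terms. *)
  exists (C0 * (QE + QA + 8 + 1)).
  intros m n Mv Hm Hn HMv r.
  assert (Heps := Rpower_pos (/ A) (- (alpha / (alpha + 1)))).
  assert (Hmn : (m < n)%nat) by (apply INR_lt; lra).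
  assert (HmR : 0 < INR m) by (apply lt_0_INR; lia).
  assert (HnmR : INR m < INR n) by lra.
  assert (Hbm := Hb_pos m Hm). assert (Hbn := Hb_pos n ltac:(lia)).
  assert (HkR : INR (n - m) = INR n - INR m) by (apply minus_INR; lia).
  set (N := Rpower (INR n) (1 / alpha)). assert (HN : 0 < N) by apply Rpower_pos.
  set (t0 := Rpower (INR n) (- (1 + 1 / alpha))). assert (Ht0 : 0 < t0) by apply Rpower_pos.
  set (kap := c0 * (INR n - INR m)). assert (Hkap : 0 < kap) by (apply Rmult_lt_0_compat; lra).
  set (sg := Rpower kap (- / alpha)). assert (Hsg : 0 < sg) by apply Rpower_pos.
  assert (HMle : forall x, A <= x <= / t0 -> h x <= Mv).
  { intros x Hx. apply HMv. exists x. split; [|reflexivity]. split; [lra|].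
    rewrite <- (Rinv_inv (Rpower (INR n) (1 + 1 / alpha))), <- Rpower_Ropp. apply Hx. }
  (* Raising the lower bound on [n] to the power [1 + 1 / alpha] gives exactly [A]. Hence [A] lies
     in the range of the supremum and [Mv >= h A > 0]. *)
  assert (HAt0 : A <= / t0).
  { unfold t0. rewrite Rpower_Ropp, Rinv_inv.
    replace A with (Rpower (Rpower (/ A) (- (alpha / (alpha + 1)))) (1 + 1 / alpha)) at 1.
    - apply Rle_Rpower_l; [|split; lra].
      assert (0 < 1 / alpha) by (apply Rdiv_lt_0_compat; lra). lra.
    - rewrite Rpower_mult. unfold Rpower. rewrite ln_Rinv by lra.
      replace (- (alpha / (alpha + 1)) * (1 + 1 / alpha) * - ln A) with (ln A) by (field; lra).
      apply exp_ln. lra. }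
  assert (HMv0 : 0 <= Mv).
  { assert (H := HMle A ltac:(lra)). destruct (HA A (Rle_refl A)) as (_ & H' & _). lra. }
  set (D := fun t => fst (inv_integrand p a (n - m) (j n - j m) t - inv_integrand p a n (j n) t)%C).
  set (G1 := 2 * Rpower (Kk * b m) eta * (KE * Rpower kap (- (eta / alpha)))).
  set (G2 := INR m * (C1 * Mv) * (KA * Rpower kap (- (alpha / alpha)))).
  assert (HG1 : 0 <= G1).
  { unfold G1. left. repeat apply Rmult_lt_0_compat; try apply Rpower_pos; lra. }
  assert (HG2 : 0 <= G2).
  { unfold G2. assert (0 <= C1 * Mv) by (apply Rmult_le_pos; lra).
    assert (0 < KA * Rpower kap (- (alpha / alpha))) by (apply Rmult_lt_0_compat; [lra|apply Rpower_pos]).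
    apply Rmult_le_pos; [apply Rmult_le_pos|]; lra. }
  assert (Hcm : Rabs (INR m * a + IZR (j m)) <= Kk * b m).
  { specialize (Hkb m). unfold Rdiv in Hkb.
    rewrite Rabs_mult, (Rabs_pos_eq (/ b m)) in Hkb by (left; now apply Rinv_0_lt_compat).
    apply Rmult_le_compat_r with (r := b m) in Hkb; [|lra].
    rewrite Rmult_assoc, Rinv_l, Rmult_1_r in Hkb by lra. assumption. }
  assert (Hnear : forall t, 0 < t < / A ->
     Rabs (D t) <= G1 / (1 + (t / sg) ^ 2)
                   + (G2 / (1 + (t / sg) ^ 2) + 4 * INR m / (1 + (t / t0) ^ 2))).
  { intros t Ht. eapply Rle_trans; [apply (re_le_Cmod (_ - _)%C)|].
    eapply Rle_trans; [apply inv_integrand_diff_le; auto; lia|].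
    assert (HAt : A <= / t) by (rewrite <- (Rinv_inv A); apply Rinv_le_contravar; lra).
    destruct (HA (/ t) HAt) as (_ & Hht & B1 & B2). rewrite Rinv_inv in B1, B2.
    set (f := chf p a t) in *. set (X := Cmod (cis (t * (INR m * a + IZR (j m))) - 1)).
    set (Y := INR m * Cmod (f - 1)).
    set (E := exp (- (kap * Rpower t alpha))). assert (HE : 0 < E) by apply exp_pos.
    assert (Hfk : 0 <= Cmod f ^ (n - m) <= E).
    { split; [apply pow_le, Cmod_ge_0|].
      eapply Rle_trans; [apply pow_incr; split; [apply Cmod_ge_0|exact B1]|].
      rewrite exp_pow, HkR. right. unfold E, kap. f_equal. ring. }
    assert (Hfk1 : Cmod f ^ (n - m) <= 1).
    { rewrite <- (pow1 (n - m)). apply pow_incr. split; [apply Cmod_ge_0|now apply Cmod_chf_le_1]. }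
    assert (HX0 : 0 <= X) by apply Cmod_ge_0.
    assert (HY0 : 0 <= Y) by (apply Rmult_le_pos; [lra|apply Cmod_ge_0]).
    assert (HXE : Cmod f ^ (n - m) * X <= G1 / (1 + (t / sg) ^ 2)).
    { assert (HX : X <= 2 * Rpower (t * (Kk * b m)) eta).
      { apply Cmod_cis_minus_1_holder; auto.
        - rewrite Rabs_mult, (Rabs_pos_eq t) by lra. apply Rmult_le_compat_l; lra.
        - repeat apply Rmult_lt_0_compat; lra. }
      rewrite <- Rpower_mult_distr in HX by (try apply Rmult_lt_0_compat; lra).
      assert (HK := kernel_le eta alpha kap t ltac:(lra) ltac:(lra) Hkap ltac:(lra)).
      fold KE sg E in HK.
      apply Rle_trans with (E * (2 * (Rpower t eta * Rpower (Kk * b m) eta))).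
      - apply Rmult_le_compat; lra.
      - replace (E * (2 * (Rpower t eta * Rpower (Kk * b m) eta)))
          with (2 * Rpower (Kk * b m) eta * (Rpower t eta * E)) by ring.
        unfold G1. unfold Rdiv in *. rewrite Rmult_assoc with (r3 := / (1 + (t * / sg) ^ 2)).
        apply Rmult_le_compat_l; [generalize (Rpower_pos (Kk * b m) eta); lra|assumption]. }
    assert (Hd1 : 0 <= G2 / (1 + (t / sg) ^ 2)).
    { apply Rmult_le_pos; [assumption|]. left. apply Rinv_0_lt_compat.
      generalize (pow2_ge_0 (t / sg)). lra. }
    assert (Hd2 : 0 <= 4 * INR m / (1 + (t / t0) ^ 2)).
    { apply Rmult_le_pos; [lra|]. left. apply Rinv_0_lt_compat.
      generalize (pow2_ge_0 (t / t0)). lra. }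
    rewrite Rmult_plus_distr_l. apply Rplus_le_compat; [assumption|].
    destruct (Rle_dec t0 t) as [Htt|Htt].
    - apply Rle_trans with (G2 / (1 + (t / sg) ^ 2)); [|lra].
      assert (HhM : h (/ t) <= Mv) by (apply HMle; split; [lra|apply Rinv_le_contravar; lra]).
      assert (HY : Y <= INR m * (C1 * Mv) * Rpower t alpha).
      { unfold Y. rewrite Rmult_assoc. apply Rmult_le_compat_l; [lra|].
        eapply Rle_trans; [exact B2|]. rewrite Rmult_assoc. apply Rmult_le_compat_l; [lra|].
        apply Rmult_le_compat_r; [left; apply Rpower_pos|assumption]. }
      assert (HK := kernel_le alpha alpha kap t ltac:(lra) ltac:(lra) Hkap ltac:(lra)).
      fold KA sg E in HK.
      apply Rle_trans with (E * (INR m * (C1 * Mv) * Rpower t alpha)).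
      + apply Rmult_le_compat; lra.
      + replace (E * (INR m * (C1 * Mv) * Rpower t alpha))
          with (INR m * (C1 * Mv) * (Rpower t alpha * E)) by ring.
        unfold G2. unfold Rdiv in *. rewrite Rmult_assoc with (r3 := / (1 + (t * / sg) ^ 2)).
        apply Rmult_le_compat_l; [|assumption].
        apply Rmult_le_pos; [lra|apply Rmult_le_pos; lra].
    - apply Rle_trans with (4 * INR m / (1 + (t / t0) ^ 2)); [|lra].
      assert (HY : Y <= INR m * 2).
      { apply Rmult_le_compat_l; [lra|]. unfold Cminus.
        eapply Rle_trans; [apply Cmod_triangle|]. rewrite Cmod_opp, Cmod_1.
        assert (Cmod f <= 1) by now apply Cmod_chf_le_1. lra. }
      (* Below [t0] the kernel denominator is at most 2, so the numerator [4 * INR m] dominates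
         [2 * INR m]. *)
      apply Rle_trans with (1 * (INR m * 2)); [apply Rmult_le_compat; lra|].
      assert (Htv : 0 < t / t0 <= 1).
      { split; [apply Rdiv_lt_0_compat; lra|]. apply Rmult_le_reg_r with t0; [assumption|].
        unfold Rdiv. rewrite Rmult_assoc, Rinv_l; lra. }
      set (v := t / t0) in *. assert (Hv2 : 0 <= v ^ 2 <= 1) by nra.
      apply Rmult_le_reg_r with (1 + v ^ 2); [lra|].
      unfold Rdiv. rewrite (Rmult_assoc (4 * INR m)), Rinv_l by lra. nra. }
  set (B := exp (- (INR (n - m) * ca)) + exp (- (INR n * ca))).
  assert (Hfar : forall t, / A <= t <= PI -> Rabs (D t) <= B).
  { intros t Ht. eapply Rle_trans; [apply (re_le_Cmod (_ - _)%C)|]. unfold Cminus.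
    eapply Rle_trans; [apply Cmod_triangle|]. rewrite Cmod_opp, !Cmod_inv_integrand. unfold B.
    rewrite <- !exp_pow. specialize (Haway t Ht).
    apply Rplus_le_compat; apply pow_incr; (split; [apply Cmod_ge_0|assumption]). }
  assert (HDc : forall x, continuous D x).
  { intro x. apply (continuous_minus (fun t => fst (inv_integrand p a (n - m) (j n - j m) t))
                      (fun t => fst (inv_integrand p a n (j n) t))).
    - exact (proj1 (Ccont_inv_integrand p a (n - m) (j n - j m) Hp x)).
    - exact (proj1 (Ccont_inv_integrand p a n (j n) Hp x)). }
  assert (HB0 : 0 <= B) by (unfold B; generalize (exp_pos (- (INR (n - m) * ca)))
                              (exp_pos (- (INR n * ca))); lra).
  assert (HI := RInt_split_bound D _ (/ A) B HDc
     (fun x => continuous_plus _ _ x (continuous_kernel G1 sg x)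
        (continuous_plus _ _ x (continuous_kernel G2 sg x) (continuous_kernel (4 * INR m) t0 x)))
     ltac:(lra) HB0 Hnear Hfar).
  assert (HI3 := RInt_three_kernels G1 G2 (4 * INR m) sg sg t0 (/ A)
     HG1 HG2 ltac:(lra) Hsg Hsg Ht0 ltac:(lra)).
  assert (HId : Rabs (RInt D 0 PI) <= 2 * (G1 * sg + G2 * sg + 4 * INR m * t0) + PI * B).
  { eapply Rle_trans; [exact HI|]. apply Rplus_le_compat_r. exact HI3. }
  assert (Hdiff : convpow p (n - m) (j n - j m) - convpow p n (j n) = / PI * RInt D 0 PI).
  { rewrite !(convpow_inversion p a) by assumption. rewrite <- Rmult_minus_distr_l. f_equal.
    symmetry.
    apply (RInt_minus (V := R_CompleteNormedModule) (fun t => fst (inv_integrand p a (n - m) (j n - j m) t))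
             (fun t => fst (inv_integrand p a n (j n) t))); apply ex_RInt_cont; intro x.
    - exact (proj1 (Ccont_inv_integrand p a (n - m) (j n - j m) Hp x)).
    - exact (proj1 (Ccont_inv_integrand p a n (j n) Hp x)). }
  rewrite <- Rmult_minus_distr_l, Hdiff, !Rabs_mult.
  assert (HPIi : 0 < / PI <= 1).
  { split; [now apply Rinv_0_lt_compat|]. rewrite <- Rinv_1. apply Rinv_le_contravar; lra. }
  rewrite (Rabs_pos_eq (/ PI)) by lra.
  assert (EL : b n = L n * N) by (unfold L; fold N; field; lra).
  assert (HLn : 0 < L n) by (unfold L; fold N; now apply Rdiv_lt_0_compat).
  set (S1 := r / Rpower (1 - r) (1 + 1 / alpha)).
  set (S2 := Rpower r (eta / alpha) * Rpower (L m) eta / Rpower (1 - r) ((eta + 1) / alpha)).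
  assert (Hr : 0 < r < 1).
  { unfold r. split; [apply Rdiv_lt_0_compat; lra|].
    apply Rmult_lt_reg_r with (INR n); [lra|]. unfold Rdiv. rewrite Rmult_assoc, Rinv_l; lra. }
  assert (HS2 : 0 < S2).
  { unfold S2. apply Rdiv_lt_0_compat; [apply Rmult_lt_0_compat|]; apply Rpower_pos. }
  (* This places the contribution [8 * r] of the range [t < t0] under the summand 1 in [1 + Mv]. *)
  assert (HS1 : r <= S1).
  { unfold S1. assert (H1 : 0 < Rpower (1 - r) (1 + 1 / alpha)) by apply Rpower_pos.
    assert (H2 : Rpower (1 - r) (1 + 1 / alpha) <= 1).
    { apply Rpower_le_1; [lra|]. assert (0 < 1 / alpha) by (apply Rdiv_lt_0_compat; lra). lra. }
    apply Rmult_le_reg_r with (Rpower (1 - r) (1 + 1 / alpha)); [assumption|].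
    unfold Rdiv. rewrite Rmult_assoc, Rinv_l by lra. nra. }
  assert (F1 : N * (2 * (G1 * sg)) = QE * S2).
  { assert (H := scaling_eta alpha eta c0 (INR n) (INR m) (b m) (proj1 Halpha) Hc0 HmR HnmR Hbm).
    fold N kap in H. fold sg r in H. change (b m / Rpower (INR m) (1 / alpha)) with (L m) in H.
    fold S2 in H. unfold G1, QE. rewrite <- Rpower_mult_distr by lra.
    transitivity (4 * KE * Rpower Kk eta * (N * (Rpower (b m) eta * Rpower kap (- (eta / alpha)) * sg)));
      [ring|]. rewrite H. ring. }
  assert (F2 : N * (2 * (G2 * sg)) = QA * Mv * S1).
  { assert (H := scaling_alpha alpha c0 (INR n) (INR m) (proj1 Halpha) Hc0 HmR HnmR).
    fold N kap in H. fold sg r in H. fold S1 in H. unfold G2, QA.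
    transitivity (2 * C1 * KA * Mv * (N * (INR m * Rpower kap (- (alpha / alpha)) * sg)));
      [ring|]. rewrite H. ring. }
  assert (F3 : N * (2 * (4 * INR m * t0)) = 8 * r).
  { assert (H := scaling_one alpha (INR n) (INR m) (proj1 Halpha) ltac:(lra)).
    fold N t0 r in H.
    transitivity (8 * (N * (INR m * t0))); [ring|]. now rewrite H. }
  assert (Hlm := Hloc m (j m) Hm). set (Pm := Rabs (convpow p m (j m))) in *.
  set (I := Rabs (RInt D 0 PI)) in *. assert (HI0 : 0 <= I) by apply Rabs_pos.
  assert (HPm : 0 <= Pm) by apply Rabs_pos.
  replace (b m * b n * (Pm * (/ PI * I))) with (b m * Pm * (L n * (N * (/ PI * I)))) by (rewrite EL; ring).
  assert (HNI : N * (/ PI * I) <= QE * S2 + QA * Mv * S1 + 8 * r + N * B).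
  { apply Rle_trans with (N * (/ PI * (2 * (G1 * sg + G2 * sg + 4 * INR m * t0) + PI * B))).
    - apply Rmult_le_compat_l; [lra|]. apply Rmult_le_compat_l; lra.
    - replace (N * (/ PI * (2 * (G1 * sg + G2 * sg + 4 * INR m * t0) + PI * B)))
        with (/ PI * (N * (2 * (G1 * sg)) + N * (2 * (G2 * sg)) + N * (2 * (4 * INR m * t0))) + N * B)
        by (field; lra).
      rewrite F1, F2, F3. apply Rplus_le_compat_r.
      assert (0 <= QE * S2 + QA * Mv * S1 + 8 * r).
      { assert (0 <= QE * S2) by (apply Rmult_le_pos; lra).
        assert (0 <= QA * Mv * S1) by (apply Rmult_le_pos; [apply Rmult_le_pos|]; lra). lra. }
      nra. }
  fold B. fold N. fold S1. fold S2.
  assert (HNI0 : 0 <= N * (/ PI * I)) by (repeat apply Rmult_le_pos; lra).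
  assert (HNB : 0 <= N * B) by (apply Rmult_le_pos; lra).
  assert (HMS : 0 <= Mv * S1) by (apply Rmult_le_pos; lra).
  assert (Hfin : N * (/ PI * I) <= (QE + QA + 8 + 1) * (N * B + S1 * (1 + Mv) + S2)) by nra.
  apply Rle_trans with (C0 * (L n * (N * (/ PI * I)))).
  { apply Rmult_le_compat_r; [apply Rmult_le_pos; lra|assumption]. }
  replace (C0 * (QE + QA + 8 + 1) * L n * (N * B + S1 * (1 + Mv) + S2))
    with (C0 * (L n * ((QE + QA + 8 + 1) * (N * B + S1 * (1 + Mv) + S2)))) by ring.
  apply Rmult_le_compat_l; [lra|]. apply Rmult_le_compat_l; lra.
Qed.
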